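(* Let $\mathcal X\subset\mathbb R^q$ be open, let $X_1,\dots,X_n$ be i.i.d. with distribution $\mu$ on $\mathcal X$, let $\mu_n=\frac1n\sum_{i=1}^n\delta_{X_i}$, let $\Theta\subset\mathbb R^d$, let $\Phi:\Theta\times\mathcal X\to\mathbb R^k$ with $k\ge d$, and let $\Phi_m:\Theta\times\mathcal X\to\mathbb R^k$, $m\in\mathbb N$, be an observed sequence of approximations of $\Phi$, independent of the sample $X_1,\dots,X_n$. Suppose that: (1) $\Theta$ is compact. (2) $\theta\mapsto\int\Phi(\theta,x)\,d\mu(x)$ is continuous on $\Theta$ and has a unique zero $\theta_0$, which lies in the interior of $\Theta$. (3) For all $x\in\mathcal X$, $\theta\mapsto\Phi(\theta,x)$ is continuous on $\Theta$, and $x\mapsto\sup_{\theta\in\Theta}\Vert\Phi(\theta,x)\Vert$ is bounded by a $\mu$-integrable function. (4) There is a neighborhood $\mathcal N$ of $\theta_0$ such that, for all $x\in\mathcal X$, $\theta\mapsto\Phi(\theta,x)$ is twice continuously differentiable on $\mathcal N$, and $\Vert\nabla\Phi(\theta,x)\Vert$ and $\Vert\partial^2\Phi(\theta,x)/\partial\theta\partial\theta^t\Vert$ are continuous and bounded, for $\theta\in\mathcal N$, by a $\mu$-integrable function of $x$. (5) $D=\int\nabla\Phi(\theta_0,x)\,d\mu(x)\in\mathbb R^{d\times k}$ and $V=\int\Phi(\theta_0,x)\Phi^t(\theta_0,x)\,d\mu(x)\in\mathbb R^{k\times k}$ are of full rank. (6) $\Vert\Phi(\cdot,x)\Vert_\Theta$,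 $\Vert\nabla\Phi(\cdot,x)\Vert_{\mathcal N}$ and $\Vert\partial^2\Phi(\cdot,x)/\partial\theta\partial\theta^t\Vert_{\mathcal N}$ are dominated by a function $\kappa(x)$ such that $\int\kappa^{12}\,d\mu<\infty$. (7) For a given sequence $(\varphi_m)_{m\in\mathbb N}$ tending to infinity, $\varphi_m\Vert\Phi_m(\cdot,x)-\Phi(\cdot,x)\Vert_\Theta$ and $\varphi_m\Vert\nabla\Phi_m(\cdot,x)-\nabla\Phi(\cdot,x)\Vert_{\mathcal N}$ are dominated by a function $\kappa_m(x)$ such that $\sup_m\int\kappa_m^{12}\,d\mu<\infty$. (8) The random map $\theta\mapsto\hat W(\theta)$ is differentiable on $\mathcal N$, and $\mathbb E[(\sqrt n\Vert\hat W-W\Vert_\Theta)^6]$, $\mathbb E[(\sqrt n\Vert\nabla\hat W-\nabla W\Vert_{\mathcal N})^6]$ and $\mathbb E[(\varphi_m\Vert\hat W_m-\hat W\Vert_\Theta)^3]$ are bounded as $m,n$ range over $\mathbb N$. Let $\hat\theta_m$ and $\hat\theta$ be the two-step GMM estimators obtained with the constraint functions $\Phi_m$ and $\Phi$ respectively. Then, as $n$ and $m$ tend to infinity, $$n\,\mathbb E\big[\Vert\hat\theta_m-\hat\theta\Vert^2\big]=O(n\varphi_m^{-2})+o(1).$$ In particular, $\hat\theta_m$ is $\sqrt n$-consistent and asymptotically efficient if $n/\varphi_m^2$ tends to zero.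
   Context: $\Vert\cdot\Vert$ denotes any norm on a Euclidean space; for $f:\Theta\to E$ with $E$ Euclidean and $\mathcal S\subseteq\Theta$, $\Vert f\Vert_{\mathcal S}=\sup_{\theta\in\mathcal S}\Vert f(\theta)\Vert$. $\nabla$ denotes the derivative in $\theta$; $\nabla\Phi(\theta,x)$ is the $d\times k$ matrix with $(i,j)$ entry $\partial\Phi_j(\theta,x)/\partial\theta_i$. For $\theta\in\Theta$, $W(\theta)$ is the inverse (assumed to exist) of the covariance matrix of $\Phi(\theta,X)$, $X\sim\mu$: $$W(\theta)=\Big[\int\Phi(\theta,\cdot)\Phi^t(\theta,\cdot)\,d\mu-\int\Phi(\theta,\cdot)\,d\mu\int\Phi^t(\theta,\cdot)\,d\mu\Big]^{-1}.$$ $\hat W(\theta)$ is an arbitrary consistent estimator of $W(\theta)$ built from the observations $X_1,\dots,X_n$ and the constraint function $\Phi(\theta,\cdot)$; $\hat W_m(\theta)$ is obtained by replacing $\Phi$ by $\Phi_m$ in the expression of $\hat W(\theta)$. Two-step GMM estimator with constraint function $\Phi_m$: first let $\tilde\theta_m$ be a minimizer over $\Theta$ of $\theta\mapsto\big[\int\Phi_m^t(\theta,\cdot)\,d\mu_n\big]\big[\int\Phi_m(\theta,\cdot)\,d\mu_n\big]$; set $\tilde W_m=\hat W_m(\tilde\theta_m)$; then $\hat\theta_m$ is a minimizer over $\Theta$ of $\theta\mapsto\big[\int\Phi_m^t(\theta,\cdot)\,d\mu_n\big]\tilde W_m\big[\int\Phi_m(\theta,\cdot)\,d\mu_n\big]$.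 The two-step GMM estimator $\hat\theta$ with constraint function $\Phi$ is defined in the same way with $\Phi$, $\hat W$ in place of $\Phi_m$, $\hat W_m$. Asymptotically efficient means that the asymptotic variance of the estimator of $\theta_0$ (the limit of $n$ times its variance) equals the efficiency bound $B=[DV^{-1}D^t]^{-1}$. *)

(* Defs.v *)
From HB Require Import structures.
From mathcomp Require Import all_boot all_order all_algebra.
From mathcomp Require Import finmap.
From mathcomp Require Import all_classical all_reals all_analysis.
From mathcomp Require Import measurable_realfun.

Set Implicit Arguments.
Unset Strict Implicit.
Unset Printing Implicit Defensive.

Import Order.TTheory GRing.Theory Num.Theory.
Import numFieldNormedType.Exports.

Local Open Scope classical_set_scope.
Local Open Scope ring_scope.

(* Vectors are rows, so Phi^t and Phi of the column-vector convention are
   exchanged, and the d x k matrix with entries dPhi_j/dtheta_i is the library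
   Jacobian 'J of theta |-> Phi(theta, x). *)

Section norms.
Context (R : realType).

Definition is_norm (V : lmodType R) (N : V -> R) : Prop :=
  [/\ forall v, 0 <= N v,
      forall v, N v = 0 -> v = 0,
      forall a v, N (a *: v) = `|a| * N v &
      forall u v, N (u + v) <= N u + N v].

(* Extended-real valued: the supremum may be infinite. *)
Definition supnorm (T V : Type) (N : V -> R) (S : set T) (f : T -> V) : \bar R :=
  ereal_sup [set (N (f t))%:E | t in S].

(* The second derivative of f : R^d -> R^k, stored as a d x (d * k) matrix:
   row i holds all the derivatives of the gradient in the i-th direction. *)
Definition hessian (d k : nat) (f : 'rV[R]_d -> 'rV[R]_k) (t : 'rV[R]_d) :
    'M[R]_(d, d * k) :=
  'J (fun s => mxvec ('J f s)) t.

(* The derivative of a matrix-valued map, through mxvec. *)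
Definition mxgrad (d p r : nat) (f : 'rV[R]_d -> 'M[R]_(p, r)) (t : 'rV[R]_d) :
    'M[R]_(d, p * r) :=
  'J (fun s => mxvec (f s)) t.

(* To be used with N open. *)
Definition twice_continuously_differentiable_on (d k : nat) (N : set 'rV[R]_d)
    (f : 'rV[R]_d -> 'rV[R]_k) : Prop :=
  forall t, N t ->
    [/\ differentiable f t,
        differentiable (fun s => 'J f s) t &
        {for t, continuous (hessian f)}].

End norms.

(* R^q with its Borel sigma-algebra. *)
Notation borel_rV R q := (g_sigma_algebraType (@open 'rV[R]_q)).

Section probability_notions.
Context (R : realType) (d : measure_display) (Om : measurableType d)
  (P : probability Om R).

Definition mutually_independent (d' : measure_display) (T : measurableType d')
    (X : nat -> {RV P >-> T}) : Prop :=
  forall (J : {fset nat}) (A : nat -> set T),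
    (forall i, i \in J -> measurable (A i)) ->
    P (\bigcap_(i in [set` J]) (X i @^-1` A i)) =
    (\big[*%E/1]_(i <- J) P (X i @^-1` A i))%E.

Definition iid (d' : measure_display) (T : measurableType d')
    (mu : probability T R) (X : nat -> {RV P >-> T}) : Prop :=
  mutually_independent X /\
  forall i A, measurable A -> distribution P (X i) A = mu A.

(* The sigma-algebra generated by the maps f i, for i in D. *)
Definition sigma_of (I : Type) (d' : measure_display) (T : measurableType d')
    (D : set I) (f : I -> Om -> T) : set (set Om) :=
  <<s \bigcup_(i in D) preimage_set_system setT (f i) measurable >>.

Definition independent_sigma (F G : set (set Om)) : Prop :=
  forall A B, F A -> G B -> P (A `&` B) = (P A * P B)%E.

Definition measurable_mx (p r : nat) (Y : Om -> 'M[R]_(p, r)) : Prop :=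
  forall i j, measurable_fun setT (fun w => Y w i j).

Definition consistent_in_probability (V : lmodType R) (N : V -> R)
    (est : nat -> Om -> V) (v : V) : Prop :=
  forall e : R, 0 < e -> P [set w | e <= N (est n w - v)] @[n --> \oo] --> 0%E.

Definition root_n_consistent (V : lmodType R) (N : V -> R)
    (est : nat -> Om -> V) (v : V) : Prop :=
  forall e : R, 0 < e -> exists K : R,
    \forall n \near \oo,
      (P [set w | (K < Num.sqrt n%:R * N (est n w - v))%R] <= e%:E)%E.

(* n times the covariance matrix of the n-th estimator tends to B. *)
Definition asymptotic_variance (p : nat) (est : nat -> Om -> 'rV[R]_p)
    (B : 'M[R]_p) : Prop :=
  forall i j : 'I_p,
    (n%:R%:E * covariance P (fun w => est n w 0%R i) (fun w => est n w 0%R j))%E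
      @[n --> \oo] --> (B i j)%:E.

End probability_notions.

Section moments.
Context (R : realType) (dT : measure_display) (T : measurableType dT)
  (mu : {measure set T -> \bar R}) (XX : set T).

Definition mxint (p r : nat) (F : T -> 'M[R]_(p, r)) : 'M[R]_(p, r) :=
  \matrix_(i, j) (\int[mu]_(x in XX) (F x i j)).

Definition second_moment (k : nat) (f : T -> 'rV[R]_k) : 'M[R]_k :=
  mxint (fun x => (f x)^T *m f x).

Definition covmx (k : nat) (f : T -> 'rV[R]_k) : 'M[R]_k :=
  second_moment f - (mxint f)^T *m mxint f.

Definition optimal_weight (d k : nat) (Phi : 'rV[R]_d -> T -> 'rV[R]_k)
    (t : 'rV[R]_d) : 'M[R]_k :=
  invmx (covmx (Phi t)).

Definition mean_jacobian (d k : nat) (Phi : 'rV[R]_d -> T -> 'rV[R]_k)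
    (t : 'rV[R]_d) : 'M[R]_(d, k) :=
  mxint (fun x => 'J (fun s => Phi s x) t).

Definition efficiency_bound (d k : nat) (Phi : 'rV[R]_d -> T -> 'rV[R]_k)
    (t : 'rV[R]_d) : 'M[R]_d :=
  invmx (mean_jacobian Phi t *m invmx (second_moment (Phi t))
           *m (mean_jacobian Phi t)^T).

End moments.

Section gmm.
Context (R : realType) (U : Type) (d k : nat).
Implicit Types (Phi : 'rV[R]_d -> U -> 'rV[R]_k) (Theta : set 'rV[R]_d).

(* The integral of f against the empirical measure of the sample s. *)
Definition empirical_mean (n : nat) (s : n.-tuple U) (f : U -> 'rV[R]_k) :
    'rV[R]_k :=
  n%:R^-1 *: \sum_(i < n) f (tnth s i).

Definition minimizer (A : Type) (S : set A) (Q : A -> R) (a : A) : Prop :=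
  S a /\ forall b, S b -> Q a <= Q b.

Definition gmm_criterion1 Phi (n : nat) (s : n.-tuple U) (t : 'rV[R]_d) : R :=
  (empirical_mean s (Phi t) *m (empirical_mean s (Phi t))^T) 0 0.

Definition gmm_criterion Phi (M : 'M[R]_k) (n : nat) (s : n.-tuple U)
    (t : 'rV[R]_d) : R :=
  (empirical_mean s (Phi t) *m M *m (empirical_mean s (Phi t))^T) 0 0.

Definition sample (Om : Type) (X : nat -> Om -> U) (n : nat) (w : Om) :
    n.-tuple U :=
  [tuple X i w | i < n].

(* What n s f is the weight estimate computed from the observations s and the
   constraint function f; replacing Phi by Phi_m in What n s (Phi t) gives the
   estimator attached to Phi_m. *)
Definition weight_estimator
    (What : forall n, n.-tuple U -> (U -> 'rV[R]_k) -> 'M[R]_k)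
    Phi (n : nat) (s : n.-tuple U) (t : 'rV[R]_d) : 'M[R]_k :=
  What n s (Phi t).

Definition two_step_gmm Theta
    (What : forall n, n.-tuple U -> (U -> 'rV[R]_k) -> 'M[R]_k)
    Phi (n : nat) (s : n.-tuple U) (t : 'rV[R]_d) : Prop :=
  exists2 t1, minimizer Theta (gmm_criterion1 Phi s) t1 &
    minimizer Theta (gmm_criterion Phi (weight_estimator What Phi s t1) s) t.

End gmm.

(* Main.v *)
(** Write a for the empirical mean of Phi at theta0, W0 = V^-1 and
    L = a W0 D^T (D W0 D^T)^-1. Both estimators expand as theta0 - L + r with
    the same L, so that thetahat_m - thetahat is a difference of two remainders;
    moreover L is centred and n times its covariance is exactly B.

    The remainder is controlled on the event that the uniform law of large numbers
    for Phi, the law of large numbers for its Jacobian at theta0 and the two bounds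
    on the weight estimators hold up to e. There the criteria are close to their
    limits, whose minimizer is well separated, so the estimator lies near theta0 and
    satisfies a first-order condition; solving it by the mean value theorem gives
    |r| <= C (e |a| + c_m), with C independent of e and c_m the error made by
    replacing Phi with Phi_m in the empirical means. By moment bounds the complement
    has probability O(n^-2 + phi_m^-3), and there r is bounded by a constant plus a
    multiple of |a|. Since n E|a|^2 and n^2 E|a|^4 are bounded and
    E c_m^2 = O(phi_m^-2), letting e tend to 0 gives n E|r|^2 <= C n / phi_m^2 + o(1):
    the factor n phi_m^-3 is at most n phi_m^-2 times a null sequence. *)

Require Import Defs.
From HB Require Import structures.
From mathcomp Require Import all_boot all_order all_algebra.
From mathcomp Require Import finmap.
From mathcomp Require Import all_classical all_reals all_analysis.
From mathcomp Require Import measurable_realfun.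
From mathcomp Require Import ring lra.

Set Implicit Arguments.
Unset Strict Implicit.
Unset Printing Implicit Defensive.

Import Order.TTheory GRing.Theory Num.Theory.
Import numFieldNormedType.Exports.

Local Open Scope classical_set_scope.
Local Open Scope ring_scope.

(** * Moments of sums of independent variables *)

(** Convergence in probability does not control second moments: on the exceptional event the
    estimators are only known to lie in the compact set [Theta], so n times its probability has to
    be negligible against n / phi_m^2 + 1. Fourth moments of empirical means give n^-2 through
    Markov's inequality, the sixth moment of the weight error gives even n^-3, and phi_m^-3 is what
    the third moment of the distance between the two weight estimators provides. Conditions uniform
    in theta define events that need not be measurable, so an exceptional event is only required to
    lie in a measurable one of small probability. The analysis of the minimizers is kept free of
    probability. It fixes its constant before the accuracy e, and the approximation enters it only
    through a number c, so that one expansion covers both estimators, c = 0 being the exact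
    constraint function. *)

Section independence.
Context (R : realType) (d : measure_display) (Om : measurableType d)
  (P : probability Om R).

(** The product formula on rectangles identifies the law of the pair with the product of the
    marginal laws; Fubini's theorem then separates the two factors. *)
Lemma expectation_mul_indep (Y Z : Om -> R) :
  measurable_fun setT Y -> measurable_fun setT Z ->
  (forall A B, measurable A -> measurable B ->
     P ((Y @^-1` A) `&` (Z @^-1` B)) = (P (Y @^-1` A) * P (Z @^-1` B))%E) ->
  P.-integrable setT (EFin \o Y) -> P.-integrable setT (EFin \o Z) ->
  P.-integrable setT (EFin \o (fun w => Y w * Z w)) ->
  \int[P]_w (Y w * Z w) = (\int[P]_w Y w) * (\int[P]_w Z w).
Proof.
move=> mY mZ YZ iY iZ iYZ.
pose Y' : {mfun Om >-> R} := mfun_Sub (mem_set mY).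
pose Z' : {mfun Om >-> R} := mfun_Sub (mem_set mZ).
have mYZ : measurable_fun setT (fun w => (Y w, Z w)) by exact: measurable_fun_pair.
pose V : {mfun Om >-> (R * R)%type} := mfun_Sub (mem_set mYZ).
pose f (z : R * R) : \bar R := (z.1 * z.2)%:E.
have mf : measurable_fun setT f.
  by apply/measurable_EFinP; apply: measurable_funM.
have E (g : R * R -> \bar R) : (\int[pushforward P V]_z g z =
    \int[(distribution P Y' \x distribution P Z')%E]_z g z)%E.
  apply: eq_measure_integral => A mA _; apply/esym.
  by apply: product_measure_unique => // B C mB mC; rewrite -YZ.
have intf : (distribution P Y' \x distribution P Z')%E.-integrable setT f.
  apply/integrableP; split => //.
  rewrite -E ge0_integral_pushforward//.
    by have /integrableP[] := iYZ.
  by apply: measurableT_comp.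
have := E f; rewrite (@integral_pushforward _ _ _ _ R _ mYZ P setT f mf iYZ measurableT).
rewrite preimage_setT => E1.
rewrite /Rintegral [X in fine X](_ : _ = (\int[P]_(x in setT) (f \o V) x)%E)//.
rewrite E1 -integral12_prod_meas1//=.
have iY' : (distribution P Y').-integrable setT EFin.
  exact: (@integrable_pushforward _ _ _ _ R _ mY P setT).
have iZ' : (distribution P Z').-integrable setT EFin.
  exact: (@integrable_pushforward _ _ _ _ R _ mZ P setT).
have EZ : (\int[distribution P Z']_y y%:E)%E = (\int[P]_w (Z w)%:E)%E.
  by rewrite integral_distribution.
have EY : (\int[distribution P Y']_y y%:E)%E = (\int[P]_w (Y w)%:E)%E.
  by rewrite integral_distribution.
have fZ : (\int[P]_w (Z w)%:E)%E \is a fin_num by exact: integrable_fin_num.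
have fY : (\int[P]_w (Y w)%:E)%E \is a fin_num by exact: integrable_fin_num.
under eq_integral => x _.
  rewrite /fubini_F/=; under eq_integral do rewrite /f/= EFinM.
  rewrite integralZl// EZ -(fineK fZ).
  over.
by rewrite integralZr// EY -(fineK fY) -EFinM fineK// -fineM.
Qed.

Context (d' : measure_display) (T : measurableType d') (X : nat -> {RV P >-> T}).

(* A pi-system generating the sigma-algebra of X_0, ..., X_{n-1}. *)
Definition past (n : nat) : set (set Om) :=
  [set E | exists2 A : nat -> set T, forall i, measurable (A i) &
     E = \bigcap_(i in [set` [fset i | i in iota 0 n]%fset]) (X i @^-1` A i)].

(** Dynkin's argument: for fixed [B] the events satisfying the product formula form a lambda-system,
    which contains the pi-system [past n] because mutual independence also applies to the index set
    enlarged by [n]. *)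
Lemma past_indep n E B : mutually_independent X -> <<s past n >> E ->
  measurable B -> P (E `&` (X n @^-1` B)) = (P E * P (X n @^-1` B))%E.
Proof.
move=> iX pE mB.
have mXB : measurable (X n @^-1` B).
  by rewrite -[_ @^-1` _]setTI; exact: measurable_funPT.
pose H := [set E | measurable E /\
  P (E `&` (X n @^-1` B)) = (P E * P (X n @^-1` B))%E].
suff: H E by case.
move: E pE; apply: lambda_system_subset => //.
- move=> _ _ [A1 mA1 ->] [A2 mA2 ->]; exists (fun i => A1 i `&` A2 i).
    by move=> i; exact: measurableI.
  rewrite -bigcapI; apply: eq_bigcapr => i _.
  by rewrite preimage_setI.
- apply/dynkin_lambda_system; split.
  + by split => //; rewrite setTI probability_setT mul1e.
  + move=> E [mE PE]; split; first exact: measurableC.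
    rewrite setIC -setDE measureD//; last first.
      by rewrite (le_lt_trans (probability_le1 _ _)) ?ltry.
    rewrite (setIC _ E) probability_setC//.
    transitivity (P (X n @^-1` B) - P E * P (X n @^-1` B))%E.
      by congr (_ - _)%E; exact: PE.
    rewrite muleBl ?mul1e//.
      exact: fin_num_measure.
  + move=> F tF HF; split; first by apply: bigcup_measurable => i _; case: (HF i).
    have mF i : measurable (F i) by case: (HF i).
    have tF' : trivIset setT (fun i => F i `&` (X n @^-1` B)).
      exact: trivIset_setIr.
    rewrite setI_bigcupl !measure_bigcup//.
    - rewrite muleC -(fineK (fin_num_measure P _ mXB)) -nneseriesZl//.
      by apply: eq_eseriesr => i _; case: (HF i) => _ /[dup] PF; rewrite muleC fineK ?fin_num_measure// => <-.
    - by move=> i _; apply: measurableI.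
- move=> _ [A mA ->]; split.
    apply: fin_bigcap_measurable => // i _.
    by rewrite -[_ @^-1` _]setTI; exact: measurable_funPT.
  pose A' i := if i == n then B else A i.
  have nn : n \notin [fset i | i in iota 0 n]%fset.
    by rewrite !inE mem_iota add0n ltnn.
  have mA' i : measurable (A' i) by rewrite /A'; case: ifP.
  have := iX (n |` [fset i | i in iota 0 n])%fset A' (fun i _ => mA' i).
  rewrite big_fsetU1//= -iX//.
  rewrite set_fsetU1 bigcap_setU1 {1 3}/A' eqxx => EE.
  rewrite setIC muleC -/A'; move: EE.
  rewrite (@eq_bigcapr _ _ _ _ (fun i => X i @^-1` A i)); last first.
    by move=> i /= ii; rewrite /A'; case: eqP => // ein; move: nn; rewrite -[X in X \notin _]ein ii.
  exact.
Qed.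

Lemma past_sum n (f : T -> R) : measurable_fun setT f ->
  @measurable_fun _ _ (g_sigma_algebraType (past n)) R setT
    (fun w => \sum_(i < n) f (X i w)).
Proof.
move=> mf; apply: measurable_sum => i _ B mB; rewrite setTI.
apply: sub_sigma_algebra.
(* The cylinder that constrains the [i]-th observation only. *)
exists (fun j => if j == i :> nat then f @^-1` B else setT).
  move=> j; case: ifP => // _; rewrite -[_ @^-1` _]setTI; exact: mf.
apply/seteqP; split => w /=.
  by move=> fB j _ /=; case: ifP => // /eqP ->.
have ii : [set` [fset j | j in iota 0 n]%fset] (val i).
  by rewrite /= !inE mem_iota add0n /=.
by move=> /(_ _ ii) /=; rewrite eqxx.
Qed.

End independence.

Section integrable_functions.
Context (R : realType) (d : measure_display) (T : measurableType d)
  (P : probability T R).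
Implicit Types a b : T -> R.

Definition Rintegrable a := P.-integrable setT (EFin \o a).

Lemma Rintegrable_measurable a : Rintegrable a -> measurable_fun setT a.
Proof. by move=> /measurable_int /measurable_EFinP. Qed.

Lemma Rintegrable_eq a b : a =1 b -> Rintegrable a -> Rintegrable b.
Proof. by move=> ab; apply: eq_integrable => // x _ /=; rewrite ab. Qed.

Lemma RintegrableD a b : Rintegrable a -> Rintegrable b ->
  Rintegrable (fun x => a x + b x).
Proof. by move=> ia ib; have := integrableD measurableT ia ib; apply. Qed.

Lemma RintegrableB a b : Rintegrable a -> Rintegrable b ->
  Rintegrable (fun x => a x - b x).
Proof. by move=> ia ib; have := integrableB measurableT ia ib; apply. Qed.

Lemma RintegrableZ r a : Rintegrable a -> Rintegrable (fun x => r * a x).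
Proof. by move=> ia; have := integrableZl measurableT r ia; apply. Qed.

Lemma Rintegrable_sum (I : Type) (s : seq I) (f : I -> T -> R) :
  (forall i, Rintegrable (f i)) -> Rintegrable (fun x => \sum_(i <- s) f i x).
Proof.
move=> fi; elim: s => [|i s IH].
  apply: Rintegrable_eq (integrable0 P setT) => x /=; by rewrite big_nil.
by apply: Rintegrable_eq (RintegrableD (fi i) IH) => x /=; rewrite big_cons.
Qed.

Lemma Rintegrable_cst r : Rintegrable (fun=> r).
Proof. exact: finite_measure_integrable_cst. Qed.

Lemma Rintegrable_le a b : measurable_fun setT a -> Rintegrable b ->
  (forall x, `|a x| <= b x) -> Rintegrable a.
Proof.
move=> ma ib ab; apply: le_integrable ib => //; first exact/measurable_EFinP.
by move=> x _ /=; rewrite lee_fin (le_trans (ab x))// ler_norm.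
Qed.

Lemma RintegralE a : Rintegrable a ->
  (\int[P]_x (a x)%:E)%E = (\int[P]_x a x)%:E.
Proof. by move=> ia; rewrite fineK//; exact: integrable_fin_num ia. Qed.

Lemma Rintegral1 r : \int[P]_x r = r :> R.
Proof.
rewrite (Rintegral_cst P measurableT).
by rewrite [X in fine X](_ : _ = 1%E) ?mulr1//; exact: probability_setT.
Qed.

(** The working level of integrability: a fourth moment is what Markov's inequality needs to give
    deviations of empirical means probability O(n^-2). *)
Definition L4 a := measurable_fun setT a /\ Rintegrable (fun x => a x ^+ 4).

Lemma L4_cst r : L4 (fun=> r).
Proof. by split => //; exact: Rintegrable_cst. Qed.

Lemma L4_le a b : measurable_fun setT a -> L4 b ->
  (forall x, `|a x| <= b x) -> L4 a.
Proof.
move=> ma [mb ib] ab; split => //.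
apply: Rintegrable_le ib _; first exact: measurable_funX.
move=> x; rewrite normrX; apply: lerXn2r; rewrite ?nnegrE//.
exact: le_trans (ab x).
Qed.

(** Stands in for Hölder's inequality in [Rintegrable4]; it follows from 2 |xy zt| <= (xy)^2 +
    (zt)^2 and 2 x^2 y^2 <= x^4 + y^4. *)
Lemma normr4_le (x y z t : R) :
  `|x * y * z * t| <= x ^+ 4 + y ^+ 4 + z ^+ 4 + t ^+ 4.
Proof.
have s1 := sqr_ge0 (x * y - z * t); have s2 := sqr_ge0 (x * y + z * t).
have s3 := sqr_ge0 (x ^+ 2 - y ^+ 2); have s4 := sqr_ge0 (z ^+ 2 - t ^+ 2).
have s5 := sqr_ge0 (x ^+ 2 + y ^+ 2); have s6 := sqr_ge0 (z ^+ 2 + t ^+ 2).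
rewrite ler_norml; apply/andP; split; lra.
Qed.

Lemma Rintegrable4 a b c e : L4 a -> L4 b -> L4 c -> L4 e ->
  Rintegrable (fun x => a x * b x * c x * e x).
Proof.
move=> [ma ia] [mb ib] [mc ic] [me ie].
apply: Rintegrable_le (RintegrableD (RintegrableD (RintegrableD ia ib) ic) ie) _.
  by do 3 apply: measurable_funM => //.
by move=> x; exact: normr4_le.
Qed.

Lemma Rintegrable2 a b : L4 a -> L4 b -> Rintegrable (fun x => a x * b x).
Proof.
move=> La Lb; apply: Rintegrable_eq (Rintegrable4 La Lb (L4_cst 1) (L4_cst 1)).
by move=> x /=; rewrite !mulr1.
Qed.

Lemma L4_Rintegrable a : L4 a -> Rintegrable a.
Proof.
move=> La; apply: Rintegrable_eq (Rintegrable2 La (L4_cst 1)).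
by move=> x /=; rewrite mulr1.
Qed.

Lemma L4D a b : L4 a -> L4 b -> L4 (fun x => a x + b x).
Proof.
move=> La Lb; have [ma _] := La; have [mb _] := Lb; split.
  exact: measurable_funD.
have ii := fun e f g h => @Rintegrable4 e f g h.
have i1 := RintegrableD (ii _ _ _ _ La La La La) (RintegrableZ 4 (ii _ _ _ _ La La La Lb)).
have i2 := RintegrableD i1 (RintegrableZ 6 (ii _ _ _ _ La La Lb Lb)).
have i3 := RintegrableD i2 (RintegrableZ 4 (ii _ _ _ _ La Lb Lb Lb)).
have i4 := RintegrableD i3 (ii _ _ _ _ Lb Lb Lb Lb).
apply: Rintegrable_eq i4 => x /=; ring.
Qed.

Lemma L4Z r a : L4 a -> L4 (fun x => r * a x).
Proof.
move=> [ma ia]; split; first exact: measurable_funM.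
by apply: Rintegrable_eq (RintegrableZ (r ^+ 4) ia) => x; rewrite exprMn.
Qed.

Lemma L4_sum (I : Type) (s : seq I) (f : I -> T -> R) :
  (forall i, L4 (f i)) -> L4 (fun x => \sum_(i <- s) f i x).
Proof.
move=> fi; elim: s => [|i s IH].
  by rewrite (_ : (fun=> _) = fun=> 0) ?funeqE; [exact: L4_cst|move=> x; rewrite big_nil].
rewrite (_ : (fun=> _) = fun x => f i x + \sum_(j <- s) f j x); first exact: L4D.
by apply/funext => x; rewrite big_cons.
Qed.

End integrable_functions.

Section iid_moments.
Context (R : realType) (d : measure_display) (Om : measurableType d)
  (P : probability Om R) (d' : measure_display) (T : measurableType d')
  (mu : probability T R) (X : nat -> {RV P >-> T}) (Xiid : iid mu X).
Implicit Types f g h : T -> R.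

Lemma ge0_integral_iid (f : T -> \bar R) i : measurable_fun setT f ->
  (forall x, 0 <= f x)%E ->
  (\int[P]_w f (X i w))%E = (\int[mu]_x f x)%E.
Proof.
move=> mf f0.
have := ge0_integral_distribution (X i) mf f0 => /= <-.
by apply: eq_measure_integral => A mA _; exact: Xiid.2.
Qed.

Lemma Rintegrable_iid f i : Rintegrable mu f -> Rintegrable P (f \o X i).
Proof.
move=> intf; have mf := Rintegrable_measurable intf.
apply/integrableP; split; first by apply/measurable_EFinP; exact: measurableT_comp.
rewrite [ltLHS](_ : _ = (\int[mu]_x `|(f x)%:E|)%E).
  by have /integrableP[] := intf.
rewrite -(@ge0_integral_iid (fun x => `|(f x)%:E|%E) i)//.
by apply: measurableT_comp => //; exact/measurable_EFinP.
Qed.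

Lemma Rintegral_iid f i : Rintegrable mu f ->
  \int[P]_w f (X i w) = \int[mu]_x f x.
Proof.
move=> intf; have mf := Rintegrable_measurable intf; congr fine.
have /= <- := @integral_distribution _ _ _ _ _ P (X i) (EFin \o f) _
  (Rintegrable_iid i intf); last exact/measurable_EFinP.
by apply: eq_measure_integral => A mA _; exact: Xiid.2.
Qed.

Lemma L4_iid f i : L4 mu f -> L4 P (f \o X i).
Proof.
move=> [mf i4]; split; first exact: measurableT_comp.
exact: (Rintegrable_iid i i4).
Qed.

Definition isum f n w := \sum_(i < n) f (X i w).

Lemma isumS f n w : isum f n.+1 w = isum f n w + f (X n w).
Proof. by rewrite /isum big_ord_recr. Qed.

Lemma isum0 f w : isum f 0 w = 0. Proof. by rewrite /isum big_ord0. Qed.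

Lemma L4_isum f n : L4 mu f -> L4 P (isum f n).
Proof. by move=> Lf; apply: L4_sum => i; exact: L4_iid. Qed.

(** The sum of the first [n] terms is measurable for the past, hence independent of [X n]. The
    inductions below peel off the last observation with this; [u] is there to treat powers of the
    sum. *)
Lemma Rintegral_isum_mul f h n (u : R -> R) : measurable_fun setT f ->
  measurable_fun setT u ->
  Rintegrable P (fun w => u (isum f n w)) -> Rintegrable mu h ->
  Rintegrable P (fun w => u (isum f n w) * h (X n w)) ->
  \int[P]_w (u (isum f n w) * h (X n w)) =
  \int[P]_w u (isum f n w) * \int[mu]_x h x.
Proof.
move=> mf mu' iu ih iuh; rewrite -(Rintegral_iid n ih).
apply: expectation_mul_indep => //.
- exact: Rintegrable_measurable iu.
- exact: Rintegrable_measurable (Rintegrable_iid n ih).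
- move=> A B mA mB; rewrite (_ : (fun w => h (X n w)) @^-1` B = X n @^-1` (h @^-1` B))//.
  apply: past_indep; first exact: Xiid.1.
    have ms := @past_sum _ _ _ P _ _ X n _ mf.
    have := measurableT_comp mu' ms measurableT mA.
    by rewrite setTI.
  rewrite -[_ @^-1` _]setTI.
  exact: (Rintegrable_measurable ih).
- exact: Rintegrable_iid.
Qed.

Lemma Rintegral_isum2 g h n : L4 mu g -> L4 mu h ->
  \int[mu]_x g x = 0 -> \int[mu]_x h x = 0 ->
  \int[P]_w (isum g n w * isum h n w) = n%:R * \int[mu]_x (g x * h x).
Proof.
move=> Lg Lh g0 h0; have [mg _] := Lg; have [mh _] := Lh.
elim: n => [|n IH].
  rewrite mul0r; under eq_Rintegral do rewrite !isum0 mul0r.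
  exact: Rintegral1.
have Sg := L4_isum n Lg; have Sh := L4_isum n Lh.
have Xg := L4_iid n Lg; have Xh := L4_iid n Lh.
have i1 := Rintegrable2 Sg Sh.
have i2 := Rintegrable2 Sg Xh.
have i3 := Rintegrable2 Sh Xg.
have i4 := Rintegrable2 Xg Xh.
transitivity (\int[P]_w (isum g n w * isum h n w + isum g n w * h (X n w) +
    isum h n w * g (X n w) + g (X n w) * h (X n w))).
  by apply: eq_Rintegral => w _; rewrite !isumS; ring.
rewrite RintegralD//; last exact: RintegrableD (RintegrableD i1 i2) i3.
rewrite RintegralD//; last exact: RintegrableD i1 i2.
rewrite RintegralD// IH.
rewrite (Rintegral_isum_mul mg (u := id))//; last 2 first.
- exact: L4_Rintegrable.
- exact: L4_Rintegrable.
rewrite (Rintegral_isum_mul mh (u := id))//; last 2 first.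
- exact: L4_Rintegrable.
- exact: L4_Rintegrable.
rewrite g0 h0 !mulr0 !addr0 (Rintegral_iid n (Rintegrable2 Lg Lh)).
by rewrite -addn1 natrD mulrDl mul1r.
Qed.

Lemma Rintegral_isum1 g n : L4 mu g -> \int[mu]_x g x = 0 ->
  \int[P]_w isum g n w = 0.
Proof.
move=> Lg g0; have [mg _] := Lg.
elim: n => [|n IH]; first by under eq_Rintegral do rewrite isum0; exact: Rintegral1.
under eq_Rintegral do rewrite isumS.
rewrite RintegralD//; [|exact/L4_Rintegrable/L4_isum|exact/L4_Rintegrable/L4_iid].
by rewrite IH Rintegral_iid ?g0 ?addr0//; exact: L4_Rintegrable.
Qed.

(** In the expansion of (S + G)^4 the terms S^3 G and S G^3 have mean zero, since G and S are
    centred and independent. What remains adds 6 n s2^2 + m4 at each step, which sums to at most 3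
    s2^2 n^2 + m4 n. *)
Lemma Rintegral_isum4_le g : L4 mu g -> \int[mu]_x g x = 0 ->
  exists2 K : R, 0 <= K & forall n, \int[P]_w (isum g n w ^+ 4) <= K * n%:R ^+ 2.
Proof.
move=> Lg g0; have [mg _] := Lg.
pose s2 := \int[mu]_x (g x * g x); pose m4 := \int[mu]_x (g x ^+ 4).
have m40 : 0 <= m4 by apply: Rintegral_ge0 => x _; rewrite exprn_even_ge0.
exists (3 * s2 ^+ 2 + m4).
  by rewrite addr_ge0// mulr_ge0// sqr_ge0.
suff H n : \int[P]_w (isum g n w ^+ 4) <= 3 * s2 ^+ 2 * n%:R ^+ 2 + m4 * n%:R.
  move=> n; apply: le_trans (H n) _; rewrite [leRHS]mulrDl; apply: lerD => //.
  rewrite ler_wpM2l//.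
  case: n => [|n]; first by rewrite expr0n.
  by rewrite expr2 ler_peMr ?ler0n// ler1n.
elim: n => [|n IH].
  rewrite (_ : Rintegral _ _ _ = 0); first by rewrite expr0n/= !mulr0 addr0.
  by under eq_Rintegral do rewrite isum0 expr0n/=; exact: Rintegral1.
have Sg := L4_isum n Lg; have Xg := L4_iid n Lg.
have L1 := L4_cst P 1; have M1 := L4_cst mu 1.
pose S := isum g n; pose G w := g (X n w).
have iS4 : Rintegrable P (fun w => S w ^+ 4) by case: Sg.
have iG4 : Rintegrable P (fun w => G w ^+ 4) by case: Xg.
have i31 : Rintegrable P (fun w => S w ^+ 3 * G w).
  by apply: Rintegrable_eq (Rintegrable4 Sg Sg Sg Xg) => w; rewrite /S /G/=; ring.
have i22 : Rintegrable P (fun w => S w ^+ 2 * G w ^+ 2).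
  by apply: Rintegrable_eq (Rintegrable4 Sg Sg Xg Xg) => w; rewrite /S /G/=; ring.
have i13 : Rintegrable P (fun w => S w * G w ^+ 3).
  by apply: Rintegrable_eq (Rintegrable4 Sg Xg Xg Xg) => w; rewrite /S /G/=; ring.
have iS3 : Rintegrable P (fun w => S w ^+ 3).
  by apply: Rintegrable_eq (Rintegrable4 Sg Sg Sg L1) => w; rewrite /S /G/=; ring.
have iS2 : Rintegrable P (fun w => S w ^+ 2).
  by apply: Rintegrable_eq (Rintegrable2 Sg Sg) => w; rewrite /S /G/=; ring.
have ig3 : Rintegrable mu (fun x => g x ^+ 3).
  by apply: Rintegrable_eq (Rintegrable4 Lg Lg Lg M1) => w /=; ring.
have ig2 : Rintegrable mu (fun x => g x ^+ 2).
  by apply: Rintegrable_eq (Rintegrable2 Lg Lg) => w /=; ring.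
rewrite [leLHS](_ : _ = \int[P]_w (S w ^+ 4 + 4 * (S w ^+ 3 * G w) +
  6 * (S w ^+ 2 * G w ^+ 2) + 4 * (S w * G w ^+ 3) + G w ^+ 4)); last first.
  by apply: eq_Rintegral => w _; rewrite isumS /S /G; ring.
have j1 := RintegrableD iS4 (RintegrableZ 4 i31).
have j2 := RintegrableD j1 (RintegrableZ 6 i22).
have j3 := RintegrableD j2 (RintegrableZ 4 i13).
rewrite RintegralD// RintegralD//; last exact: RintegrableZ.
rewrite RintegralD//; last exact: RintegrableZ.
rewrite RintegralD//; last exact: RintegrableZ.
rewrite !RintegralZl//.
rewrite (Rintegral_isum_mul mg (u := fun z => z ^+ 3) (h := g))//; last exact: L4_Rintegrable.
rewrite (Rintegral_isum_mul mg (u := fun z => z ^+ 2) (h := fun x => g x ^+ 2))//.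
rewrite (Rintegral_isum_mul mg (u := id) (h := fun x => g x ^+ 3))//; last first.
  exact/L4_Rintegrable.
rewrite (@Rintegral_isum1 g n)// g0 mulr0 mul0r !mulr0 !addr0.
rewrite (@Rintegral_iid (fun x => g x ^+ 4) n)//; last by case: Lg.
have -> : \int[P]_w (isum g n w ^+ 2) = n%:R * s2.
  by rewrite -Rintegral_isum2.
have -> : \int[mu]_x (g x ^+ 2) = s2 by [].
rewrite -/m4 -natr1.
have : 0 <= s2 ^+ 2 by exact: sqr_ge0.
move: IH; rewrite -/S; nra.
Qed.

End iid_moments.

(** * Moduli of continuity *)

Section matrix_norm.
Context (R : realType).

Lemma mxnorm_le (m n : nat) (A : 'M[R]_(m, n)) (r : R) : 0 <= r ->
  (forall i j, `|A i j| <= r) -> `|A| <= r.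
Proof.
move=> r0 Ar; rewrite [leLHS]/Num.Def.normr/= mx_normrE.
by apply/bigmax_leP; split => // -[i j] _; exact: Ar.
Qed.

Lemma mxentry_le (m n : nat) (A : 'M[R]_(m, n)) i j : `|A i j| <= `|A|.
Proof.
rewrite [leRHS]/Num.Def.normr/= mx_normrE.
by apply: (le_bigmax _ (fun ij : 'I_m * 'I_n => `|A ij.1 ij.2|) (i, j)).
Qed.

Lemma mxnorm_lt (m n : nat) (A : 'M[R]_(m, n)) (r : R) : 0 < r ->
  (forall i j, `|A i j| < r) -> `|A| < r.
Proof.
move=> r0 Ar; rewrite [ltLHS]/Num.Def.normr/= mx_normrE.
by apply/bigmax_ltP; split => // -[i j] _; exact: Ar.
Qed.

(** The norm is the largest absolute value of an entry, which is not submultiplicative; hence the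
    inner dimension as a factor. *)
Lemma mxnormM_le (m n p : nat) (A : 'M[R]_(m, n)) (B : 'M[R]_(n, p)) :
  `|A *m B| <= n%:R * `|A| * `|B|.
Proof.
apply: mxnorm_le; first by rewrite !mulr_ge0.
move=> i j; rewrite mxE (le_trans (ler_norm_sum _ _ _))//.
have -> : n%:R * `|A| * `|B| = \sum_(l < n) (`|A| * `|B|).
  by rewrite sumr_const card_ord -mulrA mulr_natl.
by apply: ler_sum => l _; rewrite normrM ler_pM ?mxentry_le.
Qed.

Lemma mxnorm_tr (m n : nat) (A : 'M[R]_(m, n)) : `|A^T| = `|A|.
Proof.
apply/eqP; rewrite eq_le; apply/andP; split; apply: mxnorm_le => // i j.
  by rewrite mxE mxentry_le.
by have := mxentry_le A^T j i; rewrite mxE.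
Qed.

End matrix_norm.

Section dense_sequence.
Context (R : realType) (d : nat).

(** Balls with rational centre and radius 1 / (i + 1) are countable in number; choose a point of [A]
    in each one that meets [A], and any point of [A] for the others. *)
Lemma dense_sequence (A : set 'rV[R]_d) : A !=set0 ->
  exists e : nat -> 'rV[R]_d, (forall n, A (e n)) /\
    forall t r, A t -> 0 < r -> exists n, `|e n - t| < r.
Proof.
move=> [a0 Aa0].
pose near_pt (c : 'rV[rat]_d * nat) s :=
  A s /\ `|s - map_mx ratr c.1| < c.2.+1%:R^-1.
have /choice[e0 e0P] : forall c, exists s, A s /\
    ((exists s', near_pt c s') -> near_pt c s).
  move=> c; have [[s ns]|no] := pselect (exists s', near_pt c s').
    by exists s; split => //; case: ns.
  by exists a0.
exists (fun n => e0 (odflt (0, 0%N) (@choice.unpickle ('rV[rat]_d * nat)%type n))); split=> [n|t r At r0].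
  by case: (e0P (odflt (0, 0%N) (@choice.unpickle ('rV[rat]_d * nat)%type n))).
have [i ir] : exists i : nat, i.+1%:R^-1 < r / 2.
  have /ltr_add_invr[i] : 0 < r / 2 by rewrite divr_gt0.
  by rewrite add0r => ?; exists i.
have i0 : 0 < i.+1%:R^-1 :> R by rewrite invr_gt0 ltr0n.
have /choice[u uP] : forall j : 'I_d, exists q : rat,
    `|t 0 j - ratr q| < i.+1%:R^-1.
  move=> j; have /rat_in_itvoo[q] : t 0 j - i.+1%:R^-1 < t 0 j + i.+1%:R^-1.
    by rewrite ltrD2l gtrN.
  rewrite in_itv/= => /andP[q1 q2]; exists q.
  by rewrite ltr_distlC q1 q2.
pose c : 'rV[rat]_d * nat := (\row_j u j, i).
have nc : near_pt c t.
  split => //; apply: mxnorm_lt => // a j; rewrite !mxE ord1; exact: uP.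
exists (choice.pickle c); rewrite choice.pickleK/=.
have [_ /(_ (ex_intro _ _ nc)) [_ h]] := e0P c.
case: nc => _ h'; rewrite (_ : e0 c - t = (e0 c - map_mx ratr c.1) - (t - map_mx ratr c.1)).
  apply: le_lt_trans (ler_normB _ _) _; rewrite [ltRHS](splitr r).
  by apply: ltrD; exact: lt_trans ir.
by rewrite opprB addrA subrK.
Qed.

Lemma within_continuousP (A : set 'rV[R]_d) (V : normedModType R)
  (f : 'rV[R]_d -> V) : {within A, continuous f} ->
  forall t e, A t -> 0 < e -> exists2 r, 0 < r &
    forall s, A s -> `|s - t| < r -> `|f s - f t| < e.
Proof.
move=> /subspace_continuousP cf t e At e0.
have /cvgrPdist_lt/(_ _ e0) := cf t At.
rewrite /within/= => /nbhs_ballP[r /= r0 rP]; exists r => // s As st.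
rewrite distrC; apply: rP => //; rewrite -ball_normE/=.
by rewrite distrC.
Qed.

End dense_sequence.

Section local_modulus.
Context (R : realType) (d : nat) (dT : measure_display) (T : measurableType dT)
  (mu : probability T R) (A : set 'rV[R]_d) (F : 'rV[R]_d -> T -> R)
  (kappa : T -> R).
Hypotheses (mF : forall t, A t -> measurable_fun setT (F t))
  (cF : forall x, {within A, continuous (F^~ x)})
  (Fk : forall t x, A t -> `|F t x| <= kappa x)
  (ik : Rintegrable mu kappa).

(* The oscillation is taken along a dense sequence of A, to keep it measurable. *)
Lemma local_modulus t e : A t -> 0 < e ->
  exists r, exists Delta : T -> R,
    [/\ 0 < r, measurable_fun setT Delta, forall x, 0 <= Delta x <= 2 * kappa x,
        \int[mu]_x Delta x <= e &
        forall s x, A s -> `|s - t| < r -> `|F s x - F t x| <= Delta x].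
Proof.
move=> At e0.
have [u [Au du]] := dense_sequence (ex_intro A t At).
pose h (l n : nat) x : R :=
  if `|u n - t| < l.+1%:R^-1 then `|F (u n) x - F t x| else 0.
pose D l x := sups (h l ^~ x) 0.
have k0 x : 0 <= kappa x by apply: le_trans (Fk x At).
have h2k l n x : h l n x <= 2 * kappa x.
  rewrite /h; case: ifP => _; last by rewrite mulr_ge0.
  by rewrite (le_trans (ler_normB _ _))// mulr2n mulrDl mul1r lerD// Fk.
have h0 l n x : 0 <= h l n x by rewrite /h; case: ifP.
have ubh l x : has_ubound (range (h l ^~ x)).
  by exists (2 * kappa x) => _ [n _ <-].
have hD l n x : h l n x <= D l x.
  apply: ub_le_sup; last by exists n.
  by exists (2 * kappa x) => _ [m _ <-].
have D0 l x : 0 <= D l x by apply: le_trans (hD l 0%N x).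
have D_le l x r : (forall n, h l n x <= r) -> D l x <= r.
  move=> hr; apply: ge_sup; first by exists (h l 0%N x); exists 0%N.
  by move=> _ [n _ <-].
have mD l : measurable_fun setT (D l).
  apply: measurable_fun_sups => // n.
  rewrite /h; case: (_ < _) => //.
  by apply: measurableT_comp => //; apply: measurable_funB; exact: mF.
have D2k l x : D l x <= 2 * kappa x by exact: D_le.
have Dcvg x : D ^~ x @ \oo --> (0 : R).
  apply/cvgrPdist_le => /= eta eta0.
  have [r r0 rP] := @within_continuousP _ _ _ _ _ (@cF x) _ _ At eta0.
  have /ltr_add_invr[l0] := r0; rewrite add0r => l0r.
  near=> l; rewrite sub0r normrN ger0_norm//; apply: D_le => n.
  rewrite /h; case: ifPn => [ul|_]; last exact: ltW.
  apply/ltW/rP => //; apply: lt_trans ul _; apply: le_lt_trans l0r.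
  rewrite lef_pV2 ?posrE ?ltr0n// ler_nat ltnS.
  by near: l; exact: nbhs_infty_ge.
have iD l : Rintegrable mu (D l).
  apply: Rintegrable_le (RintegrableZ 2 ik) _ => // x.
  by rewrite ger0_norm.
have m1 l : measurable_fun setT (fun x => (D l x)%:E) by exact/measurable_EFinP.
have ae1 : {ae mu, forall x, setT x -> (D l x)%:E @[l --> \oo] --> cst 0%E x}.
  apply: aeW => x _; apply/fine_cvgP; split; first exact: nearW.
  exact: Dcvg.
have ae2 : {ae mu, forall x n, setT x -> (`|(D n x)%:E| <= (2 * kappa x)%:E)%E}.
  by apply: aeW => x n _; rewrite lee_fin ger0_norm.
(* The oscillation over the ball of radius 1 / (l + 1) tends to 0 pointwise by continuity and is
   dominated by 2 kappa, so its mean is below [e] for some [l]. *)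
have [_ _] := dominated_convergence measurableT m1 (measurable_cst _) ae1
  (RintegrableZ 2 ik) ae2.
rewrite integral0 => /fine_cvgP[_].
move=> /cvgrPdist_le/(_ _ e0)[l _ /(_ l (leqnn l))]; rewrite sub0r normrN => Il.
exists l.+1%:R^-1, (D l); split => //.
- by move=> x; rewrite D0 D2k.
- exact: le_trans (ler_norm _) Il.
(* A general [s] is replaced by a point of the dense sequence so close that it stays in the ball
   around [t] and changes [F] by less than [eta]. *)
- move=> s x As sl; apply/ler_addgt0Pr => eta eta0.
  have [r r0 rP] := @within_continuousP _ _ _ _ _ (@cF x) _ _ As eta0.
  have [|n un] := du s (Num.min r (l.+1%:R^-1 - `|s - t|)) As.
    by rewrite lt_min r0 subr_gt0.
  move: un; rewrite lt_min => /andP[un1 un2].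
  have := hD l n x; rewrite /h ifT; last first.
    by apply: le_lt_trans (ler_distD s _ _) _; rewrite -ltrBrDr.
  have := rP _ (Au n) un1; rewrite distrC => h1 h2.
  by apply: le_trans (ler_distD (F (u n) x) _ _) _; rewrite addrC lerD// ltW.
Unshelve. all: by end_near.
Qed.

End local_modulus.

(** * Rare events and the uniform law of large numbers *)

Section rare_events.
Context (R : realType) (d : measure_display) (Om : measurableType d)
  (P : probability Om R) (phi : nat -> R) (phioo : phi m @[m --> \oo] --> +oo).
Implicit Types A B : nat -> nat -> set Om.

Lemma phi_ge (r : R) : \forall m \near \oo, r <= phi m.
Proof. by have /cvgryPge := phioo; apply. Qed.

Lemma measurable_gt (f : Om -> R) (e : R) : measurable_fun setT f ->
  measurable [set w | e < f w].
Proof.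
move=> mf; have := mf measurableT _ (measurable_itv `]e, +oo[).
rewrite setTI (_ : _ @^-1` _ = [set w | e < f w])//.
by apply/seteqP; split => w /=; rewrite in_itv/= andbT.
Qed.

Lemma prob_le_integral (A : set Om) (f : Om -> \bar R) (b : \bar R) :
  measurable A -> measurable_fun setT f -> (forall w, 0 <= f w)%E ->
  (forall w, A w -> (1 <= f w)%E) -> (\int[P]_w f w <= b)%E -> (P A <= b)%E.
Proof.
move=> mA mf f0 Af; apply: le_trans.
rewrite -[A in leLHS]setIT -integral_indic//.
apply: ge0_le_integral => //.
- by apply/measurable_EFinP; exact: measurable_indic.
- move=> w _; rewrite indicE; have [wA|_] := boolP (w \in A); last exact: f0.
  by apply: Af; exact/set_mem.
Qed.

(* Events whose probability is eventually O(n^-2 + phi_m^-3), the order that is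
   negligible in the theorem. *)
Definition rare A : Prop := exists B C,
  (forall n m, measurable (B n m)) /\
  \forall m \near \oo, forall n, (0 < n)%N -> A n m `<=` B n m /\
     (P (B n m) <= (C * (n%:R ^- 2 + phi m ^- 3))%:E)%E.

Lemma rare_sub A B : (\forall m \near \oo, forall n, (0 < n)%N -> A n m `<=` B n m) ->
  rare B -> rare A.
Proof.
move=> AB [B' [C [mB' PB']]]; exists B', C; split => //.
near=> m => n n0; have AB' : forall n, (0 < n)%N -> A n m `<=` B n m.
  by near: m.
have /(_ n n0)[BB' PB] : forall n, (0 < n)%N -> B n m `<=` B' n m /\
     (P (B' n m) <= (C * (n%:R ^- 2 + phi m ^- 3))%:E)%E by near: m.
by split => //; apply: subset_trans BB'; exact: AB'.
Unshelve. all: by end_near. Qed.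

Lemma rareU A B : rare A -> rare B -> rare (fun n m => A n m `|` B n m).
Proof.
move=> [A' [C [mA' PA']]] [B' [D [mB' PB']]].
exists (fun n m => A' n m `|` B' n m), (C + D); split.
  by move=> n m; exact: measurableU.
near=> m => n n0.
have /(_ n n0)[AA' PA] : forall n, (0 < n)%N -> A n m `<=` A' n m /\
     (P (A' n m) <= (C * (n%:R ^- 2 + phi m ^- 3))%:E)%E by near: m.
have /(_ n n0)[BB' PB] : forall n, (0 < n)%N -> B n m `<=` B' n m /\
     (P (B' n m) <= (D * (n%:R ^- 2 + phi m ^- 3))%:E)%E by near: m.
split; first exact: setUSS.
by rewrite mulrDl EFinD (le_trans (measureU2 _ _ _))// leeD.
Unshelve. all: by end_near. Qed.

Lemma rare_set0 : rare (fun _ _ => set0).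
Proof.
exists (fun _ _ => set0), 0; split => //.
by apply: nearW => m n n0; split => //; rewrite measure0 mul0r.
Qed.

Lemma rare_seq (I : eqType) (s : seq I) (A : I -> nat -> nat -> set Om) :
  (forall i, i \in s -> rare (A i)) ->
  rare (fun n m => [set w | exists2 i, i \in s & A i n m w]).
Proof.
elim: s => [|i s IH] rA.
  by apply: rare_sub rare_set0; apply: nearW => m n _ w [].
apply: (rare_sub _ (rareU (rA i (mem_head _ _)) (IH _))).
  apply: nearW => m n _ w [j]; rewrite inE => /predU1P[->|js] Aj; first by left.
  by right; exists j.
by move=> j js; apply: rA; rewrite inE js orbT.
Qed.

Lemma rare_fin (I : finType) (A : I -> nat -> nat -> set Om) :
  (forall i, rare (A i)) -> rare (fun n m => [set w | exists i, A i n m w]).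
Proof.
move=> rA; have := rare_seq (s := enum I) (fun i _ => rA i).
apply: rare_sub; apply: nearW => m n _ w [i Ai]; exists i => //.
by rewrite mem_enum.
Qed.

Lemma rare_n2 A (C : R) : (forall n m, measurable (A n m)) ->
  (forall n m, (0 < n)%N -> (P (A n m) <= (C * n%:R ^- 2)%:E)%E) -> rare A.
Proof.
move=> mA PA; exists A, (Num.max C 0); split => //.
near=> m => n n0; split => //; apply: le_trans (PA n m n0) _.
rewrite lee_fin; apply: (@le_trans _ _ (Num.max C 0 * n%:R ^- 2)).
  by rewrite ler_wpM2r ?invr_ge0 ?exprn_ge0// le_max lexx.
rewrite ler_wpM2l ?le_max ?lexx ?orbT// lerDl invr_ge0 exprn_ge0//.
by near: m; exact: phi_ge.
Unshelve. all: by end_near. Qed.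

Lemma rare_phi3 A (C : R) : (forall n m, measurable (A n m)) ->
  (\forall m \near \oo, forall n, (0 < n)%N -> (P (A n m) <= (C * phi m ^- 3)%:E)%E) ->
  rare A.
Proof.
move=> mA PA; exists A, (Num.max C 0); split => //.
near=> m => n n0; split => //.
have phi0 : 0 <= phi m by near: m; exact: phi_ge.
apply: (@le_trans _ _ (C * phi m ^- 3)%:E).
  by move: n n0; near: m.
rewrite lee_fin; apply: (@le_trans _ _ (Num.max C 0 * phi m ^- 3)).
  by rewrite ler_wpM2r ?invr_ge0 ?exprn_ge0// le_max lexx.
by rewrite ler_wpM2l ?le_max ?lexx ?orbT// lerDr invr_ge0 exprn_ge0.
Unshelve. all: by end_near. Qed.

Section iid.
Context (d' : measure_display) (T : measurableType d')
  (mu : probability T R) (X : nat -> {RV P >-> T}) (Xiid : iid mu X).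

Definition iavg (f : T -> R) n w := n%:R^-1 * isum X f n w.

Lemma isum_center f n w :
  isum X (fun x => f x - \int[mu]_x f x) n w = isum X f n w - n%:R * \int[mu]_x f x.
Proof.
rewrite /isum sumrB; congr (_ - _).
by rewrite sumr_const card_ord mulr_natl.
Qed.

Lemma L4_center f : L4 mu f -> L4 mu (fun x => f x - \int[mu]_x f x).
Proof. by move=> Lf; apply: (L4D Lf (L4_cst _ _)). Qed.

Lemma Rintegral_center f : Rintegrable mu f ->
  \int[mu]_x (f x - \int[mu]_x f x) = 0.
Proof.
by move=> If; rewrite RintegralB ?Rintegral1 ?subrr//; exact: Rintegrable_cst.
Qed.

(** Markov's inequality for the fourth power: the centred sum has fourth moment O(n^2), and a
    deviation [e] of the mean is one of n e for the sum. *)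
Lemma rare_mean f (e : R) : L4 mu f -> 0 < e ->
  rare (fun n m => [set w | e < `|iavg f n w - \int[mu]_x f x|]).
Proof.
move=> Lf e0; have If := L4_Rintegrable Lf.
pose g x := f x - \int[mu]_x f x.
have Lg : L4 mu g := L4_center Lf.
have [K K0 HK] := Rintegral_isum4_le Xiid Lg (Rintegral_center If).
have mS n : measurable_fun setT (isum X f n).
  by case: (L4_isum Xiid n Lf).
apply: (@rare_n2 _ (K / e ^+ 4)) => [n m|n m n0].
  apply: measurable_gt.
 
  apply: measurableT_comp => //; apply: measurable_funB => //.
  exact: measurable_funM.
have n0' : 0 < n%:R :> R by rewrite ltr0n.
have Lsg := L4_isum Xiid n Lg.
apply: (@prob_le_integral _ (fun w => (((e * n%:R)^-1 ^+ 4) * isum X g n w ^+ 4)%:E)).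
- apply: measurable_gt.
 
  apply: measurableT_comp => //; apply: measurable_funB => //.
  exact: measurable_funM.
- apply/measurable_EFinP; apply: measurable_funM => //.
  by apply: measurable_funX; case: Lsg.
- by move=> w; rewrite lee_fin -exprMn exprn_even_ge0.
- move=> w /= ew; rewrite lee_fin -exprMn /g isum_center.
  have -> : (e * n%:R)^-1 * (isum X f n w - n%:R * \int[mu]_x f x) =
      e^-1 * (iavg f n w - \int[mu]_x f x).
    rewrite /iavg; field; apply/andP; split; exact: lt0r_neq0.
  have : 1 <= `|e^-1 * (iavg f n w - \int[mu]_x f x)|.
    by rewrite normrM gtr0_norm ?invr_gt0// ler_pdivlMl// mulr1 ltW.
  move=> h; rewrite -[leRHS]ger0_norm ?exprn_even_ge0// normrX exprn_ege1//.
- rewrite (RintegralE (RintegrableZ _ _)); last by case: Lsg.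
  rewrite lee_fin RintegralZl//; last by case: Lsg.
  apply: le_trans (ler_wpM2l _ (HK n)) _; first by rewrite exprn_even_ge0.
  rewrite le_eqVlt; apply/orP; left; apply/eqP; field.
  by apply/andP; split; exact: lt0r_neq0.
Qed.

Lemma iavg_le f g n w : (forall x, f x <= g x) -> iavg f n w <= iavg g n w.
Proof.
by move=> fg; rewrite /iavg ler_wpM2l ?invr_ge0//; apply: ler_sum => i _.
Qed.

Lemma iavg_norm f n w : `|iavg f n w| <= iavg (fun x => `|f x|) n w.
Proof.
by rewrite /iavg normrM ger0_norm ?invr_ge0// ler_wpM2l ?invr_ge0// ler_norm_sum.
Qed.

Lemma iavgB f g n w : iavg f n w - iavg g n w = iavg (fun x => f x - g x) n w.
Proof. by rewrite /iavg -mulrBr /isum sumrB. Qed.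

Section ulln.
Context (p : nat) (A : set 'rV[R]_p) (F : 'rV[R]_p -> T -> R) (kappa : T -> R).
Hypotheses (cA : compact A) (mF : forall t, A t -> measurable_fun setT (F t))
  (cF : forall x, {within A, continuous (F^~ x)})
  (Fk : forall t x, A t -> `|F t x| <= kappa x)
  (Lk : L4 mu kappa).

Lemma L4_of_bound t : A t -> L4 mu (F t).
Proof. by move=> At; apply: L4_le Lk _ => [|x]; [exact: mF|exact: Fk]. Qed.

Lemma mean_continuous t e : A t -> 0 < e -> exists2 r, 0 < r &
  forall s, A s -> `|s - t| < r ->
    `|\int[mu]_x F s x - \int[mu]_x F t x| <= e.
Proof.
move=> At e0; have [r [D [r0 mD Dk De DF]]] :=
  local_modulus mF cF Fk (L4_Rintegrable Lk) At e0.
exists r => // s As st.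
have iF u : A u -> Rintegrable mu (F u) by move=> /L4_of_bound/L4_Rintegrable.
rewrite -RintegralB//; [|exact: iF|exact: iF].
apply: le_trans (le_normr_Rintegral _ _) _ => //; first exact: RintegrableB (iF _ As) (iF _ At).
apply: le_trans De; apply: le_Rintegral => //.
- by apply: (@Rintegrable_le _ _ _ mu _ _ _ (RintegrableZ 2 (L4_Rintegrable Lk))) => //;
    [apply: measurableT_comp => //; apply: measurable_funB; exact: mF
    |move=> x; rewrite normr_id; apply: le_trans (DF s x As st) _; case/andP: (Dk x)].
- apply: (Rintegrable_le _ (RintegrableZ 2 (L4_Rintegrable Lk))) => // x.
  by case/andP: (Dk x) => D0 D2; rewrite ger0_norm.
- by move=> x _; exact: DF.
Qed.

(* A is covered by finitely many balls on which the oscillation of F is bounded by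
   a function of small mean. *)
Lemma rare_uniform_mean e : 0 < e -> rare (fun n m => [set w |
  ~ forall t, A t -> `|iavg (F t) n w - \int[mu]_x F t x| <= e]).
Proof.
move=> e0; have e4 : 0 < e / 4 by rewrite divr_gt0.
have /choice[rD rDP] : forall t, exists rD : R * (T -> R), A t ->
    [/\ 0 < rD.1, measurable_fun setT rD.2, forall x, 0 <= rD.2 x <= 2 * kappa x,
        \int[mu]_x rD.2 x <= e / 4 &
        forall s x, A s -> `|s - t| < rD.1 -> `|F s x - F t x| <= rD.2 x].
  move=> t; have [At|nAt] := pselect (A t); last by exists (0, fun=> 0).
  have [r [D H]] := local_modulus mF cF Fk (L4_Rintegrable Lk) At e4.
  by exists (r, D).
have LD t : A t -> L4 mu (rD t).2.
  move=> /rDP[_ mD Dk _ _]; apply: L4_le mD (L4Z 2 Lk) _ => x.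
  by case/andP: (Dk x) => D0 D2; rewrite ger0_norm.
have := cA; rewrite compact_cover => /(_ _ A (fun t => ball t (rD t).1)).
have oB t : A t -> open (ball t (rD t).1) by move=> _; exact: ball_open.
have cB : A `<=` cover A (fun t => ball t (rD t).1).
  by move=> t At; exists t => //; apply: ballxx; case: (rDP t At).
move=> /(_ oB cB)[D DA AD].
have r1 := @rare_seq _ D (fun t n m => [set w | e / 4 < `|iavg (F t) n w - \int[mu]_x F t x|]).
have r2 := @rare_seq _ D (fun t n m => [set w | e / 4 < `|iavg (rD t).2 n w - \int[mu]_x (rD t).2 x|]).
apply: (rare_sub _ (rareU (r1 _) (r2 _))); last 2 first.
- by move=> t /DA/set_mem At; apply: rare_mean => //; exact: L4_of_bound.
- by move=> t /DA/set_mem At; apply: rare_mean => //; exact: LD.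
apply: nearW => m n n0 w /=; apply: contra_notP => /not_orP[h1 h2] s As.
have [t Dt] := AD s As; rewrite -ball_normE/= distrC => st.
have At : A t by exact/set_mem/DA.
have [rp mD Dk De DF] := rDP t At.
have k1 : `|iavg (F t) n w - \int[mu]_x F t x| <= e / 4.
  by rewrite leNgt; apply/negP => h; apply: h1; exists t.
have k2 : `|iavg (rD t).2 n w - \int[mu]_x (rD t).2 x| <= e / 4.
  by rewrite leNgt; apply/negP => h; apply: h2; exists t.
have iF u : A u -> Rintegrable mu (F u) by move=> /L4_of_bound/L4_Rintegrable.
have k3 : `|iavg (F s) n w - iavg (F t) n w| <= iavg (rD t).2 n w.
  rewrite iavgB; apply: le_trans (iavg_norm _ _ _) _.
  by apply: iavg_le => x; exact: DF.
have k4 : `|\int[mu]_x F s x - \int[mu]_x F t x| <= \int[mu]_x (rD t).2 x.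
  rewrite -RintegralB//; [|exact: iF|exact: iF].
  apply: le_trans (le_normr_Rintegral _ _) _ => //; first exact: RintegrableB (iF _ As) (iF _ At).
  apply: le_Rintegral => //; last by move=> x _; exact: DF.
    apply: Rintegrable_le (L4_Rintegrable (LD t At)) _.
      by apply: measurableT_comp => //; apply: measurable_funB; exact: mF.
    by move=> x; rewrite normr_id; exact: DF.
  exact: L4_Rintegrable (LD t At).
(* Four quarters of [e]: the empirical oscillation is at most its mean, e / 4, plus a deviation e /
   4; the mean oscillation and the deviation at the centre [t] are at most e / 4 each. *)
move: k1 k2 k3 k4 De; rewrite !ler_norml.
move: (iavg _ _ _) (iavg _ _ _) (iavg _ _ _) (Rintegral _ _ _) (Rintegral _ _ _) (Rintegral _ _ _) => a b c x y z.
move=> /andP[? ?] /andP[? ?] /andP[? ?] /andP[? ?] ?; apply/andP; split; lra.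
Qed.

End ulln.
End iid.
End rare_events.

(** * Zeros on compact sets, norms and quadratic forms *)

Section compactness.
Context (R : realType).

Lemma within_continuousI (d : nat) (A : set 'rV[R]_d) (f : 'rV[R]_d -> R) :
  (forall t e, A t -> 0 < e -> exists2 r, 0 < r &
    forall s, A s -> `|s - t| < r -> `|f s - f t| < e) ->
  {within A, continuous f}.
Proof.
move=> H; apply/subspace_continuousP => t At.
apply/cvgrPdist_lt => e e0; have [r r0 rP] := H t e At e0.
apply/nbhs_ballP; exists r => //= s; rewrite -ball_normE/= => st As.
by rewrite distrC; apply: rP => //; rewrite distrC.
Qed.

Lemma sphere_min (d : nat) (f : 'rV[R]_d -> R) : {within setT, continuous f} ->
  (forall x, x != 0 -> 0 < f x) ->
  exists2 l, 0 < l & forall x, `|x| = 1 -> l <= f x.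
Proof.
move=> cf f0; pose S : set 'rV[R]_d := [set x | `|x| = 1].
have [S0|nS] := pselect (S !=set0); last first.
  by exists 1 => // x x1; exfalso; apply: nS; exists x.
have cS : compact S.
  apply: bounded_closed_compact.
    by exists 1; split => // M M1 x /= ->; exact: ltW.
  have -> : S = (fun x : 'rV[R]_d => `|x|) @^-1` [set 1] by [].
  apply: closed_comp; last exact: closed_eq.
  by move=> x _; exact: norm_continuous.
have cfS : {within S, continuous f} by apply: continuous_subspaceW cf.
have [c /set_mem c1 cmin] := compact_EVT_min S0 cS cfS.
exists (f c); last by move=> x x1; apply: cmin; exact/mem_set.
by apply: f0; rewrite -normr_gt0 c1.
Qed.

(** The part of [A] at distance at least [eta] from [t0] is compact and [|f|] is continuous and
    positive on it; half of its minimum serves as [e]. *)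
Lemma sub_well_separated (d k : nat) (A : set 'rV[R]_d) (f : 'rV[R]_d -> 'rV[R]_k)
  (t0 : 'rV[R]_d) (eta : R) : compact A -> {within A, continuous f} ->
  (forall t, A t -> f t = 0 -> t = t0) -> 0 < eta ->
  exists2 e, 0 < e & forall t, A t -> `|f t| <= e -> `|t - t0| < eta.
Proof.
move=> cA cf ft0 eta0; pose B := A `&` ~` ball t0 eta.
have BE t : B t -> A t /\ eta <= `|t - t0|.
  by move=> [At]; rewrite -ball_normE/= distrC => /negP; rewrite -leNgt.
have [B0|nB] := pselect (B !=set0); last first.
  exists 1 => // t At _; rewrite ltNge; apply/negP => tt; apply: nB; exists t.
  by split => //; rewrite -ball_normE/= distrC; apply/negP; rewrite -leNgt.
have cB : compact B.
  by apply: compact_closedI => //; apply: open_closedC; exact: ball_open.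
have cfB : {within B, continuous (fun t => `|f t|)}.
  apply: within_continuousI => t e Bt e0.
  have [r r0 rP] := @within_continuousP _ _ _ _ _ cf _ _ (BE t Bt).1 e0.
  exists r => // s Bs st; apply: le_lt_trans (rP s (BE s Bs).1 st).
  exact: ler_dist_dist.
have [c /set_mem c1 cmin] := compact_EVT_min B0 cB cfB.
have fc : 0 < `|f c|.
  rewrite normr_gt0; apply/eqP => fc0.
  have [Ac etac] := BE c c1.
  by move: etac; rewrite (ft0 c Ac fc0) subrr normr0 leNgt eta0.
exists (`|f c| / 2); first by rewrite divr_gt0.
move=> t At ft; rewrite ltNge; apply/negP => tt.
have Bt : B t.
  by split => //; rewrite -ball_normE/= distrC; apply/negP; rewrite -leNgt.
have := cmin t (mem_set Bt); rewrite leNgt => /negP; apply.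
by apply: le_lt_trans ft _; rewrite gtr_pMr// invf_lt1// ltr1n.
Qed.

End compactness.

Section norm_equivalence.
Context (R : realType) (m n : nat) (N : 'M[R]_(m, n) -> R) (hN : is_norm N).

Lemma is_norm0 : N 0 = 0.
Proof. by case: hN => _ _ NZ _; have := NZ 0 0; rewrite scale0r normr0 mul0r. Qed.

Lemma is_normN A : N (- A) = N A.
Proof. by case: hN => _ _ NZ _; rewrite -scaleN1r NZ normrN1 mul1r. Qed.

Lemma is_norm_sum (I : Type) (s : seq I) (F : I -> 'M[R]_(m, n)) :
  N (\sum_(i <- s) F i) <= \sum_(i <- s) N (F i).
Proof.
case: hN => _ _ _ NT; elim: s => [|i s IH].
  by rewrite !big_nil is_norm0.
by rewrite !big_cons (le_trans (NT _ _))// lerD2l.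
Qed.

Lemma is_norm_le : exists2 C : R, 0 <= C & forall A, N A <= C * `|A|.
Proof.
have [N0 _ NZ _] := hN.
exists (\sum_(i < m) \sum_(j < n) N (delta_mx i j)).
  by apply: sumr_ge0 => i _; apply: sumr_ge0.
move=> A; rewrite [A in leLHS]matrix_sum_delta.
rewrite (le_trans (is_norm_sum _ _))// mulr_suml; apply: ler_sum => i _.
rewrite (le_trans (is_norm_sum _ _))// mulr_suml; apply: ler_sum => j _.
by rewrite NZ mulrC ler_wpM2l// mxentry_le.
Qed.

Lemma is_norm_dist A B : `|N A - N B| <= N (A - B).
Proof.
have [_ _ _ NT] := hN; rewrite ler_norml; apply/andP; split.
  rewrite lerNl opprB lerBlDr -(is_normN (A - B)) opprB.
  by rewrite -[leLHS](congr1 N (subrK A B)) NT.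
by rewrite lerBlDr -[leLHS](congr1 N (subrK B A)) NT.
Qed.

Lemma mxvec_norm (A : 'M[R]_(m, n)) : `|mxvec A| = `|A|.
Proof.
apply/eqP; rewrite eq_le; apply/andP; split; apply: mxnorm_le => // i j.
  by case/mxvec_indexP: j => a b; rewrite ord1 mxvecE mxentry_le.
by rewrite -mxvecE mxentry_le.
Qed.

(** [N] is continuous by [is_norm_le] and positive off 0, hence bounded below on the unit sphere,
    and homogeneity extends the bound. Flattening by [mxvec] preserves the maximum norm. *)
Lemma is_norm_ge : exists2 c : R, 0 < c & forall A, `|A| <= c * N A.
Proof.
have [N0 Neq0 NZ NT] := hN; have [C C0 NC] := is_norm_le.
have [||l l0 lN] := @sphere_min R (m * n) (fun v => N (vec_mx v)).
- apply: within_continuousI => t e _ e0; exists (e / (C + 1)).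
    by rewrite divr_gt0// ltr_wpDl.
  move=> s _ st; apply: le_lt_trans (is_norm_dist _ _) _.
  rewrite -linearB; apply: le_lt_trans (NC _) _.
  rewrite -mxvec_norm vec_mxK; move: st; rewrite ltr_pdivlMr ?ltr_wpDl//.
  by apply: le_lt_trans; rewrite mulrC ler_wpM2l// lerDl.
- move=> x x0; rewrite lt_neqAle N0 andbT eq_sym; apply/eqP => /Neq0.
  by move=> /(congr1 mxvec); rewrite vec_mxK linear0; exact/eqP.
exists l^-1; first by rewrite invr_gt0.
move=> A; have [->|A0] := eqVneq A 0; first by rewrite normr0 is_norm0 mulr0.
have nA : 0 < `|A| by rewrite normr_gt0.
rewrite ler_pdivlMl//.
have := lN (mxvec (`|A|^-1 *: A)).
rewrite mxvecK mxvec_norm normrZ normfV normr_id mulVf ?gt_eqF// => /(_ erefl).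
by rewrite NZ normfV normr_id ler_pdivlMl// mulrC.
Qed.

End norm_equivalence.

Section quadratic_forms.
Context (R : realType).

Definition qform (k : nat) (M : 'M[R]_k) (x : 'rV[R]_k) : R := (x *m M *m x^T) 0 0.

Definition posdef (k : nat) (M : 'M[R]_k) := forall x, x != 0 -> 0 < qform M x.

Lemma qform_norm k (M : 'M[R]_k) x : `|qform M x| <= k%:R ^+ 2 * `|M| * `|x| ^+ 2.
Proof.
rewrite /qform (le_trans (mxentry_le _ _ _))// (le_trans (mxnormM_le _ _))//.
rewrite mxnorm_tr (_ : k%:R ^+ 2 * _ * _ = k%:R * (k%:R * `|x| * `|M|) * `|x|); last by ring.
by rewrite ler_wpM2r// ler_wpM2l// mxnormM_le.
Qed.

Lemma qformB k (M : 'M[R]_k) x y :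
  qform M x - qform M y = ((x - y) *m M *m x^T + y *m M *m (x - y)^T) 0 0.
Proof.
rewrite /qform !mxE -!sumrB -big_split/=; apply: eq_bigr => j _.
by rewrite mulmxBl linearB/= !mxE; ring.
Qed.

Lemma qform_continuous k (M : 'M[R]_k) : {within setT, continuous (qform M)}.
Proof.
apply: within_continuousI => y e _ e0.
pose K := k%:R ^+ 2 * `|M| * (2 * `|y| + 1).
have K0 : 0 <= K by rewrite !mulr_ge0// addr_ge0// mulr_ge0.
exists (Num.min 1 (e / (K + 1))).
  by rewrite lt_min ltr01 divr_gt0// ltr_wpDl.
move=> x _; rewrite lt_min => /andP[x1 xK].
rewrite qformB; apply: le_lt_trans (mxentry_le _ _ _) _.
apply: le_lt_trans (ler_normD _ _) _.
have nx : `|x| <= `|y| + 1.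
  rewrite -[x](subrK y) addrC (le_trans (ler_normD _ _))// lerD2l.
  exact: ltW.
have b1 : `|(x - y) *m M *m x^T| <= k%:R ^+ 2 * `|M| * `|x - y| * (`|y| + 1).
  rewrite (le_trans (mxnormM_le _ _))// mxnorm_tr.
  rewrite (_ : _ * (_ + 1) = k%:R * (k%:R * `|x - y| * `|M|) * (`|y| + 1)); last by ring.
  by rewrite ler_pM ?mulr_ge0// ler_wpM2l// mxnormM_le.
have b2 : `|y *m M *m (x - y)^T| <= k%:R ^+ 2 * `|M| * `|x - y| * `|y|.
  rewrite (le_trans (mxnormM_le _ _))// mxnorm_tr.
  rewrite (_ : _ * `|y| = k%:R * (k%:R * `|y| * `|M|) * `|x - y|); last by ring.
  by rewrite ler_wpM2r// ler_wpM2l// mxnormM_le.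
apply: le_lt_trans (lerD b1 b2) _.
rewrite (_ : _ + _ = K * `|x - y|); last by rewrite /K; ring.
move: xK; rewrite ltr_pdivlMr ?ltr_wpDl//; apply: le_lt_trans.
by rewrite mulrC ler_wpM2l// lerDl.
Qed.

Lemma posdef_min k (M : 'M[R]_k) : posdef M ->
  exists2 l, 0 < l & forall x, l * `|x| ^+ 2 <= qform M x.
Proof.
move=> pM; have [l l0 lM] := sphere_min (@qform_continuous k M) pM.
exists l => // x; have [->|x0] := eqVneq x 0.
  by rewrite normr0 expr0n mulr0 /qform !mul0mx mxE.
have nx : 0 < `|x| by rewrite normr_gt0.
have := lM (`|x|^-1 *: x); rewrite normrZ normfV normr_id mulVf ?gt_eqF// => /(_ erefl).
rewrite /qform linearZ/= -!scalemxAl -scalemxAr scalerA mxE.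
by rewrite -invfM -expr2 ler_pdivlMl ?exprn_gt0// mulrC.
Qed.

Lemma posdef_unit k (M : 'M[R]_k) : posdef M -> M \in unitmx.
Proof.
move=> pM; rewrite -row_free_unit -kermx_eq0; apply/eqP/row_matrixP => i.
rewrite row0; apply/eqP/contraT => /pM.
by rewrite /qform -row_mul mulmx_ker row0 mul0mx mxE ltxx.
Qed.

(* A positive semidefinite invertible form is definite, by minimality of the
   form along lines through an isotropic vector. *)
Lemma psd_posdef k (M : 'M[R]_k) : M^T = M -> M \in unitmx ->
  (forall x, 0 <= qform M x) -> posdef M.
Proof.
move=> sM uM pM x x0; rewrite lt_neqAle pM andbT eq_sym; apply/eqP => Mx0.
have D00 (A B : 'M[R]_1) : (A + B) 0 0 = A 0 0 + B 0 0 by rewrite mxE.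
have Z00 (a : R) (A : 'M[R]_1) : (a *: A) 0 0 = a * A 0 0 by rewrite mxE.
have B (z : 'rV[R]_k) : (x *m M *m z^T) 0 0 = 0.
  set b := (_ *m _) 0 0.
  have bC : (z *m M *m x^T) 0 0 = b.
    have -> : z *m M *m x^T = (x *m M *m z^T)^T.
      by rewrite !trmx_mul sM trmxK mulmxA.
    by rewrite mxE.
  have E s : qform M (x + s *: z) = 2 * s * b + s ^+ 2 * qform M z.
    rewrite /qform linearD linearZ/= !mulmxDl !mulmxDr -!scalemxAl -!scalemxAr.
    rewrite !D00 !Z00 -/(qform M x) Mx0 bC -/b; ring.
  have q0 := pM z.
  (* The step b / (q + 1), rather than the exact minimizer b / q along the line, also covers an
     isotropic [z], and it still makes the form negative unless b = 0. *)
  have := pM (x - (b / (qform M z + 1)) *: z).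
  rewrite -scaleNr E; move: (qform M z) q0 => q q0.
  rewrite (_ : _ + _ = - (b ^+ 2 * ((q + 2) / (q + 1) ^+ 2))); last first.
    by field; rewrite gt_eqF// ltr_wpDl.
  rewrite oppr_ge0 pmulr_lle0; first by move=> h; apply/eqP; rewrite -sqrf_eq0 eq_le h sqr_ge0.
  by rewrite divr_gt0 ?exprn_gt0// ltr_wpDl.
have : x *m M = 0.
  apply/rowP => j; have := B (delta_mx 0 j); rewrite trmx_delta -colE [LHS]mxE => ->.
  by rewrite mxE.
move=> /(congr1 (fun y => y *m invmx M)); rewrite mulmxK// mul0mx.
by move/eqP: x0.
Qed.

Lemma posdef_inv k (M : 'M[R]_k) : M^T = M -> posdef M -> posdef (invmx M).
Proof.
move=> sM pM x x0; have uM := posdef_unit pM.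
have -> : qform (invmx M) x = qform M (x *m invmx M).
  by rewrite /qform mulmxKV// trmx_mul trmx_inv sM mulmxA.
apply: pM; apply: contra_neq x0 => /(congr1 (fun y => y *m M)).
by rewrite mulmxKV// mul0mx.
Qed.

Lemma posdef_conj d k (M : 'M[R]_k) (D : 'M[R]_(d, k)) : posdef M ->
  \rank D = d -> posdef (D *m M *m D^T).
Proof.
move=> pM rD x x0.
have -> : qform (D *m M *m D^T) x = qform M (x *m D).
  by rewrite /qform trmx_mul !mulmxA.
have /row_free_inj injD : row_free D by rewrite /row_free rD.
by apply: pM; apply: contra_neq x0 => xD; apply: injD; rewrite xD mul0mx.
Qed.

(** From A^-1 - V^-1 = A^-1 (V - A) V^-1 the unknown error x satisfies x <= K r (b + x). The first
    bound on the radius makes K r at most 1/2, so x is absorbed, and the second makes 2 K r b at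
    most [e]. *)
Lemma invmx_continuous k (V : 'M[R]_k) (e : R) : V \in unitmx -> 0 < e ->
  exists2 r, 0 < r & forall A, A \in unitmx -> `|A - V| <= r ->
    `|invmx A - invmx V| <= e.
Proof.
move=> uV e0; pose b := `|invmx V|; pose K := k%:R ^+ 2 * b.
have b0 : 0 <= b by exact: normr_ge0.
have K0 : 0 <= K by rewrite mulr_ge0.
exists (Num.min (2 * K + 1)^-1 (e / (2 * K * b + 1))).
  by rewrite lt_min invr_gt0 divr_gt0// ltr_wpDl// !mulr_ge0.
move=> A uA; rewrite le_min => /andP[].
have -> : invmx A - invmx V = invmx A *m (V - A) *m invmx V.
  by rewrite mulmxBr mulmxBl mulmxK// mulVmx// mul1mx.
rewrite ler_pdivlMr; last by rewrite ltr_wpDl// !mulr_ge0.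
rewrite -[X in _ <= X -> _]mul1r ler_pdivlMr; last by rewrite ltr_wpDl// !mulr_ge0.
set r := `|A - V| => r1 r2.
set x := `|invmx A *m _ *m _|.
have xE : x = `|invmx A - invmx V|.
  by rewrite /x mulmxBr mulmxBl mulmxK// mulVmx// mul1mx.
have x0 : 0 <= x by exact: normr_ge0.
have r0 : 0 <= r by exact: normr_ge0.
have hx : x <= K * r * (b + x).
  rewrite {1}/x (le_trans (mxnormM_le _ _))//.
  rewrite (_ : K * r * _ = k%:R * (k%:R * (b + x) * r) * b); last by rewrite /K; ring.
  rewrite ler_wpM2r// ler_wpM2l// (le_trans (mxnormM_le _ _))//.
  rewrite (distrC V) -/r; apply: (ler_wpM2r r0); apply: ler_wpM2l => //; rewrite xE.
  by rewrite -[X in `|X|](subrK (invmx V)) addrC; exact: ler_normD.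
nra.
Qed.

End quadratic_forms.

(** * First-order conditions *)

Ltac nneg := repeat first [assumption | exact: normr_ge0 | exact: ler0n
  | exact: sqr_ge0 | exact: ler01 | (apply: ltW; assumption) | apply: mulr_ge0
  | apply: addr_ge0 | apply: exprn_ge0 | rewrite invr_ge0].

Lemma mxnormM_le2 (R : realType) (m n p : nat) (A : 'M[R]_(m, n)) (B : 'M[R]_(n, p))
  (a b : R) : `|A| <= a -> `|B| <= b -> `|A *m B| <= n%:R * a * b.
Proof.
move=> Aa Bb; apply: le_trans (mxnormM_le A B) _.
by rewrite ler_pM ?mulr_ge0// ler_wpM2l.
Qed.

Section first_order_algebra.
Context (R : realType) (d k : nat) (D : 'M[R]_(d, k)) (W : 'M[R]_k).
Hypotheses (sW : W^T = W) (uS : D *m W *m D^T \in unitmx).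

(* The solution delta of D W (a + delta D)^T = 0 is - a W D^T (D W D^T)^-1; an
   approximate first-order condition J Ws u^T = 0 with u close to a + delta G
   determines delta up to the error of the approximations. *)
Lemma first_order_bound : exists C e0 : R, [/\ 0 <= C, 0 < e0 &
  forall (e c : R) (a u : 'rV[R]_k) (delta : 'rV[R]_d) (J G : 'M[R]_(d, k))
    (Ws : 'M[R]_k), 0 <= e -> e <= e0 -> 0 <= c ->
    `|J - D| <= e -> `|Ws - W| <= e -> `|G - D| <= e ->
    `|u - (a + delta *m G)| <= c -> J *m Ws *m u^T = 0 ->
    `|delta + a *m W *m D^T *m invmx (D *m W *m D^T)| <= C * (e * `|a| + c)].
Proof.
set S := D *m W *m D^T.
pose C1 := k%:R * `|D| + k%:R * (`|W| + 1).
pose K2 := k%:R * `|W *m D^T|.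
pose L := d%:R * (`|D| + 1).
pose C3 := d%:R * `|invmx S| * (K2 * (d%:R + 1) + k%:R * C1 * (L + 1)).
pose C4 := k%:R * `|W *m D^T *m invmx S|.
have C10 : 0 <= C1 by rewrite addr_ge0 ?mulr_ge0// addr_ge0.
have K20 : 0 <= K2 by rewrite mulr_ge0.
have L0 : 0 <= L by rewrite mulr_ge0// addr_ge0.
have C30 : 0 <= C3.
  by rewrite !mulr_ge0// addr_ge0// !mulr_ge0// addr_ge0.
have C40 : 0 <= C4 by rewrite mulr_ge0.
exists (2 * C3 * (1 + C4)), (Num.min 1 (2 * C3 + 1)^-1); split.
- nneg.
- rewrite lt_min ltr01 invr_gt0 ltr_wpDl//; nneg.
move=> e c a u delta J G Ws e0; rewrite le_min => /andP[e1 eC] c0 JD WsW GD uG foc.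
set r := delta + _.
(* [r *m S] equals (a + delta D) W D^T; subtracting the transposed condition u Ws^T J^T = 0 leaves
   only errors of approximation. *)
have rS : r *m S = (a + delta *m D - u) *m (W *m D^T) +
    u *m (W *m D^T - Ws^T *m J^T).
  have -> : u *m (W *m D^T - Ws^T *m J^T) = u *m (W *m D^T).
    have /(congr1 trmx) := foc; rewrite !trmx_mul trmxK trmx0 => foc'.
    by rewrite mulmxBr foc' subr0.
  rewrite -mulmxDl subrK mulmxDl /r mulmxDl mulmxKV// /S !mulmxA.
  by rewrite addrC.
have b1 : `|a + delta *m D - u| <= c + d%:R * e * `|delta|.
  have -> : a + delta *m D - u = (a + delta *m G - u) + delta *m (D - G).
    rewrite mulmxBr; move: (delta *m D) (delta *m G) => x y.
    by apply/rowP => i; rewrite !mxE; ring.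
  rewrite (le_trans (ler_normD _ _))// lerD//; first by rewrite distrC.
  rewrite mulrAC; apply: mxnormM_le2 => //; by rewrite distrC.
have b2 : `|W *m D^T - Ws^T *m J^T| <= C1 * e.
  have -> : W *m D^T - Ws^T *m J^T = (W - Ws^T) *m D^T + Ws^T *m (D - J)^T.
    by rewrite mulmxBl linearB/= mulmxBr addrA subrK.
  rewrite (le_trans (ler_normD _ _))// /C1 mulrDl lerD//.
    rewrite mulrAC; apply: mxnormM_le2; last by rewrite mxnorm_tr.
    by rewrite -{1}sW -linearB/= mxnorm_tr distrC.
  apply: mxnormM_le2; last by rewrite mxnorm_tr distrC.
  rewrite mxnorm_tr -[Ws](subrK W) (le_trans (ler_normD _ _))//.
  by rewrite addrC lerD2l (le_trans WsW).
have nu : `|u| <= `|a| + L * `|delta| + c.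
  rewrite -[u](subrK (a + delta *m G)) addrC (le_trans (ler_normD _ _))// lerD//.
  rewrite (le_trans (ler_normD _ _))// lerD2l /L mulrAC; apply: mxnormM_le2 => //.
  rewrite -[G](subrK D) addrC (le_trans (ler_normD _ _))// lerD2l.
  exact: le_trans e1.
have nrS : `|r *m S| <= K2 * (c + d%:R * e * `|delta|) +
    k%:R * (`|a| + L * `|delta| + c) * (C1 * e).
  rewrite rS (le_trans (ler_normD _ _))// lerD//.
    by rewrite /K2 mulrAC; apply: mxnormM_le2.
  exact: mxnormM_le2.
have nr : `|r| <= C3 * (e * `|a| + e * `|delta| + c).
  have -> : r = (r *m S) *m invmx S by rewrite mulmxK.
  rewrite (le_trans (mxnormM_le _ _))// [leLHS]mulrAC /C3 -[leRHS]mulrA ler_wpM2l ?mulr_ge0//.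
  apply: le_trans nrS _.
  have t1 : 0 <= K2 * (e * `|a|) by nneg.
  have t2 : 0 <= K2 * (e * `|delta|) by nneg.
  have t3 : 0 <= K2 * d%:R * (e * `|a|) by nneg.
  have t4 : 0 <= K2 * d%:R * c by nneg.
  have t5 : 0 <= k%:R * C1 * (L * (e * `|a|)) by nneg.
  have t6 : 0 <= k%:R * C1 * (e * `|delta|) by nneg.
  have t7 : 0 <= k%:R * C1 * (L * c) by nneg.
  have t8 : k%:R * C1 * (e * c) <= k%:R * C1 * c.
    by apply: ler_wpM2l; [nneg|rewrite ler_piMl].
  lra.
have nd : `|delta| <= `|r| + C4 * `|a|.
  have -> : delta = r - a *m (W *m D^T *m invmx S).
    by rewrite /r !mulmxA addrK.
  by rewrite (le_trans (ler_normB _ _))// lerD2l /C4 mulrAC; apply: mxnormM_le2.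
(* The choice of [e0] makes C3 e at most 1/2, so the term in |delta|, itself at most |r| + C4 |a|,
   can be absorbed in |r|. *)
have hC : 2 * C3 * e <= 1.
  move: eC; rewrite -[X in _ <= X -> _]mul1r ler_pdivlMr; last by rewrite ltr_wpDl//; nneg.
  rewrite mulrDr mulr1 => h; apply: le_trans h.
  by rewrite mulrC lerDl.
have t1 : C3 * e * `|delta| <= C3 * e * (`|r| + C4 * `|a|).
  by apply: ler_wpM2l => //; nneg.
have t2 : 2 * C3 * e * `|r| <= `|r|.
  by rewrite -[leRHS]mul1r ler_wpM2r.
have t3 : 0 <= C3 * C4 * c by nneg.
lra.
Qed.

End first_order_algebra.

Section differential.
Context (R : realType).

Lemma derive_line d p (f : 'rV[R]_d -> 'rV[R]_p) z h :
  differentiable f z ->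
  (fun s : R => s^-1 *: (f (s *: h + z) - f z)) @ 0^' --> h *m 'J f z.
Proof.
move=> df; have dh : derivable f z h by exact: diff_derivable.
by rewrite -(deriveEjacobian h df).
Qed.

Lemma mxBE p r (A B : 'M[R]_(p, r)) i j : (A - B) i j = A i j - B i j.
Proof. by rewrite !mxE. Qed.

(** On the line t + s h the map is q t + s v with v close to h J. Minimality divided by s gives b v
    + s (qform M v) >= 0, hence b (h J) >= 0 in the limit, and equality on replacing h by - h. As
    [M] need not be symmetric, the gradient involves M + M^T. *)
Lemma first_order_condition d k (Theta : set 'rV[R]_d) (q : 'rV[R]_d -> 'rV[R]_k)
    (M : 'M[R]_k) t r : 0 < r -> ball t r `<=` Theta -> differentiable q t ->
  (forall s, Theta s -> qform M (q t) <= qform M (q s)) ->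
  'J q t *m (M + M^T) *m (q t)^T = 0.
Proof.
move=> r0 tT dq qmin.
pose b (v : 'rV[R]_k) := (v *m (M + M^T) *m (q t)^T) 0 0.
have D00 (A B : 'M[R]_1) : (A + B) 0 0 = A 0 0 + B 0 0 by rewrite mxE.
have Z00 (a : R) (A : 'M[R]_1) : (a *: A) 0 0 = a * A 0 0 by rewrite mxE.
have qE v (s : R) : qform M (q t + s *: v) = qform M (q t) + s * (b v + s * qform M v).
  rewrite /qform linearD linearZ/= !mulmxDl !mulmxDr -!scalemxAl -!scalemxAr.
  rewrite !D00 !Z00 -/(qform M (q t)) -/(qform M v) /b mulmxDr mulmxDl D00.
  have -> : (v *m M^T *m (q t)^T) 0 0 = (q t *m M *m v^T) 0 0.
    have -> : v *m M^T *m (q t)^T = (q t *m M *m v^T)^T.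
      by rewrite !trmx_mul trmxK mulmxA.
    by rewrite mxE.
  ring.
have bC : exists2 C : R, 0 <= C & forall v, `|b v| <= C * `|v|.
  exists (k%:R * (k%:R * `|M + M^T|) * `|q t|); first by rewrite !mulr_ge0.
  move=> v; rewrite /b (le_trans (mxentry_le _ _ _))// (le_trans (mxnormM_le _ _))//.
  rewrite mxnorm_tr (_ : _ * `|v| = k%:R * (k%:R * `|v| * `|M + M^T|) * `|q t|); last by ring.
  by rewrite ler_wpM2r// ler_wpM2l// mxnormM_le.
have bB v w : b v - b w = b (v - w).
  by rewrite /b !mulmxBl mxBE.
have [C C0 bC'] := bC.
have b_ge0 h : 0 <= b (h *m 'J q t).
  set v0 := h *m _; rewrite -oppr_le0; apply/ler_addgt0Pr => e e0; rewrite add0r.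
  have /cvgrPdist_lt/(_ (Num.min 1 (e / 2 / (C + 1)))) := @derive_line _ _ _ _ h dq.
  rewrite lt_min ltr01/= !divr_gt0 ?ltr_wpDl// => /(_ erefl).
  rewrite -/v0 => /nbhs_ballP[rho /= rho0 Hrho].
  pose K := k%:R ^+ 2 * `|M| * (`|v0| + 1) ^+ 2.
  have K0 : 0 <= K by rewrite !mulr_ge0 ?sqr_ge0.
  (* Three demands on the step: the difference quotient is close to its limit, the quadratic term is
     at most e / 2, and the point stays in the ball inside [Theta]. *)
  pose s := Num.min (rho / 2) (Num.min (e / 2 / (K + 1)) (r / 2 / (`|h| + 1))).
  have s0 : 0 < s by rewrite !lt_min !divr_gt0// ltr_wpDl.
  have s1 : s < rho.
    by rewrite gt_min ltr_pdivrMr// ltr_pMr// ltr1n.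
  have s2 : s * (K + 1) <= e / 2.
    by rewrite -ler_pdivlMr ?ltr_wpDl// !ge_min lexx orbT.
  have s3 : s * (`|h| + 1) <= r / 2.
    by rewrite -ler_pdivlMr ?ltr_wpDl// !ge_min lexx !orbT.
  have := Hrho s; rewrite /ball/= sub0r normrN gtr0_norm// => /(_ s1 (lt0r_neq0 s0)).
  set v := _ *: _; rewrite lt_min => /andP[v1 v2].
  have sv : q (s *: h + t) = q t + s *: v.
    by rewrite /v scalerA mulfV ?gt_eqF// scale1r [RHS]addrC subrK.
  have /qmin : Theta (s *: h + t).
    apply: tT; rewrite -ball_normE/= opprD addrCA subrr addr0 normrN normrZ gtr0_norm//.
    by move: s3; rewrite mulrDr mulr1; lra.
  rewrite sv qE lerDl pmulr_rge0// => bv.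
  have nv : `|v| <= `|v0| + 1.
    rewrite -[v](subrK v0) addrC (le_trans (ler_normD _ _))// lerD2l distrC.
    exact: ltW.
  have qv : qform M v <= K.
    apply: le_trans (ler_norm _) _; apply: le_trans (qform_norm _ _) _.
    rewrite /K; apply: ler_wpM2l; first by nneg.
    by apply: lerXn2r => //; rewrite nnegrE; nneg.
  have h1 : b v - b v0 <= e / 2.
    rewrite bB; apply: le_trans (ler_norm _) _; apply: le_trans (bC' _) _.
    rewrite distrC; move: v2; rewrite ltr_pdivlMr ?ltr_wpDl//.
    rewrite mulrDr mulr1 mulrC => /ltW; apply: le_trans; by rewrite lerDl.
  have h2 : s * qform M v <= e / 2.
    apply: le_trans s2; apply: ler_wpM2l; first exact: ltW.
    by apply: (le_trans qv); rewrite lerDl.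
  lra.
have b0 h : b (h *m 'J q t) = 0.
  apply/eqP; rewrite eq_le b_ge0 andbT.
  have := b_ge0 (- h); rewrite mulNmx -sub0r -bB.
  by rewrite /b !mul0mx [X in X - _]mxE sub0r oppr_ge0.
apply/colP => i; have := b0 (delta_mx 0 i).
rewrite /b -rowE -!row_mul mxE => ->; by rewrite mxE.
Qed.

(** There is no mean value equality for vector-valued maps, so the intermediate point depends on the
    coordinate [j]. *)
Lemma mean_value_row d p (f : 'rV[R]_d -> 'rV[R]_p) t0 t r (j : 'I_p) :
  (forall s, `|s - t0| < r -> differentiable f s) -> `|t - t0| < r ->
  exists2 xi, `|xi - t0| <= `|t - t0| &
    f t 0 j - f t0 0 j = ((t - t0) *m 'J f xi) 0 j.
Proof.
move=> df tr; pose h := t - t0.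
pose g (s : R) : R := f (s *: h + t0) 0 j.
pose dg (s : R) : R := (h *m 'J f (s *: h + t0)) 0 j.
have inb (s : R) : 0 <= s <= 1 -> `|s *: h + t0 - t0| <= `|t - t0|.
  move=> /andP[s0 s1]; rewrite addrK normrZ ger0_norm// ler_piMl//.
have dfs (s : R) : 0 <= s <= 1 -> is_derive s 1 g (dg s).
  move=> s01; have dz := df _ (le_lt_trans (inb s s01) tr).
  have H : (fun u : R => u^-1 *: (g (u *: 1 + s) - g s)) @ 0^' --> dg s.
    rewrite (_ : (fun u => _) = (fun M : 'rV[R]_p => M 0 j) \o
        (fun u : R => u^-1 *: (f (u *: h + (s *: h + t0)) - f (s *: h + t0)))).
      apply: cvg_comp; first exact: derive_line.
      exact: coord_continuous.
    apply/funext => u /=; rewrite /g !mxE [u%:A]mulr1 scalerDl addrA.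
    by rewrite [LHS]/GRing.scale/=.
  apply: DeriveDef; last exact: cvg_lim H.
  by apply/cvg_ex; exists (dg s).
have [||c c01] := @MVT_segment R g dg 0 1 ler01.
- move=> x; rewrite in_itv/= => /andP[x0 x1]; apply: dfs.
  by rewrite !ltW.
- apply: derivable_within_continuous => x; rewrite in_itv/= => x01.
  by have [] := dfs x x01.
rewrite subr0 mulr1 /g scale1r scale0r add0r subrK => ->.
exists (c *: h + t0) => //; apply: inb.
by move: c01; rewrite in_itv.
Qed.

Lemma mulmx_inj d p (A B : 'M[R]_(d, p)) : (forall h : 'rV_d, h *m A = h *m B) -> A = B.
Proof.
by move=> AB; apply/row_matrixP => i; rewrite !rowE.
Qed.

Lemma mxvec_differentiable d p r (f : 'rV[R]_d -> 'M[R]_(p, r)) t :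
  differentiable f t -> differentiable (fun s => mxvec (f s)) t.
Proof.
move=> df; apply: (@differentiable_comp _ _ _ _ f mxvec t df).
apply: linear_differentiable.
suff : continuous (fun A : 'M[R]_(p, r) => mxvec A) by [].
move=> A; apply/(@cvgrPdist_lt _ _ _ (nbhs A)) => e e0.
apply/nbhs_ballP; exists e => // B.
by rewrite -ball_normE/= -linearB/= mxvec_norm.
Qed.

Lemma mxBE_mxvec p r (A B : 'M[R]_(p, r)) i j :
  (A - B) i j = mxvec A 0 (mxvec_index i j) - mxvec B 0 (mxvec_index i j).
Proof. by rewrite !mxvecE mxBE. Qed.

(** The mean value theorem for each entry of the Jacobian, read as a coordinate of the row
    [mxvec ('J f s)], whose own Jacobian is the Hessian. *)
Lemma jacobian_lipschitz d p (f : 'rV[R]_d -> 'rV[R]_p) t0 t r K :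
  (forall s, `|s - t0| < r -> differentiable (fun u => 'J f u) s /\ `|hessian f s| <= K) ->
  `|t - t0| < r -> `|'J f t - 'J f t0| <= d%:R * K * `|t - t0|.
Proof.
move=> H tr; have r0 : 0 < r by apply: le_lt_trans tr.
have K0 : 0 <= K.
  have [_] := H t0 (eq_ind_r (fun x => x < r) r0 (etrans (congr1 _ (subrr t0)) (normr0 _))).
  exact: le_trans.
apply: mxnorm_le; first by rewrite !mulr_ge0.
move=> i j.
have [s sr|xi xit E] := @mean_value_row _ _ (fun u => mxvec ('J f u)) t0 t r (mxvec_index i j) _ tr.
  by apply: mxvec_differentiable; case: (H s sr).
have -> : ('J f t - 'J f t0) i j =
    ((t - t0) *m 'J (fun u => mxvec ('J f u)) xi) 0 (mxvec_index i j).
  transitivity (mxvec ('J f t) 0 (mxvec_index i j) - mxvec ('J f t0) 0 (mxvec_index i j));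
    last exact: E.
  exact: mxBE_mxvec.
rewrite (le_trans (mxentry_le _ _ _))// (le_trans (mxnormM_le _ _))//.
rewrite mulrAC ler_wpM2r// ler_wpM2l//.
by have [] := H xi (le_lt_trans xit tr).
Qed.

Lemma empirical_mean_diff d k n (Om U : Type) (Phi : 'rV[R]_d -> U -> 'rV[R]_k)
    (X : nat -> Om -> U) w t : (forall i, differentiable (fun u => Phi u (X i w)) t) ->
  differentiable (fun u => empirical_mean (sample X n w) (Phi u)) t /\
  'J (fun u => empirical_mean (sample X n w) (Phi u)) t =
    n%:R^-1 *: \sum_(i < n) 'J (fun u => Phi u (X i w)) t.
Proof.
move=> dP.
have E : (fun u => empirical_mean (sample X n w) (Phi u)) =
    n%:R^-1 *: (\sum_(i < n) (fun u => Phi u (X i w))).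
  apply/funext => u; rewrite /empirical_mean /GRing.scale/= fct_sumE.
  by congr (_ *: _); apply: eq_bigr => i _; rewrite tnth_mktuple.
have dS : differentiable (\sum_(i < n) (fun u => Phi u (X i w))) t.
  by apply: differentiable_sum => i; exact: dP.
have dE : differentiable (fun u => empirical_mean (sample X n w) (Phi u)) t.
  by rewrite E; exact: differentiableZ.
split=> //; apply: mulmx_inj => h.
rewrite -deriveEjacobian// E deriveZ; last exact: diff_derivable.
rewrite derive_sum; last by move=> i; apply: diff_derivable; exact: dP.
rewrite -scalemxAr mulmx_sumr; congr (_ *: _); apply: eq_bigr => i _.
by rewrite deriveEjacobian.
Qed.

End differential.

(** * Deterministic expansion of the estimator *)

Section gmm_deterministic.
Context (R : realType) (d k : nat).

Lemma qform1_bounds (x : 'rV[R]_k) :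
  `|x| ^+ 2 <= (x *m x^T) 0 0 <= k%:R * `|x| ^+ 2.
Proof.
have E : (x *m x^T) 0 0 = \sum_j x 0 j ^+ 2.
  by rewrite mxE; apply: eq_bigr => j _; rewrite mxE expr2.
rewrite E; apply/andP; split.
  have s0 : 0 <= \sum_j x 0 j ^+ 2 by apply: sumr_ge0 => j _; exact: sqr_ge0.
  rewrite -[leRHS]sqr_sqrtr// lerXn2r ?nnegrE ?sqrtr_ge0//.
  apply: mxnorm_le => [|i j]; first exact: sqrtr_ge0.
  rewrite ord1 -sqrtr_sqr ler_sqrt// (bigD1 j)//= lerDl.
  by apply: sumr_ge0 => l _; exact: sqr_ge0.
have -> : k%:R * `|x| ^+ 2 = \sum_(j < k) `|x| ^+ 2.
  by rewrite sumr_const card_ord mulr_natl.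
apply: ler_sum => j _; rewrite -(ger0_norm (sqr_ge0 (x 0 j))) normrX.
by rewrite lerXn2r ?nnegrE// mxentry_le.
Qed.

Lemma qformBl (M N : 'M[R]_k) x : qform M x - qform N x = qform (M - N) x.
Proof. by rewrite /qform mulmxBr mulmxBl mxBE. Qed.

(** Weight estimators need not be symmetric, but the first-order condition sees only their symmetric
    part, which is as close to the symmetric limit. *)
Lemma symmetrize_le (M W : 'M[R]_k) e : W^T = W -> `|M - W| <= e ->
  `|2^-1 *: (M + M^T) - W| <= e.
Proof.
move=> sW MW.
have -> : 2^-1 *: (M + M^T) - W = 2^-1 *: ((M - W) + (M - W)^T).
  have sWe i j : W j i = W i j by rewrite -[in LHS]sW mxE.
  by apply/matrixP => i j; rewrite !mxE (sWe i j); field.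
rewrite normrZ ger0_norm ?invr_ge0// ler_pdivrMl//.
apply: le_trans (ler_normD _ _) _; rewrite mxnorm_tr mulr_natl mulr2n.
exact: lerD.
Qed.

Context (Theta : set 'rV[R]_d) (cTheta : compact Theta)
  (f : 'rV[R]_d -> 'rV[R]_k) (cf : {within Theta, continuous f})
  (theta0 : 'rV[R]_d) (f0 : f theta0 = 0)
  (funiq : forall t, Theta t -> f t = 0 -> t = theta0)
  (r0 : R) (r0_gt0 : 0 < r0) (ballT : ball theta0 r0 `<=` Theta)
  (Wf : 'rV[R]_d -> 'M[R]_k) (W : 'M[R]_k)
  (cW : forall e, 0 < e -> exists2 r, 0 < r & forall t, Theta t ->
     `|t - theta0| < r -> `|Wf t - W| <= e)
  (sW : W^T = W) (pW : posdef W) (D : 'M[R]_(d, k)) (rD : \rank D = d)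
  (K : R) (K0 : 0 <= K).

(** The order of quantifiers matters: [C0] comes before [e], so the coefficient of |q theta0| can be
    made arbitrarily small, while the tolerance [e'] may depend on [e]. The first-step minimizer is
    only located near [theta0], to bring its weight close to [W]; the second-step one is located as
    an interior point, where [first_order_bound] applies. *)
Lemma gmm_deterministic : exists C0 e0 : R, [/\ 0 <= C0, 0 < e0 &
  forall e, 0 < e -> e <= e0 -> exists2 e', 0 < e' &
  forall (q qm : 'rV[R]_d -> 'rV[R]_k) (Wm : 'rV[R]_d -> 'M[R]_k) (c : R) t1 t2,
  0 <= c -> c <= e' ->
  (forall t, Theta t -> `|q t - f t| <= e') ->
  (forall t, Theta t -> `|qm t - q t| <= c) ->
  (forall t, Theta t -> `|Wm t - Wf t| <= e') ->
  (forall s, `|s - theta0| < r0 -> [/\ differentiable q s, differentiable qm s,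
     `|'J qm s - 'J q s| <= c & `|'J q s - 'J q theta0| <= K * `|s - theta0|]) ->
  `|'J q theta0 - D| <= e' ->
  minimizer Theta (fun t => (qm t *m (qm t)^T) 0 0) t1 ->
  minimizer Theta (fun t => qform (Wm t1) (qm t)) t2 ->
  `|t2 - theta0 + q theta0 *m W *m D^T *m invmx (D *m W *m D^T)|
     <= C0 * (e * `|q theta0| + c)].
Proof.
have uS : D *m W *m D^T \in unitmx by apply/posdef_unit/posdef_conj.
have [C [e0 [C0 e0_gt0 foc]]] := first_order_bound sW uS.
exists C, e0; split => // e e_gt0 ee0.
have Theta0 : Theta theta0 by apply: ballT; exact: ballxx.
have [l l0 lW] := posdef_min pW.
(* e / 2 is the accuracy that [first_order_bound] demands of the weight; the other term keeps the
   form of [Wm t1] above l / 2 times the squared norm. *)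
pose ew := Num.min (e / 2) (l / 4 / (k%:R ^+ 2 + 1)).
have k2 : 0 <= k%:R ^+ 2 :> R by rewrite exprn_ge0.
have ew0 : 0 < ew by rewrite lt_min !divr_gt0// ltr_wpDl.
have ew1 : ew <= e / 2 by rewrite ge_min lexx.
have ew2 : ew * (k%:R ^+ 2 + 1) <= l / 4.
  by rewrite -ler_pdivlMr ?ltr_wpDl// ge_min lexx orbT.
clearbody ew.
have [eta1 eta1_gt0 W1] := cW ew0.
pose eta2 := Num.min r0 (e / 2 / (K + 1)).
have eta2_gt0 : 0 < eta2 by rewrite lt_min r0_gt0 !divr_gt0// ltr_wpDl.
have h1 : eta2 <= r0 by rewrite ge_min lexx.
have h2 : eta2 * (K + 1) <= e / 2.
  by rewrite -ler_pdivlMr ?ltr_wpDl// ge_min lexx orbT.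
clearbody eta2.
have [s1 s1_gt0 sep1] := sub_well_separated cTheta cf funiq eta1_gt0.
have [s2 s2_gt0 sep2] := sub_well_separated cTheta cf funiq eta2_gt0.
(* Comparing the criterion at [t2] and [theta0] will give |qm t2|^2 <= (B - 1) e'^2, hence |qm t2|
   <= B e' since B - 1 <= B^2. In the same way |qm t1| <= 2 (k + 1) e'. Passing from [qm] to [f]
   costs 2 e', which explains the denominators in [e']. *)
pose B := 1 + 8 * k%:R ^+ 2 * (`|W| + l + 1) / l.
have B0 : 0 <= B.
  by rewrite addr_ge0// divr_ge0 ?(ltW l0)//; nneg; exact: ltW.
pose e' := Num.min (Num.min (e / 4) ew) (Num.min (s1 / (2 * k%:R + 4)) (s2 / (B + 2))).
have e'_gt0 : 0 < e'.
  by rewrite !lt_min ew0 !divr_gt0// ltr_wpDl// mulr_ge0.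
exists e' => //.
have e'1 : e' <= e / 4 by rewrite !ge_min lexx.
have e'2 : e' <= ew by rewrite !ge_min lexx orbT.
have e'3 : (2 * k%:R + 4) * e' <= s1.
  by rewrite mulrC -ler_pdivlMr ?ltr_wpDl ?mulr_ge0// !ge_min lexx !orbT.
have e'4 : (B + 2) * e' <= s2.
  by rewrite mulrC -ler_pdivlMr ?ltr_wpDl// !ge_min lexx !orbT.
clearbody e'.
have ar1 x : x <= e' -> x + (e / 2 + e') <= e by lra.
have ar2 : e' + ew <= e by lra.
have ar3 : e / 2 + e' <= e by lra.
move=> q qm Wm c t1 t2 c0 ce' qf qmq WmW dq J0 [Tt1 min1] [Tt2 min2].
have qm0 : `|qm theta0| <= 2 * e'.
  rewrite -[qm theta0](subrK (q theta0)).
  apply: le_trans (ler_normD _ _) _; rewrite mulr_natl mulr2n lerD//.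
    exact: le_trans (qmq _ Theta0) _.
  by have := qf _ Theta0; rewrite f0 subr0.
have fqm t : Theta t -> `|f t| <= `|qm t| + 2 * e'.
  move=> Tt; rewrite -[f t](subrK (q t)) -[q t in X in _ + X](subrK (qm t)).
  apply: le_trans (ler_normD _ _) _.
  have a1 : `|f t - q t| <= e' by rewrite distrC qf.
  have a2 : `|q t - qm t + qm t| <= e' + `|qm t|.
    apply: le_trans (ler_normD _ _) _; rewrite lerD2r distrC.
    exact: le_trans (qmq t Tt) _.
  lra.
have t1near : `|t1 - theta0| < eta1.
  apply: sep1 => //; apply: le_trans (fqm _ Tt1) _.
  have := min1 _ Theta0.
  have /andP[lo _] := qform1_bounds (qm t1).
  have /andP[_ hi] := qform1_bounds (qm theta0).
  move=> /(le_trans lo)/le_trans/(_ hi) le1.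
  have : `|qm t1| <= 2 * (k%:R + 1) * e'.
    rewrite -(@ler_pXn2r _ 2)// ?nnegrE//; last by nneg; exact: ltW.
    apply: le_trans le1 _; rewrite [leRHS](_ : _ = (k%:R + 1) ^+ 2 * (2 * e') ^+ 2); last by ring.
    rewrite ler_pM ?exprn_ge0//.
      by rewrite sqrrD; have := ler0n R k; nra.
    by rewrite lerXn2r ?nnegrE// mulr_ge0// ltW.
  lra.
have W1' : `|Wm t1 - W| <= e' + ew.
  rewrite -[Wm t1](subrK (Wf t1)) -addrA; apply: le_trans (ler_normD _ _) _.
  by rewrite lerD//; [exact: WmW|exact: W1].
have t2near : `|t2 - theta0| < eta2.
  apply: sep2 => //; apply: le_trans (fqm _ Tt2) _.
  have hw : k%:R ^+ 2 * (e' + ew) <= l / 2 by nra.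
  have lo : l / 2 * `|qm t2| ^+ 2 <= qform (Wm t1) (qm t2).
    have := qform_norm (Wm t1 - W) (qm t2); rewrite -qformBl ler_norml => /andP[+ _].
    have := lW (qm t2).
    have : k%:R ^+ 2 * `|Wm t1 - W| * `|qm t2| ^+ 2 <= l / 2 * `|qm t2| ^+ 2.
      rewrite ler_wpM2r ?exprn_ge0//; apply: le_trans hw; exact: ler_wpM2l.
    lra.
  have hi : qform (Wm t1) (qm theta0) <= k%:R ^+ 2 * (`|W| + l + 1) * (2 * e') ^+ 2.
    apply: le_trans (ler_norm _) _; apply: le_trans (qform_norm _ _) _.
    have ln : l / 4 >= ew + e' * 0 + 0 * k%:R by nra.
    apply: ler_pM; [nneg|by rewrite exprn_ge0| |by rewrite lerXn2r ?nnegrE// mulr_ge0// ltW].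
    apply: ler_wpM2l => //; rewrite -[Wm t1](subrK W) addrC.
    apply: le_trans (ler_normD _ _) _; lra.
  have hm := le_trans lo (le_trans (min2 _ Theta0) hi).
  have : `|qm t2| <= B * e'.
    rewrite -(@ler_pXn2r _ 2)// ?nnegrE//; last by nneg; exact: ltW.
    have {}hm : `|qm t2| ^+ 2 <= (B - 1) * e' ^+ 2.
      have -> : (B - 1) * e' ^+ 2 = (l / 2)^-1 * (k%:R ^+ 2 * (`|W| + l + 1) * (2 * e') ^+ 2).
        by rewrite /B; field; exact: lt0r_neq0.
      by rewrite ler_pdivlMl// divr_gt0.
    apply: le_trans hm _; rewrite exprMn ler_wpM2r ?exprn_ge0// ?(ltW e'_gt0)//.
    nra.
  lra.
have [dqt2 dqmt2 JJ JK] := dq _ (lt_le_trans t2near h1).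
have Kle (s : R) : 0 <= s -> s <= eta2 -> K * s <= e / 2.
  move=> _ se; apply: le_trans (ler_wpM2l K0 se) _; apply: le_trans h2.
  by rewrite mulrC ler_pM2l// lerDl.
have JD s : `|s - theta0| <= `|t2 - theta0| -> `|'J q s - D| <= e / 2 + e'.
  move=> st; have st2 := le_lt_trans st t2near.
  have [_ _ _ JKs] := dq _ (lt_le_trans st2 h1).
  rewrite -['J q s](subrK ('J q theta0)) -addrA; apply: le_trans (ler_normD _ _) _.
  by rewrite lerD//; apply: le_trans JKs _; apply: Kle => //; exact: ltW.
have /choice[xi xiP] : forall j : 'I_k, exists xi, `|xi - theta0| <= `|t2 - theta0| /\
    q t2 0 j - q theta0 0 j = ((t2 - theta0) *m 'J q xi) 0 j.
  move=> j; have [s sr|xi xi1 xi2] := @mean_value_row _ _ _ q theta0 t2 r0 j _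
      (lt_le_trans t2near h1).
    by case: (dq _ sr).
  by exists xi.
(* The j-th column comes from the Jacobian at the intermediate point of the j-th coordinate, so that
   q t2 = q theta0 + (t2 - theta0) G exactly. *)
pose G : 'M[R]_(d, k) := \matrix_(i, j) 'J q (xi j) i j.
have t2b : ball t2 (r0 - `|t2 - theta0|) `<=` Theta.
  move=> s; rewrite -ball_normE/= => ts; apply: ballT; rewrite -ball_normE/=.
  apply: le_lt_trans (ler_distD t2 _ _) _.
  by rewrite distrC addrC -ltrBrDr.
apply: (foc e c (q theta0) (qm t2) (t2 - theta0) ('J qm t2) G
  (2^-1 *: (Wm t1 + (Wm t1)^T))) => //.
- exact: ltW.
- rewrite -['J qm t2](subrK ('J q t2)) -addrA; apply: le_trans (ler_normD _ _) _.
  apply: le_trans (lerD JJ (JD t2 (lexx _))) _.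
  exact: ar1.
- by apply: symmetrize_le => //; exact: le_trans W1' _.
- apply: mxnorm_le; first exact: ltW.
  move=> i j; rewrite mxBE mxE -mxBE; apply: le_trans (mxentry_le _ _ _) _.
  exact: le_trans (JD _ (xiP j).1) _.
- rewrite (_ : q theta0 + (t2 - theta0) *m G = q t2); first exact: qmq.
  apply/rowP => j; rewrite [LHS]mxE.
  have -> : ((t2 - theta0) *m G) 0 j = ((t2 - theta0) *m 'J q (xi j)) 0 j.
    by rewrite [LHS]mxE [RHS]mxE; apply: eq_bigr => i _; rewrite [G i j]mxE.
  by rewrite -(xiP j).2 addrC subrK.
- rewrite -scalemxAr -scalemxAl.
  rewrite (@first_order_condition _ _ _ Theta qm (Wm t1) t2 (r0 - `|t2 - theta0|))//.
    by rewrite scaler0.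
  by rewrite subr_gt0 (lt_le_trans t2near).
Qed.

End gmm_deterministic.

(** * Expansion in mean square *)

Lemma remainder_sum_le (R : realType) (U W v y a b k z1 z2 z3 z4 eta : R) :
  a + b <= eta / 2 -> (U + W) * v <= eta / 4 -> z4 <= eta / 4 -> z2 <= W * v ->
  z3 <= z4 -> z1 <= y ->
  a + b + k * y + (U * v + z1 + z2 + z3) <= (k + 1) * y + eta.
Proof. lra. Qed.

Section moment_bound.
Context (R : realType) (d : measure_display) (Om : measurableType d)
  (P : probability Om R) (phi : nat -> R) (phioo : phi m @[m --> \oo] --> +oo).

Lemma le_integralD (f g : Om -> R) (a b : R) :
  measurable_fun setT f -> measurable_fun setT g ->
  (forall w, 0 <= f w) -> (forall w, 0 <= g w) ->
  (\int[P]_w (f w)%:E <= a%:E)%E -> (\int[P]_w (g w)%:E <= b%:E)%E ->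
  (\int[P]_w (f w + g w)%:E <= (a + b)%:E)%E.
Proof.
move=> mf mg f0 g0 fa gb; under eq_integral do rewrite EFinD.
rewrite ge0_integralD//; try exact/measurable_EFinP;
  try by move=> w _; rewrite lee_fin.
by rewrite EFinD leeD.
Qed.

Lemma le_integralZ (f : Om -> R) (l a : R) :
  measurable_fun setT f -> (forall w, 0 <= f w) -> 0 <= l ->
  (\int[P]_w (f w)%:E <= a%:E)%E -> (\int[P]_w (l * f w)%:E <= (l * a)%:E)%E.
Proof.
move=> mf f0 l0 fa; under eq_integral do rewrite EFinM.
rewrite ge0_integralZl_EFin//; try exact/measurable_EFinP;
  try by move=> w _; rewrite lee_fin.
by rewrite EFinM; apply: lee_wpmul2l.
Qed.

Lemma sqr_split_le (C e x y z : R) : 0 <= C -> 0 <= e -> 0 <= x -> 0 <= y -> 0 <= z ->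
  z <= C * (e * x + y) -> z ^+ 2 <= 2 * C ^+ 2 * e ^+ 2 * x ^+ 2 + 2 * C ^+ 2 * y ^+ 2.
Proof.
move=> C0 e0 x0 y0 z0 zC.
apply: (@le_trans _ _ ((C * (e * x + y)) ^+ 2)).
  by rewrite lerXn2r ?nnegrE//; apply: le_trans zC.
have := mulr_ge0 (sqr_ge0 C) (sqr_ge0 (e * x - y)); lra.
Qed.

Lemma amgm_le (y s : R) : 0 < s -> y <= s * y ^+ 2 + s^-1.
Proof.
move=> s0; have : 0 <= s^-1 * ((s * y - 1) ^+ 2 + s * y ^+ 2 * s + 1).
  by nneg.
have -> : s^-1 * ((s * y - 1) ^+ 2 + s * y ^+ 2 * s + 1) = 2 * (s * y ^+ 2 + s^-1 - y).
  by field; exact: lt0r_neq0.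
by rewrite pmulr_rge0// subr_ge0.
Qed.

Context (r c : nat -> nat -> Om -> R) (alpha A2 A4 : nat -> Om -> R)
  (R0 R1 Ka Kc : R) (R0_ge0 : 0 <= R0) (R1_ge0 : 0 <= R1)
  (Ka_ge0 : 0 <= Ka) (Kc_ge0 : 0 <= Kc)
  (mr : forall n m, measurable_fun setT (r n m))
  (mc : forall n m, measurable_fun setT (c n m))
  (mA2 : forall n, measurable_fun setT (A2 n))
  (mA4 : forall n, measurable_fun setT (A4 n))
  (r_ge0 : forall n m w, 0 <= r n m w) (c_ge0 : forall n m w, 0 <= c n m w)
  (alpha_ge0 : forall n w, 0 <= alpha n w)
  (alpha2 : forall n w, alpha n w ^+ 2 <= A2 n w)
  (alpha4 : forall n w, alpha n w ^+ 4 <= A4 n w)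
  (IA2 : forall n, (0 < n)%N -> (\int[P]_w (A2 n w)%:E <= (Ka / n%:R)%:E)%E)
  (IA4 : forall n, (0 < n)%N -> (\int[P]_w (A4 n w)%:E <= (Ka / n%:R ^+ 2)%:E)%E)
  (Ic : \forall m \near \oo, forall n, (0 < n)%N ->
     (\int[P]_w (c n m w ^+ 2)%:E <= (Kc / phi m ^+ 2)%:E)%E)
  (r_le : forall n m w, (0 < n)%N -> r n m w <= R0 + R1 * alpha n w)
  (C0 e0 : R) (C0_ge0 : 0 <= C0) (e0_gt0 : 0 < e0)
  (rare_r : forall e, 0 < e -> e <= e0 -> rare P phi (fun n m => [set w |
    ~ (r n m w <= C0 * (e * alpha n w + c n m w))])).

(* On the rare event E the bound on r is crude, and n alpha^2 1_E is absorbed by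
   e n^2 alpha^4 + 1_E / e. *)
Lemma second_moment_remainder : exists2 C, 0 <= C & forall eta, 0 < eta ->
  \forall n \near \oo & m \near \oo,
    (n%:R%:E * \int[P]_w (r n m w ^+ 2)%:E <=
     (C * (n%:R / phi m ^+ 2) + eta)%:E)%E.
Proof.
exists (2 * C0 ^+ 2 * Kc + 1).
  by rewrite addr_ge0// !mulr_ge0// sqr_ge0.
move=> eta eta0.
(* Coefficients of the two terms that only a small e controls: n E alpha^2 off the rare event, and
   n^2 E alpha^4 on it, after the absorption. *)
pose Q := 2 * C0 ^+ 2 * Ka + 2 * R1 ^+ 2 * Ka.
have Q0 : 0 <= Q by rewrite addr_ge0// !mulr_ge0// sqr_ge0.
pose e := Num.min (Num.min e0 1) (eta / 2 / (Q + 1)).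
have e_gt0 : 0 < e by rewrite !lt_min e0_gt0 ltr01 !divr_gt0// ltr_wpDl.
have ee0 : e <= e0 by rewrite !ge_min lexx.
have e1 : e <= 1 by rewrite !ge_min lexx orbT.
have eQ : Q * e <= eta / 2.
  apply: (@le_trans _ _ ((Q + 1) * e)); first by rewrite ler_wpM2r ?(ltW e_gt0)// lerDl.
  by rewrite mulrC -ler_pdivlMr ?ltr_wpDl// !ge_min lexx orbT.
clearbody e.
have [B [Cr [mB HB]]] := rare_r e_gt0 ee0.
pose Cp := Num.max Cr 0.
have Cp0 : 0 <= Cp by rewrite le_max lexx orbT.
pose U := 2 * R0 ^+ 2 * Cp; pose W := 2 * R1 ^+ 2 * Cp / e.
have U0 : 0 <= U by rewrite !mulr_ge0// sqr_ge0.
have W0 : 0 <= W by rewrite divr_ge0 ?(ltW e_gt0)// !mulr_ge0// sqr_ge0.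
near=> n m.
have n0 : (0 < n)%N by near: n; exact: nbhs_infty_gt.
have n0' : 0 < n%:R :> R by rewrite ltr0n.
have nUW : 4 * (U + W) / eta <= n%:R by near: n; exact: nbhs_infty_ger.
have phi1 : 1 <= phi m by near: m; exact: phi_ge.
have phiU : U <= phi m by near: m; exact: phi_ge.
have phiW : 4 * W / eta <= phi m by near: m; exact: phi_ge.
have p0 : 0 < phi m by apply: lt_le_trans phi1.
have /(_ n n0)[AB PB] : forall n, (0 < n)%N ->
    [set w | ~ (r n m w <= C0 * (e * alpha n w + c n m w))] `<=` B n m /\
     (P (B n m) <= (Cr * (n%:R ^- 2 + phi m ^- 3))%:E)%E by near: m.
have /(_ n n0) Icm : forall n, (0 < n)%N ->
   (\int[P]_w (c n m w ^+ 2)%:E <= (Kc / phi m ^+ 2)%:E)%E by near: m.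
pose b := Cp * (n%:R ^- 2 + phi m ^- 3).
have IB : (\int[P]_w (\1_(B n m) w)%:E <= b%:E)%E.
  rewrite integral_indic// setIT (le_trans PB)// lee_fin /b ler_wpM2r ?le_max ?lexx//.
  by rewrite addr_ge0// invr_ge0 exprn_ge0// ltW.
have m1 : measurable_fun setT (fun w => (\1_(B n m) w : R)) by exact: measurable_indic.
have en0 : 0 < e * n%:R by rewrite mulr_gt0.
pose k1 := 2 * C0 ^+ 2 * e ^+ 2; pose k2 := 2 * C0 ^+ 2.
pose k3 := 2 * R0 ^+ 2 + 2 * R1 ^+ 2 * (e * n%:R)^-1.
pose k4 := 2 * R1 ^+ 2 * (e * n%:R).
have k10 : 0 <= k1 by rewrite /k1; nneg.
have k20 : 0 <= k2 by rewrite /k2; nneg.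
have k30 : 0 <= k3 by rewrite /k3; nneg.
have k40 : 0 <= k4 by rewrite /k4; nneg.
have A20 w : 0 <= A2 n w by apply: le_trans (alpha2 n w); exact: sqr_ge0.
have A40 w : 0 <= A4 n w by apply: le_trans (alpha4 n w); exact: exprn_ge0.
pose Z w := (k1 * A2 n w + k2 * (c n m w ^+ 2)) + (k3 * \1_(B n m) w + k4 * A4 n w).
have i0 w : 0 <= \1_(B n m) w :> R by rewrite indicE.
have mc2 : measurable_fun setT (fun w => c n m w ^+ 2) by exact: measurable_funX.
have mZ1 : measurable_fun setT (fun w => k1 * A2 n w + k2 * (c n m w ^+ 2)).
  by apply: measurable_funD; exact: measurable_funM.
have mZ2 : measurable_fun setT (fun w => k3 * \1_(B n m) w + k4 * A4 n w).
  by apply: measurable_funD; exact: measurable_funM.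
have rZ w : r n m w ^+ 2 <= Z w.
  have c2 := sqr_ge0 (c n m w).
  have [wB|wB] := boolP (w \in B n m).
    have rr : r n m w ^+ 2 <= 2 * R0 ^+ 2 + 2 * R1 ^+ 2 * alpha n w ^+ 2.
      have := @sqr_split_le 1 R1 (alpha n w) R0 (r n m w) ler01 R1_ge0 (alpha_ge0 n w) R0_ge0 (r_ge0 n m w).
      rewrite mul1r expr1n !mulr1 addrC => /(_ (r_le m w n0)); by rewrite addrC.
    have aa := amgm_le (alpha n w ^+ 2) en0.
    have a4 : (alpha n w ^+ 2) ^+ 2 <= A4 n w by rewrite -exprM; exact: alpha4.
    have {}aa : alpha n w ^+ 2 <= e * n%:R * A4 n w + (e * n%:R)^-1.
      by apply: le_trans aa _; rewrite lerD2r ler_pM2l.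
    rewrite /Z indicE wB mulr1 addrC -[leLHS]addr0 lerD//; last first.
      by rewrite addr_ge0// mulr_ge0.
    apply: le_trans rr _.
    have -> : k3 + k4 * A4 n w = 2 * R0 ^+ 2 + 2 * R1 ^+ 2 *
        (e * n%:R * A4 n w + (e * n%:R)^-1) by rewrite /k3 /k4; ring.
    by rewrite lerD2l ler_wpM2l//; nneg.
  have rr : r n m w <= C0 * (e * alpha n w + c n m w).
    by apply: contrapT => h; move/negP: wB; apply; apply/mem_set/AB.
  rewrite /Z indicE (negbTE wB) mulr0 add0r -[leLHS]addr0 lerD//; last by rewrite mulr_ge0.
  apply: le_trans (sqr_split_le C0_ge0 (ltW e_gt0) (alpha_ge0 n w) (c_ge0 n m w) (r_ge0 n m w) rr) _.
  by rewrite -/k1 -/k2 lerD2r ler_wpM2l.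
have IZ : (\int[P]_w (Z w)%:E <= (k1 * (Ka / n%:R) + k2 * (Kc / phi m ^+ 2) +
    (k3 * b + k4 * (Ka / n%:R ^+ 2)))%:E)%E.
  apply: le_integralD => //.
  - by move=> w; apply: addr_ge0; apply: mulr_ge0 => //; exact: sqr_ge0.
  - by move=> w; apply: addr_ge0; apply: mulr_ge0.
  - apply: le_integralD => //; try exact: measurable_funM.
    + by move=> w; apply: mulr_ge0.
    + by move=> w; apply: mulr_ge0 => //; exact: sqr_ge0.
    + by apply: le_integralZ => //; exact: IA2.
    + by apply: le_integralZ => // w; exact: sqr_ge0.
  - apply: le_integralD => //; try exact: measurable_funM.
    + by move=> w; apply: mulr_ge0.
    + by move=> w; apply: mulr_ge0.
    + exact: le_integralZ.
    + by apply: le_integralZ => //; exact: IA4.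
have Ir : (\int[P]_w (r n m w ^+ 2)%:E <= (k1 * (Ka / n%:R) + k2 * (Kc / phi m ^+ 2) +
    (k3 * b + k4 * (Ka / n%:R ^+ 2)))%:E)%E.
  apply: le_trans IZ; apply: ge0_le_integral => //.
  - by move=> w _; rewrite lee_fin sqr_ge0.
  - by apply/measurable_EFinP; exact: measurable_funX.
  - by apply/measurable_EFinP; exact: measurable_funD.
  - by move=> w _; rewrite lee_fin.
apply: le_trans (lee_wpmul2l _ Ir) _; first by rewrite lee_fin ltW.
rewrite -EFinM lee_fin.
pose v := n%:R^-1 : R; pose p := (phi m)^-1.
have v0 : 0 < v by rewrite invr_gt0.
have pp0 : 0 < p by rewrite invr_gt0.
(* The last bracket is the share of the rare event. Its term [U * p * (n%:R * p ^+ 2)] is at most n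
   p^2 once phi m >= U, whence the + 1 in the constant; the other three tend to 0. *)
have -> : n%:R * (k1 * (Ka / n%:R) + k2 * (Kc / phi m ^+ 2) +
    (k3 * b + k4 * (Ka / n%:R ^+ 2))) =
   (2 * C0 ^+ 2 * Ka * e ^+ 2 + 2 * R1 ^+ 2 * Ka * e) + 2 * C0 ^+ 2 * Kc * (n%:R * p ^+ 2) +
   (U * v + U * p * (n%:R * p ^+ 2) + W * v ^+ 2 + W * p ^+ 3).
  rewrite /k1 /k2 /k3 /k4 /b /U /W /v /p; field.
  by rewrite !gt_eqF.
have -> : n%:R / phi m ^+ 2 = n%:R * p ^+ 2 by rewrite /p exprVn.
have np0 : 0 <= n%:R * p ^+ 2 by rewrite mulr_ge0// sqr_ge0.
have x1 : 2 * C0 ^+ 2 * Ka * e ^+ 2 + 2 * R1 ^+ 2 * Ka * e <= eta / 2.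
  apply: le_trans eQ.
  have -> : Q * e = 2 * C0 ^+ 2 * Ka * e + 2 * R1 ^+ 2 * Ka * e by rewrite /Q; ring.
  rewrite lerD2r.
  apply: ler_wpM2l; first by nneg.
  by rewrite expr2; apply: ler_piMr => //; exact: ltW.
have v1 : v <= 1 by rewrite invf_le1// ler1n.
have p1 : p <= 1 by rewrite invf_le1.
have x2 : (U + W) * v <= eta / 4.
  move: nUW; rewrite ler_pdivrMr// => h; rewrite /v ler_pdivrMr//; lra.
have x3 : U * p <= 1 by rewrite /p ler_pdivrMr// mul1r.
have x4 : W * p <= eta / 4.
  move: phiW; rewrite ler_pdivrMr// => h; rewrite /p ler_pdivrMr//; lra.
have x5 : W * v ^+ 2 <= W * v.
  by rewrite ler_wpM2l// expr2 ler_piMr// ltW.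
have x6 : W * p ^+ 3 <= W * p.
  by rewrite ler_wpM2l// exprS ler_piMr ?(ltW pp0)// exprn_ile1// ltW.
have x7 : U * p * (n%:R * p ^+ 2) <= n%:R * p ^+ 2 by rewrite ler_piMl.
exact: remainder_sum_le x1 x2 x4 x5 x6 x7.
Unshelve. all: by end_near.
Qed.

End moment_bound.

Lemma mxBZE (R : realType) p r (A B C : 'M[R]_(p, r)) (u : R) i j :
  (A - u *: (B - C)) i j = A i j - u * (B i j - C i j).
Proof. by rewrite !mxE. Qed.

Lemma prod_modulus (R : realType) (A B C D K e : R) : 0 <= K -> 0 <= C -> 0 <= D ->
  A <= K -> B <= K -> C * (2 * K + 1) < e -> D * (2 * K + 1) < e -> A * D + C * B < e.
Proof.
move=> K0 C0 D0 AK BK Ce De.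
have k1 : A * D <= K * D by rewrite ler_wpM2r.
have k2 : C * B <= C * K by rewrite ler_wpM2l.
nra.
Qed.

Lemma Rintegral_sum (R : realType) (d : measure_display) (T : measurableType d)
    (P : probability T R) (I : Type) (s : seq I) (f : I -> T -> R) :
  (forall i, Rintegrable P (f i)) ->
  \int[P]_x (\sum_(i <- s) f i x) = \sum_(i <- s) \int[P]_x f i x.
Proof.
move=> fi; elim: s => [|i s IH].
  by under eq_Rintegral do rewrite big_nil; rewrite Rintegral1 big_nil.
under eq_Rintegral do rewrite big_cons.
rewrite RintegralD//; [by rewrite IH big_cons|exact: fi|exact: (Rintegrable_sum s fi)].
Qed.

Lemma measurable_mxnorm (R : realType) (d : measure_display) (T : measurableType d)
    (p r : nat) (Y : T -> 'M[R]_(p, r)) : measurable_mx Y ->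
  measurable_fun setT (fun w => `|Y w|).
Proof.
move=> mY.
have -> : (fun w => `|Y w|) = fun w => \big[Num.max/0]_ij `|Y w ij.1 ij.2|.
  by apply/funext => w; rewrite [LHS]/Num.Def.normr/= mx_normrE.
elim: (index_enum _) => [|ij s IH].
  by under eq_fun do rewrite big_nil; exact: measurable_cst.
under eq_fun do rewrite big_cons.
by apply: measurable_maxr => //; apply: measurableT_comp => //; exact: mY.
Qed.

Lemma mxnorm_exp_le (R : realType) (k a : nat) (x : 'rV[R]_k) (y : 'I_k -> R) :
  (0 < a)%N -> ~~ odd a -> (forall j, x 0 j = y j) -> `|x| ^+ a <= \sum_j y j ^+ a.
Proof.
move=> a0 oa xy; have s0 : 0 <= \sum_j y j ^+ a.
  by apply: sumr_ge0 => j _; exact: exprn_even_ge0.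
have [->|x0] := eqVneq x 0; first by rewrite normr0 expr0n eqn0Ngt a0.
have : mx_norm x != 0 by have := x0; rewrite -normr_eq0.
move=> /mx_norm_neq0[[i j] /= xE]; have nE : `|x| = `|x i j| := xE.
rewrite nE ord1 xy -normrX ger0_norm ?exprn_even_ge0//.
rewrite (bigD1 j)//= lerDl; apply: sumr_ge0 => l _; exact: exprn_even_ge0.
Qed.

Lemma two_step_gmm_in (R : realType) (U : Type) (d k : nat) (Theta : set 'rV[R]_d)
    (What : forall n, n.-tuple U -> (U -> 'rV[R]_k) -> 'M[R]_k)
    (Phi : 'rV[R]_d -> U -> 'rV[R]_k) (n : nat) (s : n.-tuple U) t :
  two_step_gmm Theta What Phi s t -> Theta t.
Proof. by case=> t1 _ []. Qed.

(** * Expansion of a two-step estimator with an abstract approximation error *)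

Section gmm_model.
Context (R : realType) (dT : measure_display) (T : measurableType dT)
  (mu : probability T R) (XX : set T) (mXX : measurable XX)
  (dOm : measure_display) (Om : measurableType dOm) (P : probability Om R)
  (X : nat -> {RV P >-> T}) (Xiid : iid mu X) (XXX : forall i w, XX (X i w))
  (phi : nat -> R) (phioo : phi m @[m --> \oo] --> +oo).

Lemma patch_in (f : T -> R) x : XX x -> (f \_ XX) x = f x.
Proof. by move=> XXx; rewrite patchT//; exact/mem_set. Qed.

Lemma patch_notin (f : T -> R) x : ~ XX x -> (f \_ XX) x = 0.
Proof. by move=> XXx; rewrite patchN//; apply/negP => /set_mem. Qed.

Lemma measurable_patch (f : T -> R) : measurable_fun XX f -> measurable_fun setT (f \_ XX).
Proof. by move=> mf; apply/(measurable_restrictT f mXX). Qed.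

(** The constraint function is controlled on [XX] only. The sample stays there, so extending by 0
    leaves empirical means unchanged and makes the results on i.i.d. sums over the whole space
    applicable. *)
Lemma empirical_meanE k (f : T -> 'rV[R]_k) n w j :
  empirical_mean (sample X n w) f 0 j = iavg X ((fun x => f x 0 j) \_ XX) n w.
Proof.
rewrite /empirical_mean mxE /iavg /isum summxE; congr (_ * _).
by apply: eq_bigr => i _; rewrite tnth_mktuple patch_in.
Qed.

Context (d k : nat) (Theta : set 'rV[R]_d) (cTheta : compact Theta)
  (Phi : 'rV[R]_d -> T -> 'rV[R]_k)
  (mPhi : forall t (j : 'I_k), Theta t -> measurable_fun XX (fun x => Phi t x 0 j))
  (cPhi : forall x, XX x -> {within Theta, continuous (fun t => Phi t x)})
  (kap : T -> R) (Lk : L4 mu kap) (Lk2 : L4 mu (fun x => kap x ^+ 2))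
  (kap0 : forall x, 0 <= kap x)
  (Phik : forall t x, Theta t -> XX x -> `|Phi t x| <= kap x).

Definition coordf j t := (fun x => Phi t x 0 j) \_ XX.

Lemma coordf_measurable j t : Theta t -> measurable_fun setT (coordf j t).
Proof. by move=> Tt; apply: measurable_patch; exact: mPhi. Qed.

Lemma coordf_le j t x : Theta t -> `|coordf j t x| <= kap x.
Proof.
move=> Tt; rewrite /coordf; have [Xx|nX] := pselect (XX x).
  by rewrite patch_in// (le_trans (mxentry_le _ _ _))// Phik.
by rewrite patch_notin// normr0.
Qed.

Lemma coordf_continuous j x : {within Theta, continuous (coordf j ^~ x)}.
Proof.
apply: within_continuousI => t e Tt e0; rewrite /coordf.
have [Xx|nX] := pselect (XX x); last first.
  by exists 1 => // s _ _; rewrite !patch_notin// subrr normr0.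
have [r r0 rP] := @within_continuousP _ _ _ _ _ (cPhi Xx) _ _ Tt e0.
exists r => // s Ts st; rewrite !patch_in// -mxBE.
by apply: le_lt_trans (mxentry_le _ _ _) _; exact: rP.
Qed.

Lemma L4_coordf j t : Theta t -> L4 mu (coordf j t).
Proof.
by move=> Tt; apply: L4_le Lk _ => [|x]; [exact: coordf_measurable|exact: coordf_le].
Qed.

Lemma mxint_coordf t j : mxint mu XX (Phi t) 0 j = \int[mu]_x coordf j t x.
Proof. by rewrite mxE Rintegral_mkcond. Qed.

Lemma rare_empirical_mean e : 0 < e -> rare P phi (fun n m => [set w |
  ~ forall t, Theta t ->
    `|empirical_mean (sample X n w) (Phi t) - mxint mu XX (Phi t)| <= e]).
Proof.
move=> e0.
have := @rare_fin _ _ _ P phi _ (fun j n m => [set w | ~ forall t, Theta t ->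
  `|iavg X (coordf j t) n w - \int[mu]_x coordf j t x| <= e]) _.
move=> /(_ (fun j => rare_uniform_mean phioo Xiid cTheta
  (@coordf_measurable j) (@coordf_continuous j) (@coordf_le j) Lk e0)).
apply: rare_sub; apply: nearW => m n n0 w /=; apply: contra_notP => H t Tt.
apply: mxnorm_le => [|i j]; first exact: ltW.
rewrite ord1 mxBE empirical_meanE mxint_coordf leNgt; apply/negP => h.
by apply: H; exists j => /(_ t Tt); rewrite leNgt h.
Qed.

Lemma rare_kap : rare P phi (fun n m => [set w | \int[mu]_x kap x + 1 < iavg X kap n w]).
Proof.
apply: rare_sub (rare_mean phioo Xiid Lk ltr01).
apply: nearW => m n n0 w /=; rewrite -ltrBrDl => h.
exact: lt_le_trans h (ler_norm _).
Qed.

Lemma second_momentE t i j : Theta t ->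
  second_moment mu XX (Phi t) i j = \int[mu]_x (coordf i t x * coordf j t x).
Proof.
move=> Tt; rewrite mxE Rintegral_mkcond; apply: eq_Rintegral => x _.
rewrite /coordf; have [Xx|nX] := pselect (XX x).
  by rewrite !patch_in// mxE big_ord1 mxE.
by rewrite !patch_notin// mulr0.
Qed.

(** Products of two coordinates have the envelope kap^2, which is why [mean_continuous] is applied
    with the hypothesis that kap^2 is in [L4]. *)
Lemma second_moment_continuous t e : Theta t -> 0 < e -> exists2 r, 0 < r &
  forall s, Theta s -> `|s - t| < r ->
    `|second_moment mu XX (Phi s) - second_moment mu XX (Phi t)| <= e.
Proof.
move=> Tt e0.
have H i j : exists r, 0 < r /\ forall s, Theta s -> `|s - t| < r ->
    `|second_moment mu XX (Phi s) i j - second_moment mu XX (Phi t) i j| <= e.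
  pose F s x := coordf i s x * coordf j s x.
  have mF s : Theta s -> measurable_fun setT (F s).
    by move=> Ts; apply: measurable_funM; exact: coordf_measurable.
  have cF x : {within Theta, continuous (F ^~ x)}.
    apply: within_continuousI => s eta Ts eta0.
    have K0 : 0 < 2 * kap x + 1 by rewrite ltr_wpDl// mulr_ge0.
    have ee : 0 < eta / (2 * kap x + 1) by rewrite divr_gt0.
    have [r1 r10 r1P] := @within_continuousP _ _ _ _ _ (@coordf_continuous i x) _ _ Ts ee.
    have [r2 r20 r2P] := @within_continuousP _ _ _ _ _ (@coordf_continuous j x) _ _ Ts ee.
    exists (Num.min r1 r2); first by rewrite lt_min r10.
    move=> u Tu; rewrite lt_min => /andP[us1 us2].
    have := r1P u Tu us1; have := r2P u Tu us2.
    rewrite !ltr_pdivlMr// /F.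
    have := coordf_le i x Tu; have := coordf_le j x Ts.
    move: (coordf i u x) (coordf i s x) (coordf j u x) (coordf j s x) => a a' b b' hb ha h2 h1.
    have -> : a * b - a' * b' = a * (b - b') + (a - a') * b' by ring.
    apply: le_lt_trans (ler_normD _ _) _; rewrite !normrM.
    exact: prod_modulus (kap0 x) _ _ ha hb h1 h2.
  have bF s x : Theta s -> `|F s x| <= kap x ^+ 2.
    move=> Ts; rewrite normrM expr2.
    by apply: ler_pM => //; exact: coordf_le.
  have [r r0 rP] := mean_continuous mF cF bF Lk2 Tt e0.
  exists r; split => // s Ts st; rewrite !second_momentE//.
  exact: rP.
have /choice[r rP] : forall ij : 'I_k * 'I_k, exists r, 0 < r /\ forall s, Theta s -> `|s - t| < r ->
    `|second_moment mu XX (Phi s) ij.1 ij.2 - second_moment mu XX (Phi t) ij.1 ij.2| <= e.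
  by move=> [i j]; exact: H.
exists (\big[Num.min/1]_(ij : 'I_k * 'I_k) r ij).
  by apply/bigmin_gtP; split => // ij _; case: (rP ij).
move=> s Ts /bigmin_gtP[_ st]; apply: mxnorm_le => [|i j]; first exact: ltW.
rewrite mxBE; have [_] := rP (i, j); apply => //.
exact: (st (i, j)).
Qed.

Context (theta0 : 'rV[R]_d) (mean0 : mxint mu XX (Phi theta0) = 0)
  (r0 : R) (r0_gt0 : 0 < r0) (ballT : ball theta0 r0 `<=` Theta)
  (cmean : {within Theta, continuous (fun t => mxint mu XX (Phi t))})
  (ucov : forall t, Theta t -> covmx mu XX (Phi t) \in unitmx)
  (rV : \rank (second_moment mu XX (Phi theta0)) = k).

Local Notation V := (second_moment mu XX (Phi theta0)).

Lemma Theta_theta0 : Theta theta0. Proof. by apply: ballT; exact: ballxx. Qed.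

Lemma second_moment_sym : V^T = V.
Proof.
apply/matrixP => i j; rewrite mxE !second_momentE//; try exact: Theta_theta0.
by apply: eq_Rintegral => x _; rewrite mulrC.
Qed.

Lemma second_moment_unit : V \in unitmx.
Proof. by rewrite -row_full_unit /row_full rV. Qed.

(** [V] is a Gram matrix: its form at y is the mean of the square of a linear combination of the
    coordinates. Full rank turns semidefinite into definite. *)
Lemma second_moment_posdef : posdef V.
Proof.
apply: psd_posdef second_moment_sym second_moment_unit _ => y.
have i2 i j : Rintegrable mu (fun x => y 0 i * (coordf i theta0 x * coordf j theta0 x) * y 0 j).
  apply: Rintegrable_eq (RintegrableZ (y 0 i * y 0 j) (Rintegrable2
    (L4_coordf i Theta_theta0) (L4_coordf j Theta_theta0))) => x /=; ring.
have -> : qform V y = \int[mu]_x (\sum_i \sum_j (y 0 i * (coordf i theta0 x * coordf j theta0 x) * y 0 j)).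
  rewrite /qform mxE; under eq_bigr do rewrite mxE mulr_suml [(y^T)%R _ _]mxE.
  rewrite exchange_big/= Rintegral_sum; last by move=> i; exact: Rintegrable_sum.
  apply: eq_bigr => i _; rewrite Rintegral_sum//; apply: eq_bigr => j _.
  have ij := Rintegrable2 (L4_coordf i Theta_theta0) (L4_coordf j Theta_theta0).
  rewrite second_momentE; last exact: Theta_theta0.
  by rewrite -RintegralZl// -RintegralZr//; exact: RintegrableZ.
apply: Rintegral_ge0 => x _.
have -> : \sum_i \sum_j (y 0 i * (coordf i theta0 x * coordf j theta0 x) * y 0 j) =
   (\sum_i (y 0 i * coordf i theta0 x)) ^+ 2.
  rewrite expr2 big_distrlr/=; apply: eq_bigr => i _; apply: eq_bigr => j _; ring.
exact: sqr_ge0.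
Qed.

(** The mean vanishes at [theta0], so the covariance matrix tends to the second moment [V] there and
    the optimal weight to the inverse of [V]. *)
Lemma optimal_weight_continuous e : 0 < e -> exists2 r, 0 < r &
  forall t, Theta t -> `|t - theta0| < r ->
    `|optimal_weight mu XX Phi t - invmx V| <= e.
Proof.
move=> e0; have [a a0 aP] := invmx_continuous second_moment_unit e0.
have a2 : 0 < a / 2 by rewrite divr_gt0.
have [r1 r10 r1P] := second_moment_continuous Theta_theta0 a2.
(* One factor of the outer product of the mean with itself is bounded by 1, the other by a / 2. *)
have b0 : 0 < Num.min 1 (a / 2) by rewrite lt_min ltr01.
have [r2 r20 r2P] := @within_continuousP _ _ _ _ _ cmean _ _ Theta_theta0 b0.
exists (Num.min r1 r2); first by rewrite lt_min r10.
move=> t Tt; rewrite lt_min => /andP[t1 t2]; apply: aP; first exact: ucov.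
have := r2P t Tt t2; rewrite mean0 subr0 lt_min => /andP[m1 m2].
rewrite /covmx -addrA [- _ + _]addrC addrA.
apply: le_trans (ler_normB _ _) _; rewrite [leRHS](splitr a) lerD ?r1P//.
apply: le_trans (mxnormM_le _ _) _; rewrite mxnorm_tr mul1r.
by rewrite -[leRHS]mulr1 ler_pM// ltW.
Qed.

Context (dPhi : forall x s, XX x -> `|s - theta0| < r0 ->
    [/\ differentiable (fun t => Phi t x) s,
        differentiable (fun u => 'J (fun t => Phi t x) u) s,
        `|'J (fun t => Phi t x) s| <= kap x &
        `|hessian (fun t => Phi t x) s| <= kap x]).

Definition jacf i j := (fun x => 'J (fun t => Phi t x) theta0 i j) \_ XX.

(** A partial derivative is a pointwise limit of difference quotients, which are measurable in x;
    the steps [a l] are below r0 to remain in [Theta]. *)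
Lemma jacf_measurable i j : measurable_fun setT (jacf i j).
Proof.
apply: measurable_patch.
pose a (l : nat) : R := r0 / 2 * l.+1%:R^-1.
have a0 l : 0 < a l by rewrite mulr_gt0 ?divr_gt0// invr_gt0.
have ar l : a l < r0.
  apply: (@le_lt_trans _ _ (r0 / 2)).
    by rewrite ler_piMr ?divr_ge0 ?(ltW r0_gt0)// invf_le1// ler1n.
  by rewrite gtr_pMr// invf_lt1// ltr1n.
pose e_ : 'rV[R]_d := delta_mx 0 i.
have ne : `|e_| <= 1.
  by apply: mxnorm_le => // a' b; rewrite mxE; case: (_ && _); rewrite ?normr1 ?normr0.
have aT l : Theta (a l *: e_ + theta0).
  apply: ballT; rewrite -ball_normE/= opprD addrCA subrr addr0 normrN normrZ gtr0_norm//.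
  by apply: le_lt_trans (ar l); rewrite ler_piMr// ltW.
apply: (@measurable_fun_cvg _ _ _ _
  (fun l x => (a l)^-1 * (Phi (a l *: e_ + theta0) x 0 j - Phi theta0 x 0 j))).
  move=> l; apply: measurable_funM => //; apply: measurable_funB; apply: mPhi => //.
  exact: Theta_theta0.
move=> x Xx; have [|dx _ _ _] := dPhi Xx (s := theta0); first by rewrite subrr normr0.
apply/cvgrPdist_lt => e e0.
have /cvgrPdist_lt/(_ e e0) := @derive_line _ _ _ _ _ e_ dx.
move=> /nbhs_ballP[rho /= rho0 H].
have acvg : a l @[l --> \oo] --> (0 : R).
  rewrite -[X in _ --> X](mulr0 (r0 / 2)); apply: cvgMr.
  exact: cvg_harmonic.
have /cvgrPdist_lt/(_ rho rho0) := acvg.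
apply: filterS => l al.
have := H (a l); rewrite /ball/= => /(_ al (lt0r_neq0 (a0 l))).
move=> h; apply: le_lt_trans h.
have -> : 'J (fun t => Phi t x) theta0 i j = (e_ *m 'J (fun t => Phi t x) theta0) 0 j.
  by rewrite /e_ -rowE [RHS]mxE.
apply: le_trans (mxentry_le _ 0 j).
by rewrite mxBZE.
Qed.

Lemma jacf_le i j x : `|jacf i j x| <= kap x.
Proof.
rewrite /jacf; have [Xx|nX] := pselect (XX x).
  rewrite patch_in// (le_trans (mxentry_le _ _ _))//.
  have [|_ _ + _] := dPhi Xx (s := theta0); first by rewrite subrr normr0.
  exact.
by rewrite patch_notin// normr0.
Qed.

Lemma empirical_mean_jac n w s : `|s - theta0| < r0 ->
  differentiable (fun t => empirical_mean (sample X n w) (Phi t)) s /\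
  'J (fun t => empirical_mean (sample X n w) (Phi t)) s =
    n%:R^-1 *: \sum_(i < n) 'J (fun t => Phi t (X i w)) s.
Proof.
move=> sr; apply: empirical_mean_diff => i.
by case: (dPhi (XXX i w) sr).
Qed.

Lemma empirical_jacobian_lipschitz n w s : `|s - theta0| < r0 ->
  `|'J (fun t => empirical_mean (sample X n w) (Phi t)) s -
    'J (fun t => empirical_mean (sample X n w) (Phi t)) theta0| <=
  d%:R * iavg X kap n w * `|s - theta0|.
Proof.
move=> sr; have [|_ ->] := @empirical_mean_jac n w theta0.
  by rewrite subrr normr0.
have [_ ->] := @empirical_mean_jac n w s sr.
rewrite -scalerBr -sumrB normrZ ger0_norm ?invr_ge0//.
rewrite /iavg mulrCA -!mulrA ler_wpM2l ?invr_ge0//.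
rewrite (le_trans (ler_norm_sum _ _ _))// /isum mulr_suml mulr_sumr.
apply: ler_sum => i _; rewrite mulrA.
apply: (@jacobian_lipschitz _ _ _ (fun t => Phi t (X i w)) theta0 s r0 _ _ sr) => u ur.
by case: (dPhi (XXX i w) ur).
Qed.

Lemma rare_empirical_jacobian e : 0 < e -> rare P phi (fun n m => [set w |
  e < `|'J (fun t => empirical_mean (sample X n w) (Phi t)) theta0 -
        mean_jacobian mu XX Phi theta0|]).
Proof.
move=> e0.
have Lj i j : L4 mu (jacf i j).
  by apply: L4_le Lk _; [exact: jacf_measurable|exact: jacf_le].
have := @rare_fin _ _ _ P phi _ (fun ij n m => [set w | e <
  `|iavg X (jacf ij.1 ij.2) n w - \int[mu]_x jacf ij.1 ij.2 x|]) (fun ij => rare_mean phioo Xiid (Lj _ _) e0).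
apply: rare_sub; apply: nearW => m n n0 w /=; apply: contraPP => H.
apply/negP; rewrite -leNgt; apply: mxnorm_le => [|i j]; first exact: ltW.
have [|_ ->] := @empirical_mean_jac n w theta0; first by rewrite subrr normr0.
rewrite mxBE mxE summxE [mean_jacobian _ _ _ _ _ _]mxE Rintegral_mkcond.
rewrite leNgt; apply/negP => h; apply: H; exists (i, j) => /=.
rewrite /iavg /isum; under eq_bigr do rewrite /jacf patch_in//.
exact: h.
Qed.

Context (uniq0 : forall t, Theta t -> mxint mu XX (Phi t) = 0 -> t = theta0)
  (rD : \rank (mean_jacobian mu XX Phi theta0) = d)
  (What : forall n, n.-tuple T -> (T -> 'rV[R]_k) -> 'M[R]_k)
  (Phim : nat -> Om -> 'rV[R]_d -> T -> 'rV[R]_k)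
  (c : nat -> nat -> Om -> R) (c_ge0 : forall n m w, 0 <= c n m w)
  (Hc : \forall m \near \oo, forall n w, (0 < n)%N ->
    (forall t, Theta t -> `|empirical_mean (sample X n w) (Phim m w t) -
      empirical_mean (sample X n w) (Phi t)| <= c n m w) /\
    (forall s, `|s - theta0| < r0 ->
      differentiable (fun t => empirical_mean (sample X n w) (Phim m w t)) s /\
      `|'J (fun t => empirical_mean (sample X n w) (Phim m w t)) s -
        'J (fun t => empirical_mean (sample X n w) (Phi t)) s| <= c n m w))
  (rc : forall e, 0 < e -> rare P phi (fun n m => [set w | e < c n m w]))
  (rW : forall e, 0 < e -> rare P phi (fun n m => [set w | ~ forall t, Theta t ->
     `|weight_estimator What Phi (sample X n w) t - optimal_weight mu XX Phi t| <= e]))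
  (rWm : forall e, 0 < e -> rare P phi (fun n m => [set w | ~ forall t, Theta t ->
     `|weight_estimator What (Phim m w) (sample X n w) t
       - weight_estimator What Phi (sample X n w) t| <= e]))
  (that : nat -> nat -> Om -> 'rV[R]_d)
  (that_gmm : forall n m w, (0 < n)%N ->
     two_step_gmm Theta What (Phim m w) (sample X n w) (that n m w)).

Local Notation D := (mean_jacobian mu XX Phi theta0).

Definition influence n w : 'rV[R]_d :=
  empirical_mean (sample X n w) (Phi theta0) *m invmx V *m D^T *m
    invmx (D *m invmx V *m D^T).

(** Off the union of six rare events the hypotheses of [gmm_deterministic] hold, with the two weight
    errors sharing the tolerance [e'] equally. *)
Lemma rare_expansion : exists C0 e0 : R, [/\ 0 <= C0, 0 < e0 &
  forall e, 0 < e -> e <= e0 -> rare P phi (fun n m => [set w |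
    ~ (`|that n m w - theta0 + influence n w| <=
       C0 * (e * `|empirical_mean (sample X n w) (Phi theta0)| + c n m w))])].
Proof.
(* The Lipschitz constant of the empirical Jacobian is random, being d times an empirical mean of
   [kap]; off the event of [rare_kap] it is below this deterministic number. *)
pose K := d%:R * (\int[mu]_x kap x + 1).
have K0 : 0 <= K by rewrite mulr_ge0// addr_ge0// Rintegral_ge0.
have sW : (invmx V)^T = invmx V by rewrite trmx_inv second_moment_sym.
have pW := posdef_inv second_moment_sym second_moment_posdef.
have [C0 [e0 [C0_ge0 e0_gt0 det]]] := gmm_deterministic cTheta cmean mean0 uniq0
  r0_gt0 ballT optimal_weight_continuous sW pW rD K0.
exists C0, e0; split => // e e_gt0 ee0; have [e' e'_gt0 {}det] := det e e_gt0 ee0.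
have e'2 : 0 < e' / 2 by rewrite divr_gt0.
have := rareU (rareU (rare_empirical_mean e'_gt0) (rareU rare_kap (rare_empirical_jacobian e'_gt0)))
  (rareU (rc e'_gt0) (rareU (rW e'2) (rWm e'2))).
apply: rare_sub; near=> m => n n0 w /=.
have /(_ n w n0)[Hq HJ] : forall n w, (0 < n)%N ->
    (forall t, Theta t -> `|empirical_mean (sample X n w) (Phim m w t) -
      empirical_mean (sample X n w) (Phi t)| <= c n m w) /\
    (forall s, `|s - theta0| < r0 ->
      differentiable (fun t => empirical_mean (sample X n w) (Phim m w t)) s /\
      `|'J (fun t => empirical_mean (sample X n w) (Phim m w t)) s -
        'J (fun t => empirical_mean (sample X n w) (Phi t)) s| <= c n m w).
  by near: m.
apply: contra_notP => /not_orP[/not_orP[b1 /not_orP[b2 b3]] /not_orP[b4 /not_orP[b5 b6]]].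
have {}b1 := contrapT b1; have {}b5 := contrapT b5; have {}b6 := contrapT b6.
move/negP: b2; rewrite -leNgt => b2; move/negP: b3; rewrite -leNgt => b3.
move/negP: b4; rewrite -leNgt => b4.
have [t1 min1 min2] := that_gmm m w n0.
apply: (det (fun t => empirical_mean (sample X n w) (Phi t))
  (fun t => empirical_mean (sample X n w) (Phim m w t))
  (weight_estimator What (Phim m w) (sample X n w)) (c n m w) t1) => //.
- move=> t Tt; rewrite (splitr e').
  apply: le_trans (ler_distD (weight_estimator What Phi (sample X n w) t) _ _) _.
  by rewrite lerD ?b5 ?b6.
- move=> s sr; have [d1 d2] := HJ s sr; have [d3 _] := empirical_mean_jac n w sr.
  split => //; apply: le_trans (empirical_jacobian_lipschitz n w sr) _.
  by rewrite ler_wpM2r// ler_wpM2l.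
Unshelve. all: by end_near. Qed.

Definition score n w j := iavg X (coordf j theta0) n w.

Lemma scoreE n w j : empirical_mean (sample X n w) (Phi theta0) 0 j = score n w j.
Proof. exact: empirical_meanE. Qed.

Lemma coordf_mean0 j : \int[mu]_x coordf j theta0 x = 0.
Proof. by rewrite -mxint_coordf mean0 mxE. Qed.

Lemma L4_score n j : L4 P (fun w => score n w j).
Proof. exact: L4Z _ (L4_isum Xiid n (L4_coordf j Theta_theta0)). Qed.

Lemma Rintegral_score n j : \int[P]_w score n w j = 0.
Proof.
have Lj := L4_coordf j Theta_theta0.
rewrite RintegralZl//; last exact/L4_Rintegrable/(L4_isum Xiid n Lj).
by rewrite (Rintegral_isum1 Xiid) ?mulr0// coordf_mean0.
Qed.

Lemma Rintegral_score2 n i j : (0 < n)%N ->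
  \int[P]_w (score n w i * score n w j) = n%:R^-1 * V i j.
Proof.
move=> n0; have Li := L4_coordf i Theta_theta0; have Lj := L4_coordf j Theta_theta0.
have n0' : n%:R != 0 :> R by rewrite pnatr_eq0 -lt0n.
transitivity (\int[P]_w (n%:R^-1 ^+ 2 * (isum X (coordf i theta0) n w * isum X (coordf j theta0) n w))).
  by apply: eq_Rintegral => w _; rewrite /score /iavg; ring.
rewrite RintegralZl//; last exact: Rintegrable2 (L4_isum Xiid n Li) (L4_isum Xiid n Lj).
rewrite (Rintegral_isum2 Xiid)//; try exact: coordf_mean0.
by rewrite second_momentE; [field|exact: Theta_theta0].
Qed.

Lemma Rintegral_score4 j : exists2 K : R, 0 <= K & forall n, (0 < n)%N ->
  \int[P]_w (score n w j ^+ 4) <= K / n%:R ^+ 2.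
Proof.
have Lj := L4_coordf j Theta_theta0.
have [K K0 HK] := Rintegral_isum4_le Xiid Lj (coordf_mean0 j).
exists K => // n n0; have n0' : n%:R != 0 :> R by rewrite pnatr_eq0 -lt0n.
under eq_Rintegral do rewrite /score /iavg exprMn.
rewrite RintegralZl//; last by case: (L4_isum Xiid n Lj).
apply: le_trans (ler_wpM2l _ (HK n)) _; first by rewrite exprn_ge0// invr_ge0.
by rewrite le_eqVlt; apply/orP; left; apply/eqP; field.
Qed.

Definition influence_mx : 'M[R]_(k, d) :=
  invmx V *m D^T *m invmx (D *m invmx V *m D^T).

Lemma influenceE n w : influence n w =
  empirical_mean (sample X n w) (Phi theta0) *m influence_mx.
Proof. by rewrite /influence /influence_mx !mulmxA. Qed.

Lemma influence_coord n w j : influence n w 0 j =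
  \sum_i influence_mx i j * score n w i.
Proof.
rewrite influenceE mxE; apply: eq_bigr => i _.
by rewrite scoreE mulrC.
Qed.

Lemma L4_influence n j : L4 P (fun w => influence n w 0 j).
Proof.
have := @L4_sum _ _ _ P _ (index_enum 'I_k) (fun i w => influence_mx i j * score n w i)
  (fun i => L4Z _ (L4_score n i)).
by under eq_fun do rewrite -influence_coord.
Qed.

Lemma Rintegral_influence n j : \int[P]_w influence n w 0 j = 0.
Proof.
under eq_Rintegral do rewrite influence_coord.
rewrite Rintegral_sum; last by move=> i; apply: RintegrableZ; exact/L4_Rintegrable/L4_score.
rewrite big1// => i _; rewrite RintegralZl//; last exact/L4_Rintegrable/L4_score.
by rewrite Rintegral_score mulr0.
Qed.

(** The source of efficiency: with weight V^-1 and S = D V^-1 D^T, the sandwich S^-1 D V^-1 V V^-1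
    D^T S^-1 collapses to S^-1. *)
Lemma influence_cov : influence_mx^T *m V *m influence_mx = efficiency_bound mu XX Phi theta0.
Proof.
rewrite /efficiency_bound /influence_mx -/V.
set S := D *m invmx V *m D^T.
have sV := second_moment_sym; have uV := second_moment_unit.
have uS : S \in unitmx.
  by apply/posdef_unit/posdef_conj => //; exact: posdef_inv sV second_moment_posdef.
have sS : S^T = S by rewrite /S !trmx_mul trmxK trmx_inv sV mulmxA.
rewrite !trmx_mul trmxK !trmx_inv sV sS.
rewrite -!mulmxA (mulmxA V) mulmxV// mul1mx (mulmxA (invmx V)) (mulmxA D) (mulmxA D).
by rewrite mulmxV ?mulmx1.
Qed.

Lemma Rintegral_influence2 n i j : (0 < n)%N ->
  \int[P]_w (influence n w 0 i * influence n w 0 j) =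
  n%:R^-1 * efficiency_bound mu XX Phi theta0 i j.
Proof.
move=> n0; rewrite -influence_cov.
have I2 p q : Rintegrable P (fun w => influence_mx p i * influence_mx q j *
    (score n w p * score n w q)).
  by apply: RintegrableZ; apply: Rintegrable2; exact: L4_score.
transitivity (\int[P]_w (\sum_p \sum_q influence_mx p i * influence_mx q j *
    (score n w p * score n w q))).
  apply: eq_Rintegral => w _; rewrite !influence_coord big_distrlr/=.
  by apply: eq_bigr => p _; apply: eq_bigr => q _; ring.
rewrite Rintegral_sum; last by move=> p; exact: Rintegrable_sum.
transitivity (\sum_p \sum_q influence_mx p i * influence_mx q j * (n%:R^-1 * V p q)).
  apply: eq_bigr => p _; rewrite Rintegral_sum//; apply: eq_bigr => q _.
  rewrite RintegralZl//; last by apply: Rintegrable2; exact: L4_score.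
  by rewrite Rintegral_score2.
rewrite exchange_big/= mxE mulr_sumr; apply: eq_bigr => q _.
rewrite [(influence_mx^T *m _) i q]mxE mulr_suml mulr_sumr; apply: eq_bigr => p _.
by rewrite [(influence_mx^T)%R _ _]mxE; ring.
Qed.

Context (mc : forall n m, measurable_fun setT (c n m)) (Kc : R) (Kc_ge0 : 0 <= Kc)
  (Ic : \forall m \near \oo, forall n, (0 < n)%N ->
     (\int[P]_w (c n m w ^+ 2)%:E <= (Kc / phi m ^+ 2)%:E)%E)
  (mthat : forall n m, measurable_mx (that n m)).

Lemma Theta_bounded : exists2 b : R, 0 <= b & forall t, Theta t -> `|t - theta0| <= b.
Proof.
have /ex_strict_bound_gt0[M M0 HM] := compact_bounded cTheta.
exists (M + `|theta0|); first by rewrite addr_ge0// ltW.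
move=> t Tt; apply: le_trans (ler_normB _ _) _; rewrite lerD2r; apply/ltW.
exact: HM.
Qed.

Lemma remainder_measurable n m : measurable_mx (fun w => that n m w - theta0 + influence n w).
Proof.
move=> i j; rewrite ord1.
have -> : (fun w => (that n m w - theta0 + influence n w) 0 j) =
    (fun w => (that n m w 0 j - theta0 0 j) + influence n w 0 j).
  by apply/funext => w; rewrite [LHS]mxE mxBE.
apply: measurable_funD; last by case: (L4_influence n j).
by apply: measurable_funB => //; exact: mthat.
Qed.

(** An instance of [second_moment_remainder]. The crude bound on the remainder comes from the
    boundedness of [Theta] and the linearity of the influence in the empirical mean. *)
Lemma gmm_remainder : exists2 C, 0 <= C & forall eta, 0 < eta ->
  \forall n \near \oo & m \near \oo,
    (n%:R%:E * \int[P]_w (`|that n m w - theta0 + influence n w| ^+ 2)%:E <=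
     (C * (n%:R / phi m ^+ 2) + eta)%:E)%E.
Proof.
have [C0 [e0 [C0_ge0 e0_gt0 rare_r]]] := rare_expansion.
have [b b0 hb] := Theta_bounded.
have /choice[K4 K4P] : forall j, exists K : R, 0 <= K /\ forall n, (0 < n)%N ->
    \int[P]_w (score n w j ^+ 4) <= K / n%:R ^+ 2.
  by move=> j; have [K K0 HK] := Rintegral_score4 j; exists K.
(* One constant for both moments: the maximum norm to the power 2 or 4 is at most the sum of the
   powers of the scores, whose means are V j j / n and at most K4 j / n^2. *)
pose Ka : R := \sum_j `|V j j| + \sum_j K4 j.
have K40 : 0 <= \sum_j K4 j by apply: sumr_ge0 => j _; case: (K4P j).
have V0 : 0 <= \sum_j `|V j j| by apply: sumr_ge0.
apply: (@second_moment_remainder _ _ _ P phi phioo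
  (fun n m w => `|that n m w - theta0 + influence n w|) c
  (fun n w => `|empirical_mean (sample X n w) (Phi theta0)|)
  (fun n w => \sum_j score n w j ^+ 2) (fun n w => \sum_j score n w j ^+ 4)
  b (k%:R * `|influence_mx|) Ka Kc b0 _ _ Kc_ge0 _ mc _ _ _ c_ge0 _ _ _ _ _ Ic
  _ C0 e0 C0_ge0 e0_gt0 rare_r) => //.
- exact: addr_ge0.
- by move=> n m; apply: measurable_mxnorm; exact: remainder_measurable.
- move=> n; apply: measurable_sum => j; apply: measurable_funX; by case: (L4_score n j).
- move=> n; apply: measurable_sum => j; apply: measurable_funX; by case: (L4_score n j).
- move=> n w; have /andP[+ _] := qform1_bounds (empirical_mean (sample X n w) (Phi theta0)).
  move=> /le_trans; apply; rewrite mxE; apply: ler_sum => j _.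
  by rewrite [X in _ * X]mxE -scoreE expr2.
- move=> n w; apply: mxnorm_exp_le => // j; exact: scoreE.
- move=> n n0; rewrite RintegralE; last first.
    by apply: Rintegrable_sum => j; apply: Rintegrable2; exact: L4_score.
  rewrite lee_fin Rintegral_sum; last by move=> j; apply: Rintegrable2; exact: L4_score.
  rewrite /Ka mulrDl -[leLHS]addr0 lerD//; last by rewrite divr_ge0.
  rewrite mulr_suml; apply: ler_sum => j _; rewrite Rintegral_score2// mulrC.
  by rewrite ler_wpM2r ?invr_ge0// ler_norm.
- move=> n n0; have i4 j : Rintegrable P (fun w => score n w j ^+ 4) by case: (L4_score n j).
  rewrite RintegralE; last exact: Rintegrable_sum.
  rewrite lee_fin Rintegral_sum// /Ka mulrDl -[leLHS]add0r lerD//.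
    by rewrite divr_ge0// exprn_ge0.
  by rewrite mulr_suml; apply: ler_sum => j _; case: (K4P j) => _; apply.
- move=> n m w n0; apply: le_trans (ler_normD _ _) _.
  rewrite lerD//; first by apply: hb; exact: two_step_gmm_in (that_gmm m w n0).
  by rewrite influenceE mulrAC; exact: mxnormM_le.
Qed.

End gmm_model.

(** * Asymptotic covariance *)

Section markov_power.
Context (R : realType) (d : measure_display) (Om : measurableType d)
  (P : probability Om R).

Lemma expe_le (x y : \bar R) p : (0 <= x)%E -> (x <= y)%E -> (x ^+ p <= y ^+ p)%E.
Proof.
move=> x0 xy; elim: p => [//|p IH]; rewrite !expeS.
by apply: lee_pmul => //; exact: expe_ge0.
Qed.

Lemma measurable_expe (S : Om -> \bar R) p : measurable_fun setT S ->
  measurable_fun setT (fun w => S w ^+ p)%E.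
Proof.
move=> mS; elim: p => [|p IH]; first by under eq_fun do rewrite expe0; exact: measurable_cst.
by under eq_fun do rewrite expeS; exact: emeasurable_funM.
Qed.

Lemma measurable_egt (S : Om -> \bar R) (e : R) : measurable_fun setT S ->
  measurable [set w | (e%:E < S w)%E].
Proof.
move=> mS; have := mS measurableT _ (emeasurable_itv `]e%:E, +oo[).
rewrite setTI (_ : _ @^-1` _ = [set w | (e%:E < S w)%E])//.
by apply/seteqP; split => w /=; rewrite in_itv/= andbT.
Qed.

(** Extended-real valued because a supremum norm may be infinite on some outcomes. *)
Lemma markov_power (S : Om -> \bar R) (a e C : R) p : measurable_fun setT S ->
  (forall w, 0 <= S w)%E -> 0 < a -> 0 < e ->
  (\int[P]_w (a%:E * S w) ^+ p <= C%:E)%E ->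
  (P [set w | (e%:E < S w)%E] <= (C * (a * e) ^- p)%:E)%E.
Proof.
move=> mS S0 a0 e0 HC.
have maS : measurable_fun setT (fun w => a%:E * S w)%E by exact: measurable_funeM.
have aS0 w : (0 <= a%:E * S w)%E by rewrite mule_ge0// lee_fin ltW.
have ae0 : 0 < (a * e) ^+ p by rewrite exprn_gt0// mulr_gt0.
apply: (@prob_le_integral _ _ _ P _ (fun w => ((a * e) ^- p)%:E * (a%:E * S w) ^+ p)%E).
- exact: measurable_egt.
- by apply: measurable_funeM; exact: measurable_expe.
- by move=> w; rewrite mule_ge0 ?lee_fin ?invr_ge0 ?(ltW ae0)//; exact: expe_ge0.
- move=> w /= ew; apply: (@le_trans _ _ (((a * e) ^- p)%:E * ((a * e)%:E) ^+ p)%E).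
    by rewrite -EFin_expe -EFinM mulVf ?gt_eqF.
  apply: lee_wpmul2l; first by rewrite lee_fin invr_ge0 ltW.
  apply: expe_le; first by rewrite lee_fin mulr_ge0 ?ltW.
  by rewrite EFinM; apply: lee_wpmul2l; [rewrite lee_fin ltW|exact: ltW].
- rewrite ge0_integralZl_EFin//.
  + rewrite [(C * _)%R]mulrC EFinM; apply: lee_wpmul2l => //.
    by rewrite lee_fin invr_ge0 ltW.
  + by move=> w _; exact: expe_ge0.
  + exact: measurable_expe.
  + by rewrite invr_ge0 ltW.
Qed.

End markov_power.

Section iavg_moments.
Context (R : realType) (d : measure_display) (Om : measurableType d)
  (P : probability Om R) (d' : measure_display) (T : measurableType d')
  (mu : probability T R) (X : nat -> {RV P >-> T}) (Xiid : iid mu X).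

Lemma Rintegrable_iavg f n : Rintegrable mu f -> Rintegrable P (iavg X f n).
Proof.
move=> If; apply: RintegrableZ; apply: Rintegrable_sum => i.
exact: (Rintegrable_iid Xiid i If).
Qed.

Lemma Rintegral_iavg f n : (0 < n)%N -> Rintegrable mu f ->
  \int[P]_w iavg X f n w = \int[mu]_x f x.
Proof.
move=> n0 If; rewrite RintegralZl//; last first.
  by apply: Rintegrable_sum => i; exact: (Rintegrable_iid Xiid i If).
rewrite Rintegral_sum; last by move=> i; exact: (Rintegrable_iid Xiid i If).
under eq_bigr do rewrite (Rintegral_iid Xiid _ If).
by rewrite sumr_const card_ord -[X in _ * X]mulr_natl mulKf// pnatr_eq0 -lt0n.
Qed.

(** Jensen's inequality, in the form that an empirical variance is nonnegative. *)
Lemma iavg_sqr_le f n w : iavg X f n w ^+ 2 <= iavg X (fun x => f x ^+ 2) n w.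
Proof.
case: n => [|n]; first by rewrite /iavg !isum0 mulr0 expr0n.
set m := iavg X f n.+1 w.
have n0 : n.+1%:R != 0 :> R by rewrite pnatr_eq0.
have : 0 <= iavg X (fun x => (f x - m) ^+ 2) n.+1 w.
  by rewrite mulr_ge0 ?invr_ge0//; apply: sumr_ge0 => i _; exact: sqr_ge0.
have -> : iavg X (fun x => (f x - m) ^+ 2) n.+1 w =
    iavg X (fun x => f x ^+ 2) n.+1 w - m ^+ 2.
  have mE : isum X f n.+1 w = n.+1%:R * m by rewrite /m /iavg mulVKf.
  have E : isum X (fun x => (f x - m) ^+ 2) n.+1 w = isum X (fun x => f x ^+ 2) n.+1 w -
     2 * m * isum X f n.+1 w + n.+1%:R * m ^+ 2.
    rewrite /isum mulr_sumr -sumrB.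
    have -> : n.+1%:R * m ^+ 2 = \sum_(i < n.+1) m ^+ 2.
      by rewrite sumr_const card_ord mulr_natl.
    by rewrite -big_split/=; apply: eq_bigr => i _; ring.
  by rewrite {1}/iavg E mE [in RHS]/iavg; field.
by rewrite subr_ge0.
Qed.

Lemma iavg_moment2 f n : (0 < n)%N -> L4 mu f ->
  \int[P]_w (iavg X f n w ^+ 2) <= \int[mu]_x (f x ^+ 2).
Proof.
move=> n0 Lf; rewrite -(Rintegral_iavg n0 (Rintegrable2 Lf Lf)).
have Li : L4 P (iavg X f n) by exact: L4Z _ (L4_isum Xiid n Lf).
apply: le_Rintegral => //.
- exact: (Rintegrable2 Li Li).
- by apply: Rintegrable_iavg; exact: Rintegrable2.
- by move=> w _; exact: iavg_sqr_le.
Qed.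

Lemma iavg_moment4 f n : (0 < n)%N -> L4 mu f ->
  \int[P]_w (iavg X f n w ^+ 4) <= \int[mu]_x (f x ^+ 4).
Proof.
move=> n0 Lf; have [_ i4] := Lf; rewrite -(Rintegral_iavg n0 i4).
have [_ Li] : L4 P (iavg X f n) by exact: L4Z _ (L4_isum Xiid n Lf).
apply: le_Rintegral => //; first exact: Rintegrable_iavg.
move=> w _; rewrite -[4%N]/((2 * 2)%N) exprM.
apply: (@le_trans _ _ (iavg X (fun x => f x ^+ 2) n w ^+ 2)).
  rewrite lerXn2r ?nnegrE ?sqr_ge0//; last exact: iavg_sqr_le.
  by apply: le_trans (iavg_sqr_le f n w); exact: sqr_ge0.
by apply: le_trans (iavg_sqr_le _ n w) _; apply: iavg_le => x; rewrite -exprM.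
Qed.

End iavg_moments.

Lemma covariance_error_le (R : realType) (n b x1 x2 x3 y1 y2 z eta u : R) :
  0 <= n -> n * `|x1| <= y1 + u -> n * `|x2| <= y2 + u -> n * `|x3| <= z + z ->
  y1 + y2 <= eta / 4 -> u <= eta / 4 -> z <= eta / 8 ->
  `|b - (b - n * x1 - n * x2 + n * x3)| <= eta.
Proof.
move=> n0 h1 h2 h3 hy hu hz.
have -> : b - (b - n * x1 - n * x2 + n * x3) = n * x1 + n * x2 - n * x3 by ring.
apply: le_trans (ler_normB _ _) _; apply: le_trans (lerD (ler_normD _ _) (lexx _)) _.
rewrite !normrM (ger0_norm n0); lra.
Qed.

Section covariance_limit.
Context (R : realType) (d : measure_display) (Om : measurableType d)
  (P : probability Om R).

Lemma covarianceRE (X Y : Om -> R) :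
  Rintegrable P (fun w => (X w - \int[P]_w X w) * (Y w - \int[P]_w Y w)) ->
  covariance P X Y =
  (\int[P]_w ((X w - \int[P]_w X w) * (Y w - \int[P]_w Y w)))%:E.
Proof.
move=> iXY; rewrite covariance.unlock expectation.unlock -RintegralE//.
Qed.

(** A weighted Young inequality instead of Cauchy-Schwarz: a small [s] will damp the influence term,
    and the remainder is taken small enough to beat the inverse of [s]. *)
Lemma Rintegral_mul_le (f g : Om -> R) s : 0 < s -> L4 P f -> L4 P g ->
  `|\int[P]_w (f w * g w)| <= s * \int[P]_w (f w ^+ 2) + s^-1 * \int[P]_w (g w ^+ 2).
Proof.
move=> s0 Lf Lg.
have iff := Rintegrable2 Lf Lf; have igg := Rintegrable2 Lg Lg.
have ifg := Rintegrable2 Lf Lg.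
apply: le_trans (le_normr_Rintegral _ _) _ => //.
rewrite -!RintegralZl// -RintegralD//; try exact: RintegrableZ.
apply: le_Rintegral => //.
- have [mf _] := Lf; have [mg _] := Lg.
  apply: Rintegrable_le (RintegrableD iff igg) _.
    by apply: measurableT_comp => //; exact: measurable_funM.
  move=> x; rewrite normr_id ler_norml; apply/andP; split.
    have := sqr_ge0 (f x + g x); have := sqr_ge0 (f x); have := sqr_ge0 (g x); lra.
  have := sqr_ge0 (f x - g x); have := sqr_ge0 (f x); have := sqr_ge0 (g x); lra.
- by apply: RintegrableD; exact: RintegrableZ.
- move=> x _; rewrite normrM -(real_normK (num_real (f x))) -(real_normK (num_real (g x))).
  move: (normr_ge0 (f x)) (normr_ge0 (g x)); move: `|f x| `|g x| => a b a0 b0.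
  have : 0 <= s^-1 * (s * a - b) ^+ 2 by rewrite mulr_ge0 ?sqr_ge0// invr_ge0 ltW.
  have -> : s^-1 * (s * a - b) ^+ 2 = s * a ^+ 2 + s^-1 * b ^+ 2 - 2 * (a * b).
    by field; exact: lt0r_neq0.
  have := mulr_ge0 a0 b0; lra.
Qed.

Lemma Rintegral_center2_le (r : Om -> R) : L4 P r ->
  \int[P]_w ((r w - \int[P]_w r w) ^+ 2) <= \int[P]_w (r w ^+ 2).
Proof.
move=> Lr; set m := \int[P]_w r w.
have ir := L4_Rintegrable Lr; have irr := Rintegrable2 Lr Lr.
have -> : \int[P]_w ((r w - m) ^+ 2) = \int[P]_w (r w ^+ 2) - m ^+ 2.
  transitivity (\int[P]_w (r w * r w - 2 * m * r w + m ^+ 2)).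
    by apply: eq_Rintegral => w _; ring.
  rewrite RintegralD//; [|exact: RintegrableB irr (RintegrableZ _ ir)|exact: Rintegrable_cst].
  rewrite RintegralB//; last exact: RintegrableZ.
  by rewrite RintegralZl// Rintegral1 -/m; ring.
by rewrite gerBl sqr_ge0.
Qed.

Context (Xi Xj Li Lj : nat -> Om -> R) (ti tj b bi bj : R)
  (LXi : forall n, (0 < n)%N -> L4 P (Xi n)) (LXj : forall n, (0 < n)%N -> L4 P (Xj n))
  (LLi : forall n, L4 P (Li n)) (LLj : forall n, L4 P (Lj n))
  (Li0 : forall n, \int[P]_w Li n w = 0) (Lj0 : forall n, \int[P]_w Lj n w = 0)
  (Lij : forall n, (0 < n)%N -> \int[P]_w (Li n w * Lj n w) = n%:R^-1 * b)
  (Lii : forall n, (0 < n)%N -> \int[P]_w (Li n w * Li n w) = n%:R^-1 * bi)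
  (Ljj : forall n, (0 < n)%N -> \int[P]_w (Lj n w * Lj n w) = n%:R^-1 * bj)
  (ri0 : forall eta, 0 < eta -> \forall n \near \oo,
     n%:R * \int[P]_w ((Xi n w - ti + Li n w) ^+ 2) <= eta)
  (rj0 : forall eta, 0 < eta -> \forall n \near \oo,
     n%:R * \int[P]_w ((Xj n w - tj + Lj n w) ^+ 2) <= eta).

(** From X = t - L + q with L centred, X - E X = - L + (q - E q). Centring does not increase the
    second moment of q, so the bias of the estimator needs no separate estimate. *)
Lemma covariance_expansion n (X Y L L' : Om -> R) (t t' : R) :
  (0 < n)%N -> L4 P X -> L4 P Y -> L4 P L -> L4 P L' ->
  \int[P]_w L w = 0 -> \int[P]_w L' w = 0 ->
  exists r r' : Om -> R, [/\ L4 P r, L4 P r',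
    \int[P]_w (r w ^+ 2) <= \int[P]_w ((X w - t + L w) ^+ 2),
    \int[P]_w (r' w ^+ 2) <= \int[P]_w ((Y w - t' + L' w) ^+ 2) &
    covariance P X Y = (\int[P]_w (L w * L' w) - \int[P]_w (L w * r' w)
       - \int[P]_w (L' w * r w) + \int[P]_w (r w * r' w))%:E].
Proof.
move=> n0 LX LY LL LL' L0 L'0.
pose q w := X w - t + L w; pose q' w := Y w - t' + L' w.
have Lq : L4 P q by apply: L4D LL; exact: L4D LX (L4_cst _ _).
have Lq' : L4 P q' by apply: L4D LL'; exact: L4D LY (L4_cst _ _).
pose r w := q w - \int[P]_w q w; pose r' w := q' w - \int[P]_w q' w.
have Lr : L4 P r by exact: L4D Lq (L4_cst _ _).
have Lr' : L4 P r' by exact: L4D Lq' (L4_cst _ _).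
exists r, r'; split => //; [exact: Rintegral_center2_le|exact: Rintegral_center2_le|].
have cE (Z : Om -> R) (K : Om -> R) u : L4 P Z -> L4 P K -> \int[P]_w K w = 0 -> forall w,
    Z w - \int[P]_w Z w = - K w + ((Z w - u + K w) - \int[P]_w (Z w - u + K w)).
  move=> LZ LK K0 w.
  have -> : \int[P]_w (Z w - u + K w) = \int[P]_w Z w - u.
    rewrite RintegralD//; last 2 first.
    - exact: RintegrableB (L4_Rintegrable LZ) (Rintegrable_cst _ _).
    - exact: L4_Rintegrable.
    rewrite RintegralB//; last 2 first.
    - exact: L4_Rintegrable.
    - exact: Rintegrable_cst.
    by rewrite K0 Rintegral1 addr0.
  ring.
have E w : (X w - \int[P]_w X w) * (Y w - \int[P]_w Y w) =
   L w * L' w - L w * r' w - L' w * r w + r w * r' w.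
  by rewrite (cE X L t LX LL L0 w) (cE Y L' t' LY LL' L'0 w) -/(q w) -/(q' w) /r /r'; ring.
have i1 := Rintegrable2 LL LL'; have i2 := Rintegrable2 LL Lr'.
have i3 := Rintegrable2 LL' Lr; have i4 := Rintegrable2 Lr Lr'.
have j1 := RintegrableB i1 i2; have j2 := RintegrableB j1 i3; have j3 := RintegrableD j2 i4.
rewrite covarianceRE; last by apply: Rintegrable_eq j3 => w; rewrite E.
congr EFin; under eq_Rintegral do rewrite E.
by rewrite RintegralD// RintegralB// RintegralB.
Qed.

Lemma covariance_limit :
  (n%:R%:E * covariance P (Xi n) (Xj n))%E @[n --> \oo] --> b%:E.
Proof.
have bi0 : 0 <= bi.
  have := Lii (ltn0Sn 0); rewrite invr1 mul1r => <-.
  by apply: Rintegral_ge0 => w _; rewrite -expr2 sqr_ge0.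
have bj0 : 0 <= bj.
  have := Ljj (ltn0Sn 0); rewrite invr1 mul1r => <-.
  by apply: Rintegral_ge0 => w _; rewrite -expr2 sqr_ge0.
have key : forall eta : R, 0 < eta -> \forall n \near \oo, exists c,
    (n%:R%:E * covariance P (Xi n) (Xj n))%E = c%:E /\ `|b - c| <= eta.
  move=> eta eta0.
  (* [s] is fixed first, so that s (bi + bj) <= eta / 4; only then is the bound [z] on the scaled
     remainders chosen, with z / s <= eta / 4. *)
  pose s := eta / 4 / (bi + bj + 1).
  have s0 : 0 < s by rewrite !divr_gt0// ltr_wpDl// addr_ge0.
  have sb : s * bi + s * bj <= eta / 4.
    rewrite -mulrDr.
    rewrite /s -mulrA ler_piMr//; first by rewrite divr_ge0// ltW.
    by rewrite mulrC ler_pdivrMr ?mul1r ?lerDl// ltr_wpDl// addr_ge0.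
  pose z := Num.min (s * (eta / 4)) (eta / 8).
  have z0 : 0 < z.
    by rewrite lt_min; apply/andP; split; [apply: mulr_gt0 => //|]; exact: divr_gt0.
  have zs : s^-1 * z <= eta / 4 by rewrite ler_pdivrMl// ge_min lexx.
  have z4 : z <= eta / 8 by rewrite ge_min lexx orbT.
  near=> n.
  have n0 : (0 < n)%N by near: n; exact: nbhs_infty_gt.
  have n0' : 0 < n%:R :> R by rewrite ltr0n.
  have Ri : n%:R * \int[P]_w ((Xi n w - ti + Li n w) ^+ 2) <= z by near: n; exact: ri0.
  have Rj : n%:R * \int[P]_w ((Xj n w - tj + Lj n w) ^+ 2) <= z by near: n; exact: rj0.
  have [r [r' [Lr Lr' rq rq' ->]]] := covariance_expansion ti tj n0 (LXi n0) (LXj n0)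
    (LLi n) (LLj n) (Li0 n) (Lj0 n).
  exists (n%:R * (\int[P]_w (Li n w * Lj n w) - \int[P]_w (Li n w * r' w)
       - \int[P]_w (Lj n w * r w) + \int[P]_w (r w * r' w))).
  split; first by rewrite EFinM.
  have {}rq : n%:R * \int[P]_w (r w ^+ 2) <= z.
    by apply: le_trans Ri; rewrite ler_pM2l.
  have {}rq' : n%:R * \int[P]_w (r' w ^+ 2) <= z.
    by apply: le_trans Rj; rewrite ler_pM2l.
  have h1 := Rintegral_mul_le s0 (LLi n) Lr'.
  have h2 := Rintegral_mul_le s0 (LLj n) Lr.
  have h3 := Rintegral_mul_le ltr01 Lr Lr'.
  rewrite invr1 !mul1r in h3.
  have e1 : n%:R * \int[P]_w (Li n w ^+ 2) = bi.
    by have := Lii n0; rewrite /= => ->; rewrite mulVKf// gt_eqF.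
  have e2 : n%:R * \int[P]_w (Lj n w ^+ 2) = bj.
    by have := Ljj n0; rewrite /= => ->; rewrite mulVKf// gt_eqF.
  have e3 : n%:R * \int[P]_w (Li n w * Lj n w) = b.
    by rewrite Lij// mulVKf// gt_eqF.
  have {}h1 : n%:R * `|\int[P]_w (Li n w * r' w)| <= s * bi + s^-1 * z.
    apply: le_trans (ler_wpM2l (ltW n0') h1) _; rewrite mulrDr mulrCA e1 lerD2l.
    by rewrite mulrCA ler_pM2l ?invr_gt0.
  have {}h2 : n%:R * `|\int[P]_w (Lj n w * r w)| <= s * bj + s^-1 * z.
    apply: le_trans (ler_wpM2l (ltW n0') h2) _; rewrite mulrDr mulrCA e2 lerD2l.
    by rewrite mulrCA ler_pM2l ?invr_gt0.
  have {}h3 : n%:R * `|\int[P]_w (r w * r' w)| <= z + z.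
    apply: le_trans (ler_wpM2l (ltW n0') h3) _; rewrite mulrDr.
    by rewrite lerD.
  rewrite mulrDr !mulrBr e3.
  exact: (@covariance_error_le R n%:R b _ _ _ _ _ z eta _ (ltW n0') h1 h2 h3 sb zs z4).
apply/fine_cvgP; split.
  by have := key 1 ltr01; apply: filterS => n [c [-> _]].
apply/cvgrPdist_le => eta eta0; have := key eta eta0.
by apply: filterS => n [c [/= -> ]].
Unshelve. all: by end_near. Qed.

End covariance_limit.

(** * Approximation errors and the two estimators *)

Section norm_measurability.
Context (R : realType) (d : measure_display) (Om : measurableType d) (p : nat)
  (N : 'rV[R]_p -> R) (hN : is_norm N).

(* A norm is the infimum over a countable dense set of N (e_n) + C |v - e_n|. *)
Lemma measurable_norm_comp (Y : Om -> 'rV[R]_p) : measurable_mx Y ->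
  measurable_fun setT (fun w => N (Y w)).
Proof.
move=> mY; have [C C0 NC] := is_norm_le hN; have [_ _ _ NT] := hN.
have [e [_ de]] := @dense_sequence R p setT (ex_intro _ 0 I).
(* Signs are reversed to turn the infimum into a supremum of measurable functions. *)
pose h (n : nat) w : R := - N (e n) - C * `|Y w - e n|.
have mh n : measurable_fun setT (h n).
  apply: measurable_funB => //; apply: measurable_funM => //.
  apply: measurable_mxnorm => i j; under eq_fun do rewrite mxBE.
  by apply: measurable_funB => //; exact: mY.
have hle n w : h n w <= - N (Y w).
  rewrite /h -opprD lerN2 -[Y w in X in X <= _](subrK (e n)).
  by rewrite (le_trans (NT _ _))// addrC lerD2l NC.
have E w : N (Y w) = - sups (h ^~ w) 0.
  apply: oppr_inj; rewrite opprK; apply/esym/eqP; rewrite eq_le; apply/andP; split.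
    apply: ge_sup; first by exists (h 0%N w); exists 0%N.
    by move=> _ [n _ <-].
  apply/ler_addgt0Pr => eps eps0.
  have [|n un] := de (Y w) (eps / (2 * C + 1)) I.
    by rewrite divr_gt0// ltr_wpDl// mulr_ge0.
  have hs : h n w <= sups (h ^~ w) 0.
    apply: ub_le_sup; last by exists n.
    by exists (- N (Y w)) => _ [m _ <-].
  have NC1 := NC (e n - Y w).
  have NT1 : N (e n) <= N (e n - Y w) + N (Y w) by rewrite -[leLHS](congr1 N (subrK (Y w) _)) NT.
  move: un; rewrite ltr_pdivlMr ?ltr_wpDl ?mulr_ge0// => un.
  move: hs; rewrite /h distrC; have := normr_ge0 (e n - Y w); nra.
under eq_fun do rewrite E.
apply: measurableT_comp => //; apply: measurable_fun_sups => // w _.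
by exists (- N (Y w)) => _ [n _ <-].
Qed.

End norm_measurability.

Section powers.
Context (R : realType).

Lemma pow_le_1D (x : R) (a b : nat) : (a <= b)%N -> ~~ odd a -> ~~ odd b ->
  x ^+ a <= 1 + x ^+ b.
Proof.
move=> ab oa ob.
have E c : ~~ odd c -> x ^+ c = `|x| ^+ c.
  by move=> oc; rewrite -normrX ger0_norm// exprn_even_ge0.
rewrite (E a oa) (E b ob); have [x1|x1] := leP `|x| 1.
  by rewrite -[leLHS]addr0 lerD ?exprn_ile1 ?exprn_ge0.
by rewrite -[leLHS]add0r lerD// ler_weXn2l// ltW.
Qed.

Context (dT : measure_display) (T : measurableType dT) (mu : probability T R)
  (XX : set T) (mXX : measurable XX) (f : T -> R) (mf : measurable_fun XX f).

Lemma integral_patch_pow12 :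
  (\int[mu]_x ((f \_ XX) x ^+ 12)%:E = \int[mu]_(x in XX) (f x ^+ 12)%:E)%E.
Proof.
rewrite [RHS]integral_mkcond; apply: eq_integral => x _.
rewrite !patchE; case: ifP => // _; by rewrite expr0n.
Qed.

Hypothesis f12 : (\int[mu]_(x in XX) (f x ^+ 12)%:E < +oo)%E.

Lemma Rintegrable_pow12 : Rintegrable mu (fun x => (f \_ XX) x ^+ 12).
Proof.
have mpf := measurable_patch mXX mf.
apply/integrableP; split; first by apply/measurable_EFinP; exact: measurable_funX.
under eq_integral do rewrite gee0_abs ?lee_fin ?exprn_even_ge0//.
by rewrite integral_patch_pow12.
Qed.

Lemma Rintegrable_pow (a : nat) : (a <= 12)%N -> ~~ odd a ->
  Rintegrable mu (fun x => (f \_ XX) x ^+ a).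
Proof.
move=> a12 oa; have mpf := measurable_patch mXX mf.
apply: Rintegrable_le (RintegrableD (Rintegrable_cst mu 1) Rintegrable_pow12) _.
  exact: measurable_funX.
by move=> x; rewrite ger0_norm ?exprn_even_ge0//; exact: pow_le_1D.
Qed.

Lemma Rintegral_pow_le (a : nat) : (a <= 12)%N -> ~~ odd a ->
  \int[mu]_x ((f \_ XX) x ^+ a) <= 1 + \int[mu]_x ((f \_ XX) x ^+ 12).
Proof.
move=> a12 oa; rewrite -{1}(Rintegral1 mu 1) -RintegralD//; last 2 first.
- exact: Rintegrable_cst.
- exact: Rintegrable_pow12.
apply: le_Rintegral => //; first exact: Rintegrable_pow.
- exact: RintegrableD (Rintegrable_cst mu 1) Rintegrable_pow12.
- by move=> x _; exact: pow_le_1D.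
Qed.

Lemma L4_patch : L4 mu (f \_ XX).
Proof. by split; [exact: measurable_patch|exact: Rintegrable_pow]. Qed.

Lemma L4_patch_sqr : L4 mu (fun x => (f \_ XX) x ^+ 2).
Proof.
have mpf := measurable_patch mXX mf; split; first exact: measurable_funX.
by apply: Rintegrable_eq (@Rintegrable_pow 8 isT isT) => x; rewrite -exprM.
Qed.

End powers.

Lemma supnorm_leP (R : realType) (T V : Type) (N : V -> R) (S : set T) (f : T -> V) (r : R) t :
  (supnorm N S f <= r%:E)%E -> S t -> N (f t) <= r.
Proof.
move=> sr St; rewrite -lee_fin; apply: le_trans sr.
by apply: ereal_sup_ubound; exists t.
Qed.

Lemma supnorm_ge0 (R : realType) (T : Type) (V : lmodType R) (N : V -> R) (S : set T)
  (f : T -> V) t : is_norm N -> S t -> (0 <= supnorm N S f)%E.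
Proof.
move=> [N0 _ _ _] St; apply: (@le_trans _ _ (N (f t))%:E); first by rewrite lee_fin.
by apply: ereal_sup_ubound; exists t.
Qed.

Lemma scaled_supnorm_le (R : realType) (T V : Type) (N : V -> R) (S : set T) (f : T -> V)
    (a r : R) t :
  0 < a -> (a%:E * supnorm N S f <= r%:E)%E -> S t -> N (f t) <= r / a.
Proof.
move=> a0 ar St; rewrite ler_pdivlMr// mulrC -lee_fin EFinM; apply: le_trans ar.
apply: lee_wpmul2l; first by rewrite lee_fin ltW.
by apply: ereal_sup_ubound; exists t.
Qed.

Lemma norm_le_constant (R : realType) (nrm : forall p r : nat, 'M[R]_(p, r) -> R)
    (hnrm : forall p r : nat, is_norm (nrm p r)) (d k : nat) :
  exists2 C : R, 0 < C &
    [/\ forall A : 'rV[R]_k, `|A| <= C * nrm 1%N k A,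
        forall A : 'M[R]_(d, k), `|A| <= C * nrm d k A,
        forall A : 'M[R]_(d, d * k), `|A| <= C * nrm d (d * k)%N A &
        forall A : 'M[R]_k, `|A| <= C * nrm k k A].
Proof.
have [a a0 Ha] := is_norm_ge (hnrm 1%N k).
have [b b0 Hb] := is_norm_ge (hnrm d k).
have [c c0 Hc] := is_norm_ge (hnrm d (d * k)%N).
have [e e0 He] := is_norm_ge (hnrm k k).
have weaken p r (C C' : R) : C <= C' -> (forall A : 'M[R]_(p, r), `|A| <= C * nrm p r A) ->
    forall A : 'M[R]_(p, r), `|A| <= C' * nrm p r A.
  move=> CC' H A; apply: le_trans (H A) _; apply: ler_wpM2r => //.
  by have [] := hnrm p r.
exists (a + b + c + e); first lra.
split; [apply: weaken Ha|apply: weaken Hb|apply: weaken Hc|apply: weaken He]; lra.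
Qed.

Lemma mean_dist_le (R : realType) (d : measure_display) (Om : measurableType d)
    (P : probability Om R) (d' : measure_display) (T : measurableType d')
    (X : nat -> {RV P >-> T}) (XX : set T) (XXX : forall i w, XX (X i w))
    (p r : nat) (f g : T -> 'M[R]_(p, r)) (h : T -> R) (n : nat) w :
  (forall x, XX x -> `|f x - g x| <= h x) ->
  `|n%:R^-1 *: \sum_(i < n) f (X i w) - n%:R^-1 *: \sum_(i < n) g (X i w)|
    <= iavg X h n w.
Proof.
move=> fgh; rewrite -scalerBr -sumrB normrZ ger0_norm ?invr_ge0//.
apply: ler_wpM2l; first by rewrite invr_ge0.
apply: le_trans (ler_norm_sum _ _ _) _.
by apply: ler_sum => i _; exact: fgh.
Qed.

Lemma scaled_integral_le (R : realType) (d : measure_display) (Om : measurableType d)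
    (P : probability Om R) (n : nat) (f g h : Om -> R) (a b l : R) :
  (0 < n)%N -> measurable_fun setT f -> measurable_fun setT g -> measurable_fun setT h ->
  (forall w, 0 <= f w) -> (forall w, 0 <= g w) -> (forall w, 0 <= h w) -> 0 <= l ->
  (forall w, h w <= l * (f w + g w)) ->
  (n%:R%:E * \int[P]_w (f w)%:E <= a%:E)%E -> (n%:R%:E * \int[P]_w (g w)%:E <= b%:E)%E ->
  (n%:R%:E * \int[P]_w (h w)%:E <= (l * (a + b))%:E)%E.
Proof.
move=> n0 mf mg mh f0 g0 h0 l0 hfg; have n0' : 0 < n%:R :> R by rewrite ltr0n.
rewrite -!lee_pdivlMl// -!EFinM => fa gb.
have := le_integralZ (measurable_funD mf mg : measurable_fun setT (fun w => f w + g w)) (fun w => addr_ge0 (f0 w) (g0 w)) l0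
  (le_integralD mf mg f0 g0 fa gb).
rewrite (_ : l * (n%:R^-1 * a + n%:R^-1 * b) = n%:R^-1 * (l * (a + b))); last by ring.
apply: le_trans; apply: ge0_le_integral => //.
- by move=> w _; rewrite lee_fin.
- by apply/measurable_EFinP.
- by apply/measurable_EFinP; apply: measurable_funM => //; exact: measurable_funD.
- by move=> w _; rewrite lee_fin.
Qed.

(** Turns the difference of two estimators into the difference of their remainders: the target [t]
    and the common influence [i] cancel. *)
Lemma subr_shift (V : zmodType) (u v t i : V) : u - v = (u - t + i) - (v - t + i).
Proof. by rewrite opprD addrACA subrr addr0 opprB addrA subrK. Qed.

(** * The exact and the approximate estimator, and efficiency along a sequence *)

Section two_step.
Context (R : realType) (nrm : forall p r : nat, 'M[R]_(p, r) -> R)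
  (hnrm : forall p r : nat, is_norm (nrm p r))
  (dT : measure_display) (T : measurableType dT) (mu : probability T R)
  (XX : set T) (mXX : measurable XX) (d k : nat)
  (dOm : measure_display) (Om : measurableType dOm) (P : probability Om R)
  (X : nat -> {RV P >-> T})
  (hXiid : iid mu X) (hXval : forall i w, XX (X i w))
  (Theta : set 'rV[R]_d)
  (Phi : 'rV[R]_d -> T -> 'rV[R]_k)
  (hPhimeas : forall t (j : 'I_k), Theta t ->
     measurable_fun XX (fun x => Phi t x 0 j))
  (Phim : nat -> Om -> 'rV[R]_d -> T -> 'rV[R]_k)
  (hTheta : compact Theta)
  (hcont : {within Theta, continuous (fun t => mxint mu XX (Phi t))})
  (theta0 : 'rV[R]_d)
  (hzero : mxint mu XX (Phi theta0) = 0)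
  (huniq : forall t, Theta t -> mxint mu XX (Phi t) = 0 -> t = theta0)
  (hPhicont : forall x, XX x -> {within Theta, continuous (fun t => Phi t x)})
  (N : set 'rV[R]_d) (hN0 : N theta0) (hNTheta : N `<=` Theta)
  (hPhiC2 : forall x, XX x ->
     twice_continuously_differentiable_on N (fun t => Phi t x))
  (hD : \rank (mean_jacobian mu XX Phi theta0) = d)
  (hV : \rank (second_moment mu XX (Phi theta0)) = k)
  (kappa : T -> R)
  (hkmeas : measurable_fun XX kappa)
  (hkdom : forall x, XX x ->
     [/\ (supnorm (nrm 1%N k) Theta (fun t => Phi t x) <= (kappa x)%:E)%E,
         (supnorm (nrm d k) N (fun t => 'J (fun s => Phi s x) t)
            <= (kappa x)%:E)%E &
         (supnorm (nrm d (d * k)%N) N (hessian (fun s => Phi s x))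
            <= (kappa x)%:E)%E])
  (hkmom : (\int[mu]_(x in XX) (kappa x ^+ 12)%:E < +oo)%E)
  (phi : nat -> R) (hphi : phi m @[m --> \oo] --> +oo)
  (hPhimdiff : forall m w x t, XX x -> N t ->
     differentiable (fun s => Phim m w s x) t)
  (kappam : nat -> T -> R)
  (hkmmeas : forall m, measurable_fun XX (kappam m))
  (hkmdom : forall m w x, XX x ->
     ((phi m)%:E
        * supnorm (nrm 1%N k) Theta (fun t => (Phim m w t x - Phi t x)%R)
        <= (kappam m x)%:E)%E /\
     ((phi m)%:E
        * supnorm (nrm d k) N
            (fun t => ('J (fun s => Phim m w s x) t
                       - 'J (fun s => Phi s x) t)%R)
        <= (kappam m x)%:E)%E)
  (hkmmom : (ereal_sup
     (range (fun m => \int[mu]_(x in XX) (kappam m x ^+ 12)%:E)) < +oo)%E)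
  (hcov : forall t, Theta t -> covmx mu XX (Phi t) \in unitmx)
  (What : forall n, n.-tuple T ->
     (T -> 'rV[R]_k) -> 'M[R]_k)
  (hWsupmeas : forall n, (0 < n)%N ->
     measurable_fun setT (fun w =>
       supnorm (nrm k k) Theta (fun t =>
         weight_estimator What Phi (sample X n w) t
         - optimal_weight mu XX Phi t)) /\
     forall m, measurable_fun setT (fun w =>
       supnorm (nrm k k) Theta (fun t =>
         weight_estimator What (Phim m w) (sample X n w) t
         - weight_estimator What Phi (sample X n w) t)))
  (CW : R)
  (hWmom : forall n, (0 < n)%N ->
     (\int[P]_w ((Num.sqrt n%:R)%:E *
         supnorm (nrm k k) Theta (fun t =>
           (weight_estimator What Phi (sample X n w) t
            - optimal_weight mu XX Phi t)%R)) ^+ 6 <= CW%:E)%E /\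
     forall m, (\int[P]_w ((phi m)%:E *
         supnorm (nrm k k) Theta (fun t =>
           (weight_estimator What (Phim m w) (sample X n w) t
            - weight_estimator What Phi (sample X n w) t)%R)) ^+ 3
         <= CW%:E)%E)
  (CN : R) (CN0 : 0 < CN)
  (nrm1k : forall A : 'rV[R]_k, `|A| <= CN * nrm 1%N k A)
  (nrmdk : forall A : 'M[R]_(d, k), `|A| <= CN * nrm d k A)
  (nrmdh : forall A : 'M[R]_(d, d * k), `|A| <= CN * nrm d (d * k)%N A)
  (nrmkk : forall A : 'M[R]_k, `|A| <= CN * nrm k k A)
  (r0 : R) (r0_gt0 : 0 < r0) (r0N : ball theta0 r0 `<=` N).

(** The factor [CN] converts envelopes for the given norms into envelopes for the maximum norm. *)
Definition dom (f : T -> R) (x : T) : R := CN * (f \_ XX) x.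

Lemma L4_dom (f : T -> R) : measurable_fun XX f ->
  (\int[mu]_(x in XX) (f x ^+ 12)%:E < +oo)%E -> L4 mu (dom f).
Proof. by move=> mf f12; have L := L4_patch mXX mf f12; exact: L4Z _ L. Qed.

Lemma L4_dom_sqr (f : T -> R) : measurable_fun XX f ->
  (\int[mu]_(x in XX) (f x ^+ 12)%:E < +oo)%E -> L4 mu (fun x => dom f x ^+ 2).
Proof.
move=> mf f12; rewrite (_ : (fun x => _) = fun x => CN ^+ 2 * (f \_ XX) x ^+ 2).
  exact: L4Z _ (L4_patch_sqr mXX mf f12).
by apply/funext => x; rewrite /dom exprMn.
Qed.

Lemma dom_in f x : XX x -> dom f x = CN * f x.
Proof. by move=> Xx; rewrite /dom patch_in. Qed.

Lemma dom_kappa_ge0 x : 0 <= dom kappa x.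
Proof.
apply: mulr_ge0; first exact: ltW.
have [Xx|nX] := pselect (XX x); last by rewrite patch_notin.
rewrite patch_in//; have [h _ _] := hkdom Xx.
have [n0 _ _ _] := hnrm 1%N k.
apply: le_trans (n0 (Phi theta0 x)) (supnorm_leP h _); exact: hNTheta.
Qed.

Lemma Phi_le_dom t x : Theta t -> XX x -> `|Phi t x| <= dom kappa x.
Proof.
move=> Tt Xx; rewrite dom_in//; have [h _ _] := hkdom Xx.
apply: le_trans (nrm1k _) _; apply: ler_wpM2l; first exact: ltW.
exact: (supnorm_leP h Tt).
Qed.

Lemma r0_ball s : `|s - theta0| < r0 -> N s.
Proof. by move=> sr; apply: r0N; rewrite -ball_normE/= distrC. Qed.

Lemma ball_Theta : ball theta0 r0 `<=` Theta.
Proof. exact: subset_trans r0N hNTheta. Qed.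

Lemma Phi_derivatives_le x s : XX x -> `|s - theta0| < r0 ->
  [/\ differentiable (fun t => Phi t x) s,
      differentiable (fun u => 'J (fun t => Phi t x) u) s,
      `|'J (fun t => Phi t x) s| <= dom kappa x &
      `|hessian (fun t => Phi t x) s| <= dom kappa x].
Proof.
move=> Xx /r0_ball Ns; have [d1 d2 _] := hPhiC2 Xx Ns.
have [_ h1 h2] := hkdom Xx; split; [exact: d1|exact: d2| |]; rewrite dom_in//.
  apply: le_trans (nrmdk _) _; apply: ler_wpM2l; first exact: ltW.
  exact: (supnorm_leP h1 Ns).
apply: le_trans (nrmdh _) _; apply: ler_wpM2l; first exact: ltW.
exact: (supnorm_leP h2 Ns).
Qed.

(** The envelopes [kappam] are deterministic although the approximations are random, so this bound
    is a function of the sample alone. The absolute value keeps it nonnegative even where [phi m] is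
    not positive. *)
Definition mean_error (n m : nat) (w : Om) : R :=
  `|iavg X (dom (kappam m)) n w / phi m|.

Lemma mean_error_ge0 n m w : 0 <= mean_error n m w.
Proof. exact: normr_ge0. Qed.

Lemma iavg_dom f (a : R) n w :
  iavg X (fun x => dom f x / a) n w = iavg X (dom f) n w / a.
Proof. by rewrite /iavg /isum -mulr_suml mulrA. Qed.

Lemma mean_error_bound : \forall m \near \oo, forall n w, (0 < n)%N ->
  (forall t, Theta t -> `|empirical_mean (sample X n w) (Phim m w t) -
     empirical_mean (sample X n w) (Phi t)| <= mean_error n m w) /\
  (forall s, `|s - theta0| < r0 ->
     differentiable (fun t => empirical_mean (sample X n w) (Phim m w t)) s /\
     `|'J (fun t => empirical_mean (sample X n w) (Phim m w t)) s -
       'J (fun t => empirical_mean (sample X n w) (Phi t)) s| <= mean_error n m w).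
Proof.
near=> m => n w n0.
have p0 : 0 < phi m by apply: (@lt_le_trans _ _ 1) => //; near: m; exact: (phi_ge hphi).
have avg p r (f g : T -> 'M[R]_(p, r)) :
    (forall x, XX x -> `|f x - g x| <= CN * (kappam m x / phi m)) ->
    `|n%:R^-1 *: \sum_(i < n) f (X i w) - n%:R^-1 *: \sum_(i < n) g (X i w)|
      <= mean_error n m w.
  move=> fg; apply: le_trans (ler_norm _); rewrite -iavg_dom.
  by apply: (mean_dist_le hXval) => x Xx; rewrite dom_in// -mulrA; exact: fg.
split.
  move=> t Tt; rewrite /empirical_mean.
  under eq_bigr do rewrite tnth_mktuple.
  under [in X in _ - X]eq_bigr do rewrite tnth_mktuple.
  apply: avg => x Xx; have [h _] := hkmdom m w Xx.
  apply: le_trans (nrm1k _) _; apply: ler_wpM2l; first exact: ltW.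
  exact: (scaled_supnorm_le p0 h Tt).
move=> s /r0_ball Ns.
have [dm Jm] := @empirical_mean_diff R d k n Om _ (Phim m w) (fun i => X i) w s
  (fun i => hPhimdiff m w (hXval i w) Ns).
have dPhi i : differentiable (fun t => Phi t (X i w)) s.
  by have [] := hPhiC2 (hXval i w) Ns.
have [_ J0] := @empirical_mean_diff R d k n Om _ Phi (fun i => X i) w s dPhi.
split; first exact: dm.
rewrite Jm J0.
apply: (avg _ _ (fun x => 'J (fun t => Phim m w t x) s) (fun x => 'J (fun t => Phi t x) s)).
move=> x Xx; have [_ h] := hkmdom m w Xx.
apply: le_trans (nrmdk _) _; apply: ler_wpM2l; first exact: ltW.
exact: (scaled_supnorm_le p0 h Ns).
Unshelve. all: by end_near. Qed.

Lemma kappam_finite m : (\int[mu]_(x in XX) (kappam m x ^+ 12)%:E < +oo)%E.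
Proof.
apply: le_lt_trans hkmmom; apply: ereal_sup_ubound; by exists m.
Qed.

Lemma L4_mean m n : L4 P (iavg X (dom (kappam m)) n).
Proof.
exact: L4Z _ (L4_isum hXiid n (L4_dom (hkmmeas m) (kappam_finite m))).
Qed.

Lemma dom_kappam_moment : exists2 S : R, 0 <= S & forall m a, (a <= 12)%N -> ~~ odd a ->
  \int[mu]_x (dom (kappam m) x ^+ a) <= CN ^+ a * (1 + S).
Proof.
pose e := ereal_sup (range (fun m => \int[mu]_(x in XX) (kappam m x ^+ 12)%:E))%E.
have em m : (\int[mu]_(x in XX) (kappam m x ^+ 12)%:E <= e)%E.
  by apply: ereal_sup_ubound; exists m.
have e0 : (0 <= e)%E.
  apply: le_trans (em 0%N); apply: integral_ge0 => x _.
  by rewrite lee_fin exprn_even_ge0.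
have ef : e \is a fin_num by rewrite ge0_fin_numE.
exists (fine e); first exact: fine_ge0.
move=> m a a12 oa; have mk := hkmmeas m; have fk := kappam_finite m.
have -> : \int[mu]_x (dom (kappam m) x ^+ a) = CN ^+ a * \int[mu]_x ((kappam m \_ XX) x ^+ a).
  rewrite -RintegralZl//; last exact: (Rintegrable_pow mXX mk fk a12 oa).
  by apply: eq_Rintegral => x _; rewrite /dom exprMn.
apply: ler_wpM2l; first by rewrite exprn_ge0// ltW.
apply: le_trans (Rintegral_pow_le mXX mk fk a12 oa) _.
rewrite lerD2l -lee_fin -RintegralE; last exact: (Rintegrable_pow12 mXX mk fk).
by rewrite integral_patch_pow12 fineK.
Qed.

(** The second moment enters the mean-square bound, the fourth makes large errors rare. By Jensen's
    inequality neither grows with [n]. *)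
Lemma mean_error_moment a : (a = 2)%N \/ (a = 4)%N ->
  exists2 K : R, 0 <= K & forall n m, (0 < n)%N ->
  (\int[P]_w (mean_error n m w ^+ a)%:E <= (K / phi m ^+ a)%:E)%E.
Proof.
move=> a24; have [S S0 HS] := dom_kappam_moment.
have oa : ~~ odd a by case: a24 => ->.
have a12 : (a <= 12)%N by case: a24 => ->.
exists (CN ^+ a * (1 + S)).
  by apply: mulr_ge0; [rewrite exprn_ge0// ltW|rewrite addr_ge0].
move=> n m n0; have Lm := L4_mean m n.
have Ia : Rintegrable P (fun w => iavg X (dom (kappam m)) n w ^+ a).
  by case: a24 => ->; [exact: (Rintegrable2 Lm Lm)|exact: (proj2 Lm)].
have E w : mean_error n m w ^+ a = (phi m ^+ a)^-1 * iavg X (dom (kappam m)) n w ^+ a.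
  rewrite /mean_error -normrX ger0_norm; last by rewrite exprn_even_ge0.
  by rewrite expr_div_n mulrC.
under eq_integral do rewrite E.
rewrite RintegralE; last exact: RintegrableZ.
rewrite RintegralZl// lee_fin mulrC; apply: ler_wpM2r.
  by rewrite invr_ge0 exprn_even_ge0.
have LK := L4_dom (hkmmeas m) (kappam_finite m).
apply: le_trans (HS m a a12 oa).
by case: a24 => ->; [exact: iavg_moment2|exact: iavg_moment4].
Qed.

Lemma mean_error_measurable n m : measurable_fun setT (mean_error n m).
Proof.
have [mi _] := L4_mean m n.
by apply: measurableT_comp => //; exact: measurable_funM.
Qed.

Lemma rare_mean_error (e : R) : 0 < e -> rare P phi (fun n m => [set w | e < mean_error n m w]).
Proof.
move=> e0; have [K K0 HK] := mean_error_moment (or_intror erefl).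
apply: (rare_phi3 hphi (C := e ^- 4 * K)).
  by move=> n m; apply: measurable_gt; exact: mean_error_measurable.
near=> m => n n0.
have p1 : 1 <= phi m by near: m; exact: (phi_ge hphi).
have p0 : 0 < phi m by exact: lt_le_trans p1.
have mE := mean_error_measurable n m.
apply: (@prob_le_integral _ _ _ P _ (fun w => (e ^- 4 * mean_error n m w ^+ 4)%:E)).
- exact: measurable_gt.
- by apply/measurable_EFinP; apply: measurable_funM => //; exact: measurable_funX.
- by move=> w; rewrite lee_fin mulr_ge0// ?invr_ge0 exprn_ge0 ?mean_error_ge0// ltW.
- move=> w /= ew; rewrite lee_fin ler_pdivlMl ?exprn_gt0// mulr1 lerXn2r ?nnegrE ?mean_error_ge0//.
    exact: ltW.
  exact: ltW.
apply: le_trans (le_integralZ _ _ _ (HK n m n0)) _.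
- exact: measurable_funX.
- by move=> w; rewrite exprn_ge0// mean_error_ge0.
- by rewrite invr_ge0 exprn_ge0// ltW.
rewrite lee_fin -mulrA; apply: ler_wpM2l; first by rewrite invr_ge0 exprn_ge0// ltW.
apply: ler_wpM2l => //.
by rewrite lef_pV2 ?posrE ?exprn_gt0// ler_weXn2l.
Unshelve. all: by end_near. Qed.

Lemma supnorm_event (Y : Om -> 'rV[R]_d -> 'M[R]_k) (e : R) :
  [set w | ~ forall t, Theta t -> `|Y w t| <= e] `<=`
  [set w | ((e / CN)%:E < supnorm (@nrm k k) Theta (Y w))%E].
Proof.
move=> w /=; apply: contra_notP => /negP; rewrite -leNgt => h t Tt.
apply: le_trans (nrmkk _) _; rewrite mulrC -ler_pdivlMr//.
exact: (supnorm_leP h Tt).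
Qed.

Lemma supnorm_Theta_ge0 (f : 'rV[R]_d -> 'M[R]_k) : (0 <= supnorm (@nrm k k) Theta f)%E.
Proof. exact: (@supnorm_ge0 _ _ _ _ _ _ theta0 (@hnrm k k) (hNTheta hN0)). Qed.

Lemma CW_ge0 : 0 <= CW.
Proof.
have [h _] := hWmom (ltn0Sn 0); rewrite -lee_fin; apply: le_trans h.
apply: integral_ge0 => w _; apply: expe_ge0; apply: mule_ge0; last exact: supnorm_Theta_ge0.
by rewrite lee_fin sqrtr_ge0.
Qed.

(** The sixth power of sqrt n yields n^-3, weakened to the order n^-2 that [rare] admits. *)
Lemma sqrt_pow6_le (n : nat) (e : R) : 0 < e -> (0 < n)%N ->
  CW * (Num.sqrt n%:R * e) ^- 6 <= CW * e ^- 6 * n%:R ^- 2.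
Proof.
move=> e0 n0; rewrite exprMn invfM -mulrA [X in _ <= _ * X]mulrC.
apply: ler_wpM2l; first exact: CW_ge0.
apply: ler_wpM2r; first by rewrite invr_ge0 exprn_ge0// ltW.
rewrite (_ : 6%N = (2 * 3)%N)// exprM sqr_sqrtr//.
by rewrite lef_pV2 ?posrE ?exprn_gt0 ?ltr0n// ler_weXn2l// ler1n.
Qed.

(** The rate [psi] is left free because the exact estimator is treated with the rate m instead of
    phi_m. *)
Lemma rare_weight (psi : nat -> R) (e : R) : psi m @[m --> \oo] --> +oo -> 0 < e ->
  rare P psi (fun n m => [set w | ~ forall t, Theta t ->
    `|weight_estimator What Phi (sample X n w) t - optimal_weight mu XX Phi t| <= e]).
Proof.
move=> psioo e0; have eCN : 0 < e / CN by exact: divr_gt0.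
pose S n w := supnorm (@nrm k k) Theta (fun t =>
  weight_estimator What Phi (sample X n w) t - optimal_weight mu XX Phi t).
(* The covering events must be measurable for every [n], while the supremum is only known to be
   measurable for positive [n]; hence the empty event at 0. *)
pose A n (m : nat) := if (0 < n)%N then [set w | ((e / CN)%:E < S n w)%E] else set0.
apply: (@rare_sub _ _ _ P psi _ A).
  by apply: nearW => m n n0; rewrite /A n0; exact: supnorm_event.
apply: (rare_n2 psioo (C := CW * (e / CN) ^- 6)).
  move=> n m; rewrite /A; case: ifP => [n0|_]; last exact: measurable0.
  by apply: measurable_egt; have [] := hWsupmeas n0.
move=> n m n0; rewrite /A n0.
have [mS _] := hWsupmeas n0; have [IS _] := hWmom n0.
apply: (le_trans (markov_power mS _ _ eCN IS)).
- by move=> w; exact: supnorm_Theta_ge0.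
- by rewrite sqrtr_gt0 ltr0n.
- by rewrite lee_fin; exact: sqrt_pow6_le.
Qed.

(** Markov's inequality at order three: this event is the one that dictates phi_m^-3 in [rare]. *)
Lemma rare_weightm (e : R) : 0 < e ->
  rare P phi (fun n m => [set w | ~ forall t, Theta t ->
    `|weight_estimator What (Phim m w) (sample X n w) t -
      weight_estimator What Phi (sample X n w) t| <= e]).
Proof.
move=> e0; have eCN : 0 < e / CN by exact: divr_gt0.
pose S n m w := supnorm (@nrm k k) Theta (fun t =>
  weight_estimator What (Phim m w) (sample X n w) t -
  weight_estimator What Phi (sample X n w) t).
pose A n m := if (0 < n)%N then [set w | ((e / CN)%:E < S n m w)%E] else set0.
apply: (@rare_sub _ _ _ P phi _ A).
  by apply: nearW => m n n0; rewrite /A n0; exact: supnorm_event.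
apply: (rare_phi3 hphi (C := CW * (e / CN) ^- 3)).
  move=> n m; rewrite /A; case: ifP => [n0|_]; last exact: measurable0.
  by have [_ mS] := hWsupmeas n0; apply: measurable_egt; exact: mS.
near=> m => n n0; rewrite /A n0.
have p0 : 0 < phi m by apply: (@lt_le_trans _ _ 1) => //; near: m; exact: (phi_ge hphi).
have [_ mS] := hWsupmeas n0; have [_ IS] := hWmom n0.
apply: (le_trans (markov_power (mS m) _ p0 eCN (IS m))).
  by move=> w; exact: supnorm_Theta_ge0.
by rewrite lee_fin exprMn invfM mulrA mulrAC.
Unshelve. all: by end_near. Qed.

Context (thetahat : nat -> Om -> 'rV[R]_d)
  (thetahatm : nat -> nat -> Om -> 'rV[R]_d)
  (hthmeas : forall n, measurable_mx (thetahat n))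
  (hthmmeas : forall n m, measurable_mx (thetahatm n m))
  (hthgmm : forall n w, (0 < n)%N ->
     two_step_gmm Theta What Phi (sample X n w) (thetahat n w))
  (hthmgmm : forall n m w, (0 < n)%N ->
     two_step_gmm Theta What (Phim m w) (sample X n w) (thetahatm n m w)).

Let infl n w := influence mu XX X Phi theta0 n w.

Lemma approximate_remainder : exists2 C : R, 0 <= C & forall eta : R, 0 < eta ->
  \forall n \near \oo & m \near \oo,
    (n%:R%:E * \int[P]_w (`|thetahatm n m w - theta0 + infl n w| ^+ 2)%:E <=
     (C * (n%:R / phi m ^+ 2) + eta)%:E)%E.
Proof.
have [K K0 HK] := mean_error_moment (or_introl erefl).
have Lk := L4_dom hkmeas hkmom; have Lk2 := L4_dom_sqr hkmeas hkmom.
apply: (@gmm_remainder _ _ _ mu XX mXX _ _ P X hXiid hXval phi hphi d k Theta hTheta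
  Phi hPhimeas hPhicont (dom kappa) Lk Lk2 dom_kappa_ge0 Phi_le_dom theta0 hzero r0
  r0_gt0 ball_Theta hcont hcov hV Phi_derivatives_le huniq hD What Phim mean_error
  mean_error_ge0 mean_error_bound rare_mean_error (fun e => rare_weight hphi (e := e))
  rare_weightm thetahatm hthmgmm mean_error_measurable K K0 _ hthmmeas).
by apply: nearW => m n n0; exact: HK.
Qed.

(* The case Phi_m = Phi and phi_m = m of the previous estimate. *)
Lemma exact_remainder (eta : R) : 0 < eta -> \forall n \near \oo,
  (n%:R%:E * \int[P]_w (`|thetahat n w - theta0 + infl n w| ^+ 2)%:E <= eta%:E)%E.
Proof.
move=> eta0; have Lk := L4_dom hkmeas hkmom; have Lk2 := L4_dom_sqr hkmeas hkmom.
have idoo : (n%:R : R) @[n --> \oo] --> +oo by exact: cvgr_idn.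
have [] := @gmm_remainder _ _ _ mu XX mXX _ _ P X hXiid hXval _ idoo d k Theta hTheta
  Phi hPhimeas hPhicont (dom kappa) Lk Lk2 dom_kappa_ge0 Phi_le_dom theta0 hzero r0
  r0_gt0 ball_Theta hcont hcov hV Phi_derivatives_le huniq hD What (fun _ _ => Phi)
  (fun _ _ _ => 0) (fun _ _ _ => lexx 0) _ _ (fun e => rare_weight idoo (e := e)) _
  (fun n _ => thetahat n) (fun n _ w => @hthgmm n w) _ 0 (lexx 0)
  _ (fun n _ => hthmeas n).
- apply: nearW => m n w n0; split => [t _|s /r0_ball Ns]; first by rewrite subrr normr0.
  have dPhi i : differentiable (fun t => Phi t (X i w)) s.
    by have [] := hPhiC2 (hXval i w) Ns.
  have [dm _] := @empirical_mean_diff R d k n Om _ Phi (fun i => X i) w s dPhi.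
  by split; [exact: dm|rewrite subrr normr0].
- move=> e e0; apply: rare_sub (rare_set0 _ _); apply: nearW => m n _ w /=.
  by rewrite ltNge ltW.
- move=> e e0; apply: rare_sub (rare_set0 _ _); apply: nearW => m n _ w /=.
  by case=> t _; rewrite subrr normr0 ltW.
- by move=> n m; exact: measurable_cst.
- apply: nearW => m n n0; rewrite expr0n/= integral0 mul0r//.
move=> C C0 /(_ (eta / 2) (divr_gt0 eta0 (ltr0Sn _ _)))[[A B] [/= nA nB] AB].
apply: filterS nA => n An.
(* The left-hand side does not depend on m, so for each [n] an m large enough for C n / m^2 <= eta /
   2 may be used. *)
have : \forall m \near \oo, B m /\ C * (n%:R / m%:R ^+ 2) <= eta / 2.
  apply: filterI => //.
  near=> m.
  have m1 : C * n%:R / (eta / 2) + 1 <= m%:R by near: m; exact: (phi_ge idoo).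
  have c0 : 0 <= C * n%:R / (eta / 2).
    by apply: divr_ge0; [exact: mulr_ge0|exact: (divr_ge0 (ltW eta0))].
  have m0 : 1 <= m%:R :> R by apply: le_trans m1; rewrite lerDr.
  have mm : 0 < m%:R ^+ 2 :> R by rewrite exprn_gt0// (lt_le_trans ltr01).
  have m2 : C * n%:R / (eta / 2) <= m%:R by apply: le_trans m1; rewrite lerDl.
  rewrite ler_pdivrMr in m2; last exact: divr_gt0.
  rewrite mulrA ler_pdivrMr//; apply: le_trans m2 _; rewrite mulrC.
  apply: ler_wpM2l; first exact: (divr_ge0 (ltW eta0)).
  by rewrite expr2 ler_peMr// (le_trans ler01).
move=> /filter_ex[m [Bm Cm]].
apply: le_trans (AB (n, m) (conj An Bm)) _.
by rewrite lee_fin [leRHS]splitr lerD2r.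
Unshelve. all: by end_near. Qed.

Context (CU : R) (CU0 : 0 <= CU) (nrm1d : forall v : 'rV[R]_d, @nrm 1%N d v <= CU * `|v|).

Lemma nrm_sqr_le (u v : 'rV[R]_d) :
  @nrm 1%N d (u - v) ^+ 2 <= 2 * CU ^+ 2 * (`|u| ^+ 2 + `|v| ^+ 2).
Proof.
have [n0 _ _ _] := hnrm 1%N d.
have h : @nrm 1%N d (u - v) <= CU * (`|u| + `|v|).
  by apply: le_trans (nrm1d _) _; apply: ler_wpM2l => //; exact: ler_normB.
apply: (@le_trans _ _ ((CU * (`|u| + `|v|)) ^+ 2)).
  by rewrite lerXn2r ?nnegrE ?n0// (le_trans (n0 _) h).
rewrite exprMn (_ : 2 * CU ^+ 2 * _ = CU ^+ 2 * (2 * (`|u| ^+ 2 + `|v| ^+ 2))); last by ring.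
apply: ler_wpM2l; first exact: sqr_ge0.
have := sqr_ge0 (`|u| - `|v|); move: (`|u|) (`|v|) => a b; nra.
Qed.

Lemma remainderm_measurable n m :
  measurable_fun setT (fun w => `|thetahatm n m w - theta0 + infl n w| ^+ 2).
Proof.
have Lk := L4_dom hkmeas hkmom.
apply: measurable_funX; apply: measurable_mxnorm.
exact: (remainder_measurable mXX hXiid hXval hPhimeas Lk dom_kappa_ge0 Phi_le_dom r0_gt0
  ball_Theta hthmmeas).
Qed.

Lemma remainder0_measurable n :
  measurable_fun setT (fun w => `|thetahat n w - theta0 + infl n w| ^+ 2).
Proof.
have Lk := L4_dom hkmeas hkmom.
apply: measurable_funX; apply: measurable_mxnorm.
exact: (@remainder_measurable _ _ _ _ _ mXX _ _ _ _ hXiid hXval _ _ _ _ hPhimeas _ Lk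
  dom_kappa_ge0 Phi_le_dom _ _ r0_gt0 ball_Theta (fun n _ => thetahat n)
  (fun n _ => hthmeas n) n 0%N).
Qed.

Lemma nrm_measurable (Y : Om -> 'rV[R]_d) : measurable_mx Y ->
  measurable_fun setT (fun w => @nrm 1%N d (Y w)).
Proof. exact: (measurable_norm_comp (@hnrm 1%N d)). Qed.

Lemma difference_measurable n m :
  measurable_fun setT (fun w => @nrm 1%N d (thetahatm n m w - thetahat n w)).
Proof.
apply: nrm_measurable => i j; under eq_fun do rewrite mxBE.
by apply: measurable_funB; [exact: hthmmeas|exact: hthmeas].
Qed.

Lemma difference_L4 n m : (0 < n)%N ->
  L4 P (fun w => @nrm 1%N d (thetahatm n m w - thetahat n w)).
Proof.
move=> n0; have [b b0 hb] := Theta_bounded hTheta theta0.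
apply: L4_le (L4_cst P (CU * (b + b))) _; first exact: difference_measurable.
move=> w; have [nn0 _ _ _] := hnrm 1%N d; rewrite ger0_norm//.
apply: le_trans (nrm1d _) _; apply: ler_wpM2l => //.
rewrite -(subrKA theta0); apply: le_trans (ler_normD _ _) _; apply: lerD.
  by apply: hb; exact: two_step_gmm_in (hthmgmm m w n0).
rewrite distrC; apply: hb.
exact: two_step_gmm_in (hthgmm w n0).
Qed.

Definition mean_sqr_difference (c : nat * nat) : R :=
  c.1%:R * \int[P]_w (@nrm 1%N d (thetahatm c.1 c.2 w - thetahat c.1 w) ^+ 2).

Lemma mean_sqr_differenceE n m : (0 < n)%N ->
  (n%:R%:E * \int[P]_w (@nrm 1%N d (thetahatm n m w - thetahat n w) ^+ 2)%:E)%E =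
  (mean_sqr_difference (n, m))%:E.
Proof.
move=> n0; have L := difference_L4 m n0.
by rewrite RintegralE//; exact: (Rintegrable2 L L).
Qed.

Lemma difference_bound : exists2 C : R, 0 <= C & forall eta : R, 0 < eta ->
  \forall n \near \oo & m \near \oo,
    mean_sqr_difference (n, m) <= C * (n%:R / phi m ^+ 2) + eta.
Proof.
have [C C0 HC] := approximate_remainder.
pose l := 2 * CU ^+ 2; have l0 : 0 <= l by rewrite mulr_ge0// sqr_ge0.
exists (l * C); first exact: mulr_ge0.
move=> eta eta0; pose e := eta / (2 * (l + 1)).
have l1 : 0 < l + 1 by apply: ltr_wpDl.
have e0 : 0 < e by apply: divr_gt0 => //; exact: mulr_gt0.
have le : l * (e + e) <= eta.
  rewrite (_ : l * (e + e) = l / (l + 1) * eta); last by rewrite /e; field; rewrite gt_eqF.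
  by rewrite ler_piMl ?(ltW eta0)// ler_pdivrMr// mul1r lerDl.
have [[A B] [/= nA nB] AB] := HC e e0.
exists ([set n | A n /\ (0 < n)%N /\ (n%:R%:E *
   \int[P]_w (`|thetahat n w - theta0 + infl n w| ^+ 2)%:E <= e%:E)%E], B); first split => //=.
  apply: filterI => //; apply: filterI; first exact: nbhs_infty_gt.
  exact: exact_remainder.
move=> [n m] [/= [An [n0 H0]] Bm].
have Hm := AB (n, m) (conj An Bm).
rewrite -lee_fin -mean_sqr_differenceE//.
apply: le_trans (scaled_integral_le n0 (remainderm_measurable n m) (remainder0_measurable n)
  _ (fun w => sqr_ge0 _) (fun w => sqr_ge0 _) (fun w => sqr_ge0 _) l0 _ Hm H0) _.
- by apply: measurable_funX; exact: difference_measurable.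
- by move=> w; rewrite (subr_shift _ _ theta0 (infl n w)); exact: nrm_sqr_le.
- by rewrite lee_fin -addrA mulrDr mulrA lerD2l.
Qed.

(** Truncation turns a bound C x + eta, valid eventually for each eta, into O(x) + o(1): [u] is the
    quantity cut off at C x, and [v] is its positive excess over C x, eventually below every eta. *)
Lemma mean_sqr_difference_expansion : exists u v : nat * nat -> R^o,
  [/\ forall c, mean_sqr_difference c = u c + v c,
      u =O_ (filter_prod \oo \oo) (fun c : nat * nat => c.1%:R / phi c.2 ^+ 2 : R^o) &
      v =o_ (filter_prod \oo \oo) (fun=> 1 : R^o)].
Proof.
have [C C0 HC] := difference_bound.
pose Q c : R := mean_sqr_difference c.
pose g (c : nat * nat) : R := C * (c.1%:R / phi c.2 ^+ 2).
have Q0 c : 0 <= Q c.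
  by apply: mulr_ge0 => //; apply: Rintegral_ge0 => w _; exact: sqr_ge0.
have g0 c : 0 <= c.1%:R / phi c.2 ^+ 2 :> R by rewrite divr_ge0// sqr_ge0.
exists (fun c => Num.min (Q c) (g c)), (fun c => Q c - Num.min (Q c) (g c)); split.
- by move=> c; rewrite addrC subrK.
- apply/eqOP; near=> K; near=> c.
  have KC : C <= K by near: K; apply: nbhs_pinfty_ge; exact: num_real.
  rewrite /= !ger0_norm//; last by rewrite le_min Q0 mulr_ge0.
  by rewrite ge_min; apply/orP; right; apply: ler_wpM2r.
- apply/eqoP => eta eta0.
  have := HC eta eta0; apply: filterS => -[n m] /= h.
  rewrite normr1 mulr1 ger0_norm; last by rewrite subr_ge0 ge_min lexx.
  rewrite lerBlDl /Order.min; case: ifP => _; first by rewrite lerDl ltW.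
  exact: h.
Unshelve. all: by end_near. Qed.

Context (m_ : nat -> nat) (m_oo : m_ n @[n --> \oo] --> \oo)
  (phi_m_ : n%:R / phi (m_ n) ^+ 2 @[n --> \oo] --> (0 : R)).

Lemma sequence_remainder (eta : R) : 0 < eta -> \forall n \near \oo,
  (n%:R%:E * \int[P]_w (`|thetahatm n (m_ n) w - theta0 + infl n w| ^+ 2)%:E <= eta%:E)%E.
Proof.
move=> eta0; have [C C0 HC] := approximate_remainder.
have e0 : 0 < eta / 2 by exact: divr_gt0.
have [[A B] [/= nA nB] AB] := HC _ e0.
have CR : C * (n%:R / phi (m_ n) ^+ 2) @[n --> \oo] --> C * 0 by exact: cvgMr.
rewrite mulr0 in CR; have /cvgrPdist_le /(_ _ e0) CR' := CR.
near=> n.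
have An : A n by near: n.
have Bn : B (m_ n) by near: n; exact: m_oo.
apply: le_trans (AB (n, m_ n) (conj An Bn)) _.
rewrite lee_fin [leRHS]splitr lerD2r.
have : `|0 - C * (n%:R / phi (m_ n) ^+ 2)| <= eta / 2 by near: n.
by rewrite sub0r normrN; apply: le_trans; exact: ler_norm.
Unshelve. all: by end_near. Qed.

Lemma thetahatm_L4 n m i : (0 < n)%N -> L4 P (fun w => thetahatm n m w 0 i).
Proof.
move=> n0; have [b b0 hb] := Theta_bounded hTheta theta0.
apply: L4_le (L4_cst P (b + `|theta0|)) _; first exact: hthmmeas.
move=> w; apply: le_trans (mxentry_le _ _ _) _; rewrite -[X in `|X|](subrK theta0).
apply: le_trans (ler_normD _ _) _; rewrite lerD2r.
by apply: hb; exact: two_step_gmm_in (hthmgmm m w n0).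
Qed.

Lemma infl_L4 n i : L4 P (fun w => infl n w 0 i).
Proof.
exact: (L4_influence mXX hXiid hXval hPhimeas (L4_dom hkmeas hkmom) dom_kappa_ge0
  Phi_le_dom r0_gt0 ball_Theta n i).
Qed.

Let B := efficiency_bound mu XX Phi theta0.

Lemma infl_moment2 n i j : (0 < n)%N ->
  \int[P]_w (infl n w 0 i * infl n w 0 j) = n%:R^-1 * B i j.
Proof.
exact: (Rintegral_influence2 mXX hXiid hXval hPhimeas (L4_dom hkmeas hkmom) dom_kappa_ge0
  Phi_le_dom hzero r0_gt0 ball_Theta hV hD i j).
Qed.

Lemma sequence_variance : asymptotic_variance P (fun n => thetahatm n (m_ n)) B.
Proof.
have r i (eta : R) : 0 < eta -> \forall n \near \oo,
    n%:R * \int[P]_w ((thetahatm n (m_ n) w 0 i - theta0 0 i + infl n w 0 i) ^+ 2) <= eta.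
  move=> eta0; near=> n.
  have n0 : (0 < n)%N by near: n; exact: nbhs_infty_gt.
  have H : (n%:R%:E * \int[P]_w (`|thetahatm n (m_ n) w - theta0 + infl n w| ^+ 2)%:E <=
    eta%:E)%E by near: n; exact: sequence_remainder.
  have L : L4 P (fun w => thetahatm n (m_ n) w 0 i - theta0 0 i + infl n w 0 i).
    apply: L4D (infl_L4 n i); exact: L4D (thetahatm_L4 (m_ n) i n0) (L4_cst _ _).
  have [mL _] := L.
  rewrite -lee_fin EFinM -RintegralE; last exact: (Rintegrable2 L L).
  apply: le_trans H; apply: lee_wpmul2l; first by rewrite lee_fin.
  apply: ge0_le_integral => //.
  - by move=> w _; rewrite lee_fin sqr_ge0.
  - by apply/measurable_EFinP; exact: measurable_funX.
  - by apply/measurable_EFinP; exact: remainderm_measurable.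
  move=> w _; rewrite lee_fin -real_normK ?num_real// lerXn2r ?nnegrE//.
  by have := mxentry_le (thetahatm n (m_ n) w - theta0 + infl n w) 0 i; rewrite mxE mxBE.
have z n i : \int[P]_w infl n w 0 i = 0.
  exact: (Rintegral_influence mXX hXiid hXval hPhimeas (L4_dom hkmeas hkmom) dom_kappa_ge0
    Phi_le_dom hzero r0_gt0 ball_Theta n i).
move=> i j.
apply: (@covariance_limit _ _ _ P (fun n w => thetahatm n (m_ n) w 0 i)
  (fun n w => thetahatm n (m_ n) w 0 j) (fun n w => infl n w 0 i) (fun n w => infl n w 0 j)
  (theta0 0 i) (theta0 0 j) (B i j) (B i i) (B j j)).
- by move=> n n0; exact: thetahatm_L4.
- by move=> n n0; exact: thetahatm_L4.
- by move=> n; exact: infl_L4.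
- by move=> n; exact: infl_L4.
- by move=> n; exact: z.
- by move=> n; exact: z.
- by move=> n; exact: infl_moment2.
- by move=> n; exact: infl_moment2.
- by move=> n; exact: infl_moment2.
- exact: r.
- exact: r.
Unshelve. all: by end_near. Qed.

Lemma sequence_root_n : root_n_consistent P (@nrm 1%N d) (fun n => thetahatm n (m_ n)) theta0.
Proof.
(* Eventual bound for n times the mean square error: 1 from the remainder, the diagonal of [B] from
   the influence, and 2 CU^2 from the norm of their difference. *)
pose b : R := 2 * CU ^+ 2 * (1 + \sum_j `|B j j|).
have s0 : 0 <= \sum_j `|B j j| by apply: sumr_ge0.
have l0 : 0 <= 2 * CU ^+ 2 by rewrite mulr_ge0// sqr_ge0.
have b0 : 0 <= b by apply: mulr_ge0 => //; exact: addr_ge0.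
have [nn0 _ _ _] := hnrm 1%N d.
(* Markov's inequality for the square gives b / K^2, which is at most [e] because b / e <= K <=
   K^2. *)
move=> e e0; pose K : R := b / e + 1.
have K1 : 1 <= K by rewrite lerDr divr_ge0// ltW.
have K0 : 0 < K by exact: lt_le_trans K1.
exists K; near=> n.
have n0 : (0 < n)%N by near: n; exact: nbhs_infty_gt.
have n0' : 0 < n%:R :> R by rewrite ltr0n.
have H : (n%:R%:E * \int[P]_w (`|thetahatm n (m_ n) w - theta0 + infl n w| ^+ 2)%:E <=
  1%:E)%E by near: n; exact: sequence_remainder.
have ms : measurable_fun setT (fun w => \sum_j infl n w 0 j ^+ 2).
  by apply: measurable_sum => j; have [mi _] := infl_L4 n j; exact: measurable_funX.
have Hs : (n%:R%:E * \int[P]_w (\sum_j infl n w 0 j ^+ 2)%:E <= (\sum_j `|B j j|)%:E)%E.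
  rewrite RintegralE; last first.
    by apply: Rintegrable_sum => j; apply: (Rintegrable2 (infl_L4 n j) (infl_L4 n j)).
  rewrite -EFinM lee_fin Rintegral_sum; last first.
    by move=> j; apply: (Rintegrable2 (infl_L4 n j) (infl_L4 n j)).
  rewrite mulr_sumr; apply: ler_sum => j _.
  have := infl_moment2 j j n0; rewrite /= => ->.
  by rewrite mulVKf ?gt_eqF// ler_norm.
have md : measurable_fun setT (fun w => @nrm 1%N d (thetahatm n (m_ n) w - theta0)).
  apply: nrm_measurable => i j; under eq_fun do rewrite mxBE.
  by apply: measurable_funB => //; exact: hthmmeas.
have Hd := scaled_integral_le n0 (remainderm_measurable n (m_ n)) ms
  (measurable_funX 2 md) (fun w => sqr_ge0 _)
  (fun w => sumr_ge0 _ (fun j _ => sqr_ge0 _)) (fun w => sqr_ge0 _) l0 _ H Hs.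
have {}Hd : (n%:R%:E * \int[P]_w (@nrm 1%N d (thetahatm n (m_ n) w - theta0) ^+ 2)%:E <=
    b%:E)%E.
  apply: Hd => w; rewrite -{1}[X in nrm X](addrK (infl n w)).
  apply: le_trans (nrm_sqr_le _ _) _; apply: ler_wpM2l => //; rewrite lerD2l.
  by apply: mxnorm_exp_le.
apply: (@prob_le_integral _ _ _ P _ (fun w => (K ^- 2 * (n%:R *
  @nrm 1%N d (thetahatm n (m_ n) w - theta0) ^+ 2))%:E)).
- by apply: measurable_gt; exact: measurable_funM.
- apply/measurable_EFinP; apply: measurable_funM => //; apply: measurable_funM => //.
  exact: measurable_funX.
- move=> w; rewrite lee_fin; apply: mulr_ge0; first by rewrite invr_ge0 sqr_ge0.
  by apply: mulr_ge0 => //; exact: sqr_ge0.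
- move=> w /= Kw; rewrite lee_fin ler_pdivlMl ?exprn_gt0// mulr1.
  have -> : n%:R * @nrm 1%N d (thetahatm n (m_ n) w - theta0) ^+ 2 =
     (Num.sqrt n%:R * @nrm 1%N d (thetahatm n (m_ n) w - theta0)) ^+ 2.
    by rewrite exprMn sqr_sqrtr.
  have Kw' := ltW Kw.
  by rewrite lerXn2r ?nnegrE ?(ltW K0)// (le_trans (ltW K0) Kw').
have mn : measurable_fun setT (fun w => n%:R * @nrm 1%N d (thetahatm n (m_ n) w - theta0) ^+ 2).
  by apply: measurable_funM => //; exact: measurable_funX.
apply: (@le_trans _ _ (K ^- 2 * b)%:E).
  apply: (le_integralZ mn).
  - by move=> w; apply: mulr_ge0 => //; exact: sqr_ge0.
  - by rewrite invr_ge0 sqr_ge0.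
  under eq_integral do rewrite EFinM.
  rewrite ge0_integralZl_EFin//.
  - by move=> w _; rewrite lee_fin sqr_ge0.
  - by apply/measurable_EFinP; exact: measurable_funX.
rewrite lee_fin ler_pdivrMl ?exprn_gt0// -ler_pdivrMr//.
apply: (@le_trans _ _ K); first by rewrite lerDl.
by rewrite expr2 ler_peMr// ltW.
Unshelve. all: by end_near. Qed.

End two_step.

Theorem theorem4p1 (R : realType)
  (* any norm on each space of matrices *)
  (nrm : forall p r : nat, 'M[R]_(p, r) -> R)
  (hnrm : forall p r : nat, is_norm (nrm p r))
  (q d k : nat) (hdk : (d <= k)%N)
  (XX : set 'rV[R]_q) (hXX : open XX)
  (mu : probability (borel_rV R q) R) (hmu : mu XX = 1%E)
  (dOm : measure_display) (Om : measurableType dOm) (P : probability Om R)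
  (* the sample *)
  (X : nat -> {RV P >-> borel_rV R q})
  (hXiid : iid mu X) (hXval : forall i w, XX (X i w))
  (Theta : set 'rV[R]_d)
  (* the constraint function and its approximations *)
  (Phi : 'rV[R]_d -> borel_rV R q -> 'rV[R]_k)
  (hPhimeas : forall t (j : 'I_k), Theta t ->
     measurable_fun (XX : set (borel_rV R q)) (fun x => Phi t x 0 j))
  (Phim : nat -> Om -> 'rV[R]_d -> borel_rV R q -> 'rV[R]_k)
  (hPhimmeas : forall m t x, Theta t -> XX x ->
     measurable_mx (fun w => Phim m w t x))
  (hPhimindep : forall n : nat,
     independent_sigma P
       (sigma_of
          [set c : nat * 'rV[R]_d * 'rV[R]_q * 'I_k |
             Theta c.1.1.2 /\ XX c.1.2]
          (fun c w => Phim c.1.1.1 w c.1.1.2 c.1.2 0 c.2))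
       (sigma_of [set i | (i < n)%N] (fun i w => X i w)))
  (* (1) *)
  (hTheta : compact Theta)
  (* (2) *)
  (hcont : {within Theta, continuous (fun t => mxint mu XX (Phi t))})
  (theta0 : 'rV[R]_d)
  (hzero : mxint mu XX (Phi theta0) = 0)
  (huniq : forall t, Theta t -> mxint mu XX (Phi t) = 0 -> t = theta0)
  (hint : interior Theta theta0)
  (* (3) *)
  (hPhicont : forall x, XX x -> {within Theta, continuous (fun t => Phi t x)})
  (hPhidom : exists2 g : borel_rV R q -> R, mu.-integrable XX (EFin \o g) &
     forall x, XX x ->
       (supnorm (nrm 1%N k) Theta (fun t => Phi t x) <= (g x)%:E)%E)
  (* (4) *)
  (N : set 'rV[R]_d) (hNopen : open N) (hN0 : N theta0) (hNTheta : N `<=` Theta)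
  (hPhiC2 : forall x, XX x ->
     twice_continuously_differentiable_on N (fun t => Phi t x))
  (hPhiC2cont : forall x, XX x ->
     {within N, continuous (fun t => nrm d k ('J (fun s => Phi s x) t))} /\
     {within N, continuous
        (fun t => nrm d (d * k)%N (hessian (fun s => Phi s x) t))})
  (hPhiC2dom : exists2 g : borel_rV R q -> R, mu.-integrable XX (EFin \o g) &
     forall x t, XX x -> N t ->
       nrm d k ('J (fun s => Phi s x) t) <= g x /\
       nrm d (d * k)%N (hessian (fun s => Phi s x) t) <= g x)
  (* (5) *)
  (hD : \rank (mean_jacobian mu XX Phi theta0) = d)
  (hV : \rank (second_moment mu XX (Phi theta0)) = k)
  (* (6) *)
  (kappa : borel_rV R q -> R)
  (hkmeas : measurable_fun (XX : set (borel_rV R q)) kappa)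
  (hkdom : forall x, XX x ->
     [/\ (supnorm (nrm 1%N k) Theta (fun t => Phi t x) <= (kappa x)%:E)%E,
         (supnorm (nrm d k) N (fun t => 'J (fun s => Phi s x) t)
            <= (kappa x)%:E)%E &
         (supnorm (nrm d (d * k)%N) N (hessian (fun s => Phi s x))
            <= (kappa x)%:E)%E])
  (hkmom : (\int[mu]_(x in XX) (kappa x ^+ 12)%:E < +oo)%E)
  (* (7) *)
  (phi : nat -> R) (hphi : phi m @[m --> \oo] --> +oo)
  (hPhimdiff : forall m w x t, XX x -> N t ->
     differentiable (fun s => Phim m w s x) t)
  (kappam : nat -> borel_rV R q -> R)
  (hkmmeas : forall m, measurable_fun (XX : set (borel_rV R q)) (kappam m))
  (hkmdom : forall m w x, XX x ->
     ((phi m)%:E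
        * supnorm (nrm 1%N k) Theta (fun t => (Phim m w t x - Phi t x)%R)
        <= (kappam m x)%:E)%E /\
     ((phi m)%:E
        * supnorm (nrm d k) N
            (fun t => ('J (fun s => Phim m w s x) t
                       - 'J (fun s => Phi s x) t)%R)
        <= (kappam m x)%:E)%E)
  (hkmmom : (ereal_sup
     (range (fun m => \int[mu]_(x in XX) (kappam m x ^+ 12)%:E)) < +oo)%E)
  (* the optimal weight W and its estimator *)
  (hcov : forall t, Theta t -> covmx mu XX (Phi t) \in unitmx)
  (What : forall n, n.-tuple (borel_rV R q) ->
     (borel_rV R q -> 'rV[R]_k) -> 'M[R]_k)
  (hWmeas : forall n t, (0 < n)%N -> Theta t ->
     measurable_mx (fun w => weight_estimator What Phi (sample X n w) t) /\
     forall m, measurable_mx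
       (fun w => weight_estimator What (Phim m w) (sample X n w) t))
  (hWcons : forall t, Theta t ->
     consistent_in_probability P (nrm k k)
       (fun n w => weight_estimator What Phi (sample X n w) t)
       (optimal_weight mu XX Phi t))
  (* (8) *)
  (hWdiff : forall n w t, (0 < n)%N -> N t ->
     differentiable (weight_estimator What Phi (sample X n w)) t)
  (hWsupmeas : forall n, (0 < n)%N ->
     [/\ measurable_fun setT (fun w =>
           supnorm (nrm k k) Theta (fun t =>
             weight_estimator What Phi (sample X n w) t
             - optimal_weight mu XX Phi t)),
         measurable_fun setT (fun w =>
           supnorm (nrm d (k * k)%N) N (fun t =>
             mxgrad (weight_estimator What Phi (sample X n w)) t
             - mxgrad (optimal_weight mu XX Phi) t)) &
         forall m, measurable_fun setT (fun w =>
           supnorm (nrm k k) Theta (fun t =>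
             weight_estimator What (Phim m w) (sample X n w) t
             - weight_estimator What Phi (sample X n w) t))])
  (hWmom : exists C : R, forall n, (0 < n)%N ->
     [/\ (\int[P]_w ((Num.sqrt n%:R)%:E *
             supnorm (nrm k k) Theta (fun t =>
               (weight_estimator What Phi (sample X n w) t
                - optimal_weight mu XX Phi t)%R)) ^+ 6 <= C%:E)%E,
         (\int[P]_w ((Num.sqrt n%:R)%:E *
             supnorm (nrm d (k * k)%N) N (fun t =>
               (mxgrad (weight_estimator What Phi (sample X n w)) t
                - mxgrad (optimal_weight mu XX Phi) t)%R)) ^+ 6 <= C%:E)%E &
         forall m, (\int[P]_w ((phi m)%:E *
             supnorm (nrm k k) Theta (fun t =>
               (weight_estimator What (Phim m w) (sample X n w) t
                - weight_estimator What Phi (sample X n w) t)%R)) ^+ 3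
             <= C%:E)%E])
  (* the estimators *)
  (thetahat : nat -> Om -> 'rV[R]_d)
  (thetahatm : nat -> nat -> Om -> 'rV[R]_d)
  (hthmeas : forall n, measurable_mx (thetahat n))
  (hthmmeas : forall n m, measurable_mx (thetahatm n m))
  (hthgmm : forall n w, (0 < n)%N ->
     two_step_gmm Theta What Phi (sample X n w) (thetahat n w))
  (hthmgmm : forall n m w, (0 < n)%N ->
     two_step_gmm Theta What (Phim m w) (sample X n w) (thetahatm n m w)) :
  (exists u v : nat * nat -> R^o,
    [/\ forall n m, (0 < n)%N ->
          (n%:R%:E * 'E_P[fun w => (nrm 1%N d (thetahatm n m w - thetahat n w)%R
                                    ^+ 2)%R])%E
          = (u (n, m) + v (n, m))%:E,
        u =O_ (filter_prod \oo \oo)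
          (fun c : nat * nat => c.1%:R / phi c.2 ^+ 2 : R^o) &
        v =o_ (filter_prod \oo \oo) (fun=> 1 : R^o)]) /\
  (forall m_ : nat -> nat, m_ n @[n --> \oo] --> \oo ->
    n%:R / phi (m_ n) ^+ 2 @[n --> \oo] --> (0 : R) ->
    root_n_consistent P (nrm 1%N d) (fun n => thetahatm n (m_ n)) theta0 /\
    asymptotic_variance P (fun n => thetahatm n (m_ n))
      (efficiency_bound mu XX Phi theta0)).
Proof.
have mXX : measurable (XX : set (borel_rV R q)) by apply: sub_sigma_algebra; exact: hXX.
have [CN CN0 [n1k ndk ndh nkk]] := norm_le_constant hnrm d k.
have [CU CU0 n1d] := is_norm_le (hnrm 1%N d).
have /nbhs_ballP[r0 r0_gt0 r0N] : nbhs theta0 N by exact: open_nbhs_nbhs.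
have [CW HCW] := hWmom.
have WM n (n0 : (0 < n)%N) := let: And3 a _ b := hWsupmeas n n0 in conj a b.
have HW n (n0 : (0 < n)%N) := let: And3 a _ b := HCW n n0 in conj a b.
split.
  have [u [v [uv uO vo]]] := mean_sqr_difference_expansion hnrm mXX hXiid hXval hPhimeas hTheta hcont hzero huniq hPhicont hN0 hNTheta hPhiC2 hD hV
    hkmeas hkdom hkmom hphi hPhimdiff hkmmeas hkmdom hkmmom hcov WM HW CN0 n1k ndk ndh nkk r0_gt0 r0N
    hthmeas hthmmeas hthgmm hthmgmm CU0 n1d.
  exists u, v; split => // n m n0.
  rewrite -uv expectation.unlock.
  exact: (mean_sqr_differenceE hnrm hTheta theta0 hthmeas hthmmeas hthgmm hthmgmm CU0 n1d).
move=> m_ m_oo phi_m_; split.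
  exact: (sequence_root_n hnrm mXX hXiid hXval hPhimeas hTheta hcont hzero huniq hPhicont hN0 hNTheta hPhiC2 hD hV
    hkmeas hkdom hkmom hphi hPhimdiff hkmmeas hkmdom hkmmom hcov WM HW CN0 n1k ndk ndh nkk r0_gt0 r0N
    hthmmeas hthmgmm CU0 n1d m_oo phi_m_).
exact: (sequence_variance hnrm mXX hXiid hXval hPhimeas hTheta hcont hzero huniq hPhicont hN0 hNTheta hPhiC2 hD hV
    hkmeas hkdom hkmom hphi hPhimdiff hkmmeas hkmdom hkmmom hcov WM HW CN0 n1k ndk ndh nkk r0_gt0 r0N
  hthmmeas hthmgmm m_oo phi_m_).
Qed.
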